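(* Let $M>0$ and let $(B_N)_{N\ge 1}$ be a sequence of deterministic Hermitian $N\times N$ matrices with $\sup_N\|B_N\|_\infty<M$. Let $\theta\in\mathbb{R}\setminus\{0\}$ with $|\theta|<\frac{1}{4M^2+10M+1}$. Let $D_{2N}=\mathrm{diag}(\lambda_1,\lambda_1,\lambda_2,\lambda_2,\dots,\lambda_N,\lambda_N)$, where $\lambda_1,\dots,\lambda_N$ are the eigenvalues of $B_N$. Then for any given $n$, as $N\to\infty$, $$I_N^{(2)}(\theta,B_N)=I_{2N}^{(1)}\Big(\frac{\theta}{2},D_{2N}\Big)=e^{N\int_0^{\theta}R_{B_N}(s)\,ds}\left\{m_0+\frac{m_1}{N}+\frac{m_2}{N^2}+\cdots+\frac{m_n}{N^n}+O\Big(\frac{1}{N^{n+1}}\Big)\right\},$$ where the coefficients $m_0,\dots,m_n$ depend only on $\theta$, $v$ and $A_2,\dots,A_{2n+2}$, i.e. on the derivatives of the Hilbert transform of the empirical spectral distribution of $B_N$ at $v+\frac1\theta$ (that is, they are functions of these quantities, with no other dependence on $N$ or $B_N$). In particular $$m_0=\frac{1}{\sqrt{A_2}},\qquad m_1=\frac{1}{2\sqrt{A_2}}\left(\frac{3}{2}\frac{A_4}{A_2^2}-\frac{5}{3}\frac{A_3^2}{A_2^3}+\frac16\right).$$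
   Context: $\|B\|_\infty$ denotes the operator norm of $B$, i.e. the maximum of $|\lambda|$ over the eigenvalues $\lambda$ of $B$. For $\beta\in\{1,2\}$ the rank one spherical integral is $$I_N^{(\beta)}(\theta,B_N)=\int\exp\{\theta N\,(e_1^{*}B_Ne_1)\}\,dm_N^{(\beta)}(U),$$ where $m_N^{(\beta)}$ is the Haar probability measure on the orthogonal group $O(N)$ if $\beta=1$ and on the unitary group $U(N)$ if $\beta=2$, and $e_1$ is the first column of $U$. For a Hermitian matrix $B$ of size $N$ with eigenvalues $\lambda_1,\dots,\lambda_N$, let $H_B(z)=\frac1N\sum_{i=1}^N\frac{1}{z-\lambda_i}$ for $z\in\mathbb{R}\setminus[\lambda_{\min}(B),\lambda_{\max}(B)]$ (the Hilbert transform of its empirical spectral distribution). $H_B$ is a bijection from $(-\infty,\lambda_{\min}(B))\cup(\lambda_{\max}(B),\infty)$ onto $\mathbb{R}\setminus\{0\}$; let $H_B^{-1}$ be its inverse and let $R_B(z)=H_B^{-1}(z)-\frac1z$ for $z\in\mathbb{R}\setminus\{0\}$ (the $R$-transform). Here $v=R_{B_N}(\theta)$ and, for $k\ge1$, $$A_k=\frac{(-1)^{k-1}}{(k-1)!\,\theta^k}\frac{d^{k-1}H_{B_N}}{dz^{k-1}}\Big(v+\frac1{\theta}\Big)=\frac1N\sum_{i=1}^N\frac{1}{(1-\theta\lambda_i+\theta v)^k}.$$ The quantities $v$, $A_k$ depend on $N$. $O(N^{-l})$ denotes a quantity bounded in magnitude by $CN^{-l}$ for some constant $C>0$ independent of $N$.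 *)

(* Defs.v *)
From HB Require Import structures.
From mathcomp Require Import all_boot all_order all_algebra.
From mathcomp Require Import spectral.
From mathcomp Require Import complex.
From mathcomp Require Import all_classical all_reals all_analysis.

Set Implicit Arguments.
Unset Strict Implicit.
Unset Printing Implicit Defensive.

Import Order.TTheory GRing.Theory Num.Theory.
Import numFieldNormedType.Exports.

Local Open Scope classical_set_scope.
Local Open Scope ring_scope.
Local Open Scope sesquilinear_scope.
Local Open Scope complex_scope.

(* Makes 'M[R[i]]_n a pointed type, as required by g_sigma_algebraType. *)
HB.instance Definition _ (R : realType) := isPointed.Build R[i] 0.

(* The Borel sigma-algebras of 'M[R]_n = R^(n^2) and of
   'M[R[i]]_n = R^(2 n^2) are product sigma-algebras: they are generated by
   the preimages of the Borel sets of R under the real coordinates, i.e. the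
   entries, resp. the real and imaginary parts of the entries. *)
Definition real_cylinders (R : realType) (n : nat) : set (set 'M[R]_n) :=
  [set A | exists (i j : 'I_n) (X : set R),
     measurable X /\ A = (fun U : 'M[R]_n => U i j) @^-1` X].

Definition complex_cylinders (R : realType) (n : nat) :
    set (set 'M[R[i]]_n) :=
  [set A | exists (i j : 'I_n) (X : set R), measurable X /\
     (A = (fun U : 'M[R[i]]_n => complex.Re (U i j)) @^-1` X \/
      A = (fun U : 'M[R[i]]_n => complex.Im (U i j)) @^-1` X)].

Definition real_matrices (R : realType) (n : nat) :=
  g_sigma_algebraType (@real_cylinders R n).

Definition complex_matrices (R : realType) (n : nat) :=
  g_sigma_algebraType (@complex_cylinders R n).

Definition orthogonal_group (R : realType) (n : nat) : set 'M[R]_n :=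
  [set U | U *m U^T = 1%:M].

Definition unitary_group (R : realType) (n : nat) : set 'M[R[i]]_n :=
  [set U | U \is unitarymx].

(* A probability measure on the closed matrix group G is viewed as a
   probability measure on the ambient matrix space giving mass 1 to G. G being
   compact, left invariance characterizes the Haar probability measure. *)
Definition is_haar_probability (R : realType) (K : nzRingType) (n : nat)
    (gen : set (set 'M[K]_n)) (G : set 'M[K]_n)
    (m : set 'M[K]_n -> \bar R) : Prop :=
  m G = 1%E /\
  forall g, G g -> forall A, <<s gen >> A ->
    m ((fun U => g *m U) @^-1` A) = m A.

Definition spherical_integral1 (R : realType) (n : nat)
    (m : probability (real_matrices R n.+1) R) (theta : R)
    (B : 'M[R]_n.+1) : R :=
  \int[m]_(U in @orthogonal_group R n.+1)
    expR (theta * n.+1%:R *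
      (((col ord0 (U : 'M[R]_n.+1))^T *m B *m col ord0 (U : 'M[R]_n.+1))
         ord0 ord0)).

(* e_1^* B e_1 is a real number when B is Hermitian, whence the Re. *)
Definition spherical_integral2 (R : realType) (n : nat)
    (m : probability (complex_matrices R n.+1) R) (theta : R)
    (B : 'M[R[i]]_n.+1) : R :=
  \int[m]_(U in @unitary_group R n.+1)
    expR (theta * n.+1%:R *
      complex.Re (((col ord0 (U : 'M[R[i]]_n.+1))^t* *m B
                     *m col ord0 (U : 'M[R[i]]_n.+1)) ord0 ord0)).

Definition eigenvalues_of (R : realType) (n : nat) (B : 'M[R[i]]_n)
    (lam : 'I_n -> R) : Prop :=
  char_poly B = \prod_(i < n) ('X - ((lam i)%:C)%:P).

Definition spectral_norm (R : realType) (n : nat) (lam : 'I_n.+1 -> R) : R :=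
  \big[Num.max/0]_(i < n.+1) `|lam i|.

Definition hilbert (R : realType) (n : nat) (lam : 'I_n.+1 -> R) (z : R) : R :=
  n.+1%:R^-1 * \sum_(i < n.+1) (z - lam i)^-1.

Definition outside_spectrum (R : realType) (n : nat) (lam : 'I_n.+1 -> R) : set R :=
  [set z | (forall i, z < lam i) \/ (forall i, lam i < z)].

(* The hilbert transform is a bijection from outside_spectrum onto R \ {0};
   at 0 the inverse, hence Rtransform, takes a junk value. *)
Definition hilbert_inv (R : realType) (n : nat) (lam : 'I_n.+1 -> R) : R -> R :=
  'pinv_(fun=> 0) (outside_spectrum lam) (hilbert lam).

Definition Rtransform (R : realType) (n : nat) (lam : 'I_n.+1 -> R) (z : R) : R :=
  hilbert_inv lam z - z^-1.

Definition Acoef (R : realType) (n : nat) (lam : 'I_n.+1 -> R)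
    (theta : R) (k : nat) : R :=
  (-1) ^+ k.-1 / (k.-1`!%:R * theta ^+ k) *
    derive1n k.-1 (hilbert lam) (Rtransform lam theta + theta^-1).

(* diag(lam_0, lam_0, lam_1, lam_1, ...), of size 2(n+1) = n.*2.+2. *)
Definition doubled_diag (R : realType) (n : nat) (lam : 'I_n.+1 -> R) :
    'M[R]_(n.*2.+2) :=
  diag_mx (\row_(j < n.*2.+2) lam (inord j./2)).

(* int_a^b f, with the usual sign convention when b < a. *)
Definition oriented_integral (R : realType) (f : R -> R) (a b : R) : R :=
  if a <= b then \int[lebesgue_measure]_(x in `[a, b]) f x
  else - \int[lebesgue_measure]_(x in `[b, a]) f x.

(* Main.v *)
Require Import Defs.
From mathcomp Require Import all_boot all_order all_algebra.
From mathcomp Require Import spectral.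
From mathcomp Require Import complex.
From mathcomp Require Import all_classical all_reals all_analysis.
From mathcomp Require Import ring lra zify.
Set Implicit Arguments.
Unset Strict Implicit.
Unset Printing Implicit Defensive.
Import Order.TTheory GRing.Theory Num.Theory.
Import numFieldNormedType.Exports.
Local Open Scope classical_set_scope.
Local Open Scope ring_scope.

(* Write [d] for the size of [B], [v = R_B(theta)], [b_i = theta (lam_i - v)]
   and [a_i = 1 / (1 - b_i)]; the equation defining [v] is [\sum_i a_i = d], and
   [A_k] is the mean of the [a_i ^ k].

   Both spherical integrals equal [e^(d theta v) E], where [E] is the mean of
   [exp (d \sum_i b_i |u_i|^2)] over the unit sphere of [C^d]. Invariance under
   rotations of two coordinates and under phases gives a recursion for the
   moments of [\sum_i b_i |u_i|^2], whose solution is Newton's identity for the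
   complete homogeneous symmetric polynomials [h_k(b)]; hence
   [E = \sum_k h_k(b) d^k (d-1)! / (d+k-1)!]. Up to exponentially small errors
   the same series, times [\prod_i a_i], is the ratio of
   [\int e^(idt) \prod_i (1 + i a_i t)^-1 dt] over [[-2, 2]] to the same integral
   with all [a_i = 1]. Since [\sum_i a_i = d] the phase is stationary at [t = 0],
   and Laplace's method expands both integrals in powers of [1/d] with
   coefficients given by Gaussian moments and the [A_k]; the quotient of the two
   expansions defines the [m_k].

   Finally, [s v(s) - d^-1 \sum_i ln (1 - s (lam_i - v(s)))] is a primitive of
   the R-transform, so that
   [exp (d \int_0^theta R_B) = e^(d theta v) \prod_i a_i]. *)

(** The numerical constants are tied to the truncation to [[-2, 2]]. At the endpoints
    [|1 + it| = sqrt 5 > 2], so shifting the power of [(1 + it)^-1] by integration by parts leaves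
    boundary terms of order [2^-d]. Against them stand [\sum_k |h_k(b)|], of order [(7/5)^d] when
    all [|b_i| <= 1/7], and [1 / \prod_i a_i <= (8/7)^d]; the three rates multiply to [(4/5)^d],
    which still decays. The bound [|b_i| <= 1/7] follows from [14 M |theta| <= 1], and
    [14 M <= 4 M^2 + 10 M + 1] is [(2 M - 1)^2 >= 0].

    The other constraint is uniformity: the constants of the Laplace expansion must depend on [n]
    alone, not on the spectrum. They do because [1/2 <= a_i <= 2], whence [|A_k| <= 2^k] and
    [1 <= A_2 <= 4]. To stay clear of branches of the complex logarithm, the integrand and its
    approximation are compared through the derivative of their quotient. Both Laplace integrals are
    measured against one truncated Gaussian mass, which cancels in the quotient. *)

Local Notation "''ic'" := (Complex 0 1) : ring_scope.
Local Notation normc := Normc.normc.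
Local Notation "p %:CP" := (map_poly (real_complex _) p) (at level 2, format "p %:CP").

(** * Integrals over segments *)

Section RealIntegral.
Context {R : realType}.
Implicit Types (f g F : R -> R) (a b c t : R).

Definition intg (a b : R) (f : R -> R) : R :=
  \int[lebesgue_measure]_(t in `[a, b]) f t.

Lemma continuous_integrable_segment f a b : continuous f ->
  lebesgue_measure.-integrable `[a, b] (EFin \o f).
Proof.
move=> cf; apply: continuous_compact_integrable.
  exact: segment_compact.
exact: continuous_subspaceT.
Qed.

Lemma is_derive_continuous F f : (forall t, is_derive t 1 F (f t)) ->
  continuous F.
Proof.
by move=> dF t; apply/differentiable_continuous/derivable1_diffP; have [] := dF t.
Qed.

Lemma intg_eq f g a b : (forall t, a <= t <= b -> f t = g t) ->
  intg a b f = intg a b g.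
Proof.
by move=> fg; apply: eq_Rintegral => t; rewrite inE /= in_itv /=; exact: fg.
Qed.

Lemma intgD f g a b : continuous f -> continuous g ->
  intg a b (fun t => f t + g t) = intg a b f + intg a b g.
Proof.
by move=> cf cg; rewrite /intg RintegralD //; exact: continuous_integrable_segment.
Qed.

Lemma intgZ f a b c : continuous f ->
  intg a b (fun t => c * f t) = c * intg a b f.
Proof.
by move=> cf; rewrite /intg RintegralZl //; exact: continuous_integrable_segment.
Qed.

Lemma intgB f g a b : continuous f -> continuous g ->
  intg a b (fun t => f t - g t) = intg a b f - intg a b g.
Proof.
by move=> cf cg; rewrite /intg RintegralB //; exact: continuous_integrable_segment.
Qed.

Lemma intg0 a b : intg a b (fun=> 0) = 0.
Proof. by rewrite /intg Rintegral_cst // mul0r. Qed.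

Lemma intg_cst a b c : a <= b -> intg a b (fun=> c) = c * (b - a).
Proof.
move=> ab; rewrite /intg Rintegral_cst //= lebesgue_measure_itv /= lte_fin.
by move: ab; rewrite le_eqVlt => /predU1P[->|->]//; rewrite ltxx subrr.
Qed.

Lemma continuous_sum_fun (I : Type) (r : seq I) (f : I -> R -> R) :
  (forall i, continuous (f i)) -> continuous (fun t => \sum_(i <- r) f i t).
Proof.
move=> cf; elim: r => [|i r ih].
  by rewrite (_ : (fun=> _) = cst 0); [exact: cst_continuous|apply/funext=> t; rewrite big_nil].
rewrite (_ : (fun=> _) = (fun t => f i t + \sum_(j <- r) f j t)).
  by move=> t; apply: continuousD; [exact: cf|exact: ih].
by apply/funext=> t; rewrite big_cons.
Qed.

Lemma intg_sum (I : Type) (r : seq I) (f : I -> R -> R) a b :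
  (forall i, continuous (f i)) ->
  intg a b (fun t => \sum_(i <- r) f i t) = \sum_(i <- r) intg a b (f i).
Proof.
move=> cf; elim: r => [|i r ih].
  by rewrite big_nil -[RHS](intg0 a b); apply: intg_eq => t _; rewrite big_nil.
rewrite big_cons -ih -intgD //; last exact: continuous_sum_fun.
by apply: intg_eq => t _; rewrite big_cons.
Qed.

Lemma intg_le f g a b : continuous f -> continuous g ->
  (forall t, a <= t <= b -> f t <= g t) -> intg a b f <= intg a b g.
Proof.
move=> cf cg fg; apply: le_Rintegral => //; try exact: continuous_integrable_segment.
Qed.

Lemma intg_norm_le f g a b : continuous f -> continuous g ->
  (forall t, a <= t <= b -> `|f t| <= g t) -> `|intg a b f| <= intg a b g.
Proof.
move=> cf cg fg; apply: le_trans (le_normr_Rintegral _ _) _ => //.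
  exact: continuous_integrable_segment.
apply: le_Rintegral => //.
- apply: (@continuous_integrable_segment (fun x => `|f x|)) => t.
  by apply: continuous_comp; [exact: cf|exact: norm_continuous].
- exact: continuous_integrable_segment.
Qed.

Lemma intg_FTC F f a b : a < b -> (forall t, a <= t <= b -> is_derive t 1 F (f t)) ->
  continuous f -> intg a b f = F b - F a.
Proof.
move=> ab dF cf; rewrite /intg /Rintegral (@continuous_FTC2 _ f F) //=.
- exact: continuous_subspaceT.
- have FC t : a <= t <= b -> F x @[x --> t] --> F t.
    move=> tab; apply/differentiable_continuous/derivable1_diffP.
    by have [] := dF t tab.
  split; last 2 first.
  + by apply: cvg_at_right_filter; apply: FC; rewrite lexx ltW.
  + by apply: cvg_at_left_filter; apply: FC; rewrite lexx ltW.
  + by move=> t; rewrite in_itv /= => /andP[/ltW ta /ltW tb];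
      have [] := dF t (introT andP (conj ta tb)).
- move=> t; rewrite in_itv /= => /andP[/ltW ta /ltW tb].
  by rewrite derive1E; have [_ ->] := dF t (introT andP (conj ta tb)).
Qed.

(** Serves to reduce splitting and rescaling of integrals to evaluations of a single primitive. The
    primitive is an integral from the fixed lower endpoint [- c], so it is obtained on an open
    window, chosen by the caller to contain the segments at hand. *)
Lemma continuous_primitive f (c : R) : continuous f ->
  exists F, forall t, - c < t < c -> is_derive t 1 F (f t).
Proof.
move=> cf; exists (fun x => \int[lebesgue_measure]_(t in `[- c, x]) f t).
move=> t /andP[ct tc].
have [] := @continuous_FTC1_closed _ f (- c) t c tc _ ct (cf t).
  exact: continuous_integrable_segment.
by move=> dF <-; rewrite derive1E; apply: DeriveDef.
Qed.

Lemma intg_split f a b c : a < b -> b < c -> continuous f ->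
  intg a c f = intg a b f + intg b c f.
Proof.
move=> ab bc cf; pose m := `|a| + `|c| + 1.
have [F dF] := continuous_primitive m cf.
have ma : - m < a by rewrite /m; have := ler_norm (- a); rewrite normrN; have := normr_ge0 c; lra.
have mc : c < m by rewrite /m; have := ler_norm c; have := normr_ge0 a; lra.
have FTC x y : - m < x -> x < y -> y < m -> intg x y f = F y - F x.
  move=> mx xy ym; apply: intg_FTC => // t /andP[xt ty]; apply: dF.
  by apply/andP; split; lra.
by rewrite !FTC; lra.
Qed.

Lemma intg_scale f a b c : 0 < c -> a < b -> continuous f ->
  intg a b (fun t => f (c * t)) = c^-1 * intg (c * a) (c * b) f.
Proof.
move=> c0 ab cf; pose m := `|c * a| + `|c * b| + 1.
have [F dF] := continuous_primitive m cf.
have cab : c * a < c * b by rewrite ltr_pM2l.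
have ma : - m < c * a.
  by rewrite /m; have := ler_norm (- (c * a)); rewrite normrN; have := normr_ge0 (c * b); lra.
have mc : c * b < m.
  by rewrite /m; have := ler_norm (c * b); have := normr_ge0 (c * a); lra.
have cfc : continuous (fun t => f (c * t)).
  by move=> t; apply: continuous_comp; [exact: mulrl_continuous|exact: cf].
have -> : intg a b (fun t => f (c * t)) = c^-1 * F (c * b) - c^-1 * F (c * a).
  apply: (@intg_FTC (fun t => c^-1 * F (c * t))) => // t /andP[ta tb].
  have ct : - m < c * t < m.
    have : c * a <= c * t by rewrite ler_pM2l.
    have : c * t <= c * b by rewrite ler_pM2l.
    by move=> ? ?; apply/andP; split; lra.
  have d1 := dF _ ct.
  have d2 : is_derive t 1 (fun t => c * t) (c * 1) by exact: is_deriveZ.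
  have d3 := @is_derive1_comp _ F (fun t => c * t) t _ _ d1 d2.
  have := @is_deriveZ _ _ _ _ c^-1 t 1 _ d3.
  rewrite (_ : c^-1 *: (f (c * t) * (c * 1)) = f (c * t)) //.
  by rewrite /GRing.scale /= mulr1 mulrCA mulVf ?mulr1 // gt_eqF.
have -> : intg (c * a) (c * b) f = F (c * b) - F (c * a).
  by apply: intg_FTC => // t /andP[? ?]; apply: dF; apply/andP; split; lra.
by rewrite mulrBr.
Qed.

End RealIntegral.

(** * Complex-valued functions of a real variable *)

Section ComplexDerivative.
Context {R : realType}.
Implicit Types (F G : R -> R[i]) (z w D E : R[i]) (t : R).

Lemma ReM z w : complex.Re (z * w) =
  complex.Re z * complex.Re w - complex.Im z * complex.Im w.
Proof. by case: z => a b; case: w. Qed.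

Lemma ImM z w : complex.Im (z * w) =
  complex.Re z * complex.Im w + complex.Im z * complex.Re w.
Proof. by case: z => a b; case: w. Qed.

Lemma ReD z w : complex.Re (z + w) = complex.Re z + complex.Re w.
Proof. by case: z => a b; case: w. Qed.

Lemma ImD z w : complex.Im (z + w) = complex.Im z + complex.Im w.
Proof. by case: z => a b; case: w. Qed.

Lemma ReN z : complex.Re (- z) = - complex.Re z.
Proof. by case: z. Qed.

Lemma ImN z : complex.Im (- z) = - complex.Im z.
Proof. by case: z. Qed.

Lemma Re_sum (I : Type) (r : seq I) (F : I -> R[i]) :
  complex.Re (\sum_(i <- r) F i) = \sum_(i <- r) complex.Re (F i).
Proof. by elim: r => [|i r ih]; rewrite ?big_nil // !big_cons ReD ih. Qed.

Lemma normc_ge0 z : 0 <= normc z.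
Proof. by case: z => a b; exact: sqrtr_ge0. Qed.

Lemma normcX z n : normc (z ^+ n) = normc z ^+ n.
Proof.
elim: n => [|n ih]; first by rewrite !expr0 Normc.normc1.
by rewrite !exprS Normc.normcM ih.
Qed.

Lemma normc_real (x : R) : normc (x%:C)%C = `|x|.
Proof. by rewrite /normc /= expr0n addr0 sqrtr_sqr. Qed.

Lemma normc_i : normc ('ic : R[i]) = 1.
Proof. by rewrite /normc /= expr0n add0r expr1n sqrtr1. Qed.

Lemma normc_sum (I : Type) (r : seq I) (F : I -> R[i]) :
  normc (\sum_(i <- r) F i) <= \sum_(i <- r) normc (F i).
Proof.
elim: r => [|i r ih]; first by rewrite !big_nil Normc.normc0.
by rewrite !big_cons (le_trans (le_normcD _ _)) // lerD2l.
Qed.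

Lemma normc_prod (I : Type) (r : seq I) (F : I -> R[i]) :
  normc (\prod_(i <- r) F i) = \prod_(i <- r) normc (F i).
Proof.
elim: r => [|i r ih]; first by rewrite !big_nil Normc.normc1.
by rewrite !big_cons Normc.normcM ih.
Qed.

Lemma Re_le_normc z : `|complex.Re z| <= normc z.
Proof.
by case: z => a b /=; rewrite -sqrtr_sqr ler_wsqrtr // lerDl sqr_ge0.
Qed.

Lemma Im_le_normc z : `|complex.Im z| <= normc z.
Proof.
by case: z => a b /=; rewrite -sqrtr_sqr ler_wsqrtr // lerDr sqr_ge0.
Qed.

Lemma normc_le_Re_Im z : normc z <= `|complex.Re z| + `|complex.Im z|.
Proof.
case: z => a b /=; rewrite -[leRHS]ger0_norm ?addr_ge0 // -sqrtr_sqr ler_wsqrtr //.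
by rewrite sqrrD !real_normK ?num_real // addrAC lerDl mulrn_wge0 // mulr_ge0.
Qed.

(** Complex values, but a real variable: working coordinate by coordinate reduces everything to the
    calculus of real derivatives. *)
Definition is_cderive F t D :=
  is_derive t 1 (fun x => complex.Re (F x)) (complex.Re D) /\
  is_derive t 1 (fun x => complex.Im (F x)) (complex.Im D).

Lemma cderive_eq F t D E : is_cderive F t D -> D = E -> is_cderive F t E.
Proof. by move=> ? <-. Qed.

Lemma cderive_cst z t : is_cderive (fun=> z) t 0.
Proof. by split; exact: is_derive_cst. Qed.

Lemma cderive_real (f : R -> R) t (d : R) : is_derive t 1 f d ->
  is_cderive (fun x => (f x)%:C%C) t (d%:C)%C.
Proof. by move=> df; split => //=; exact: is_derive_cst. Qed.

Lemma cderiveD F G t D E : is_cderive F t D -> is_cderive G t E ->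
  is_cderive (fun x => F x + G x) t (D + E).
Proof.
move=> [? ?] [? ?]; split.
- rewrite (_ : (fun _ => _) = (fun x => complex.Re (F x)) + (fun x => complex.Re (G x))).
    by rewrite ReD; exact: is_deriveD.
  by apply/funext => x; rewrite ReD.
- rewrite (_ : (fun _ => _) = (fun x => complex.Im (F x)) + (fun x => complex.Im (G x))).
    by rewrite ImD; exact: is_deriveD.
  by apply/funext => x; rewrite ImD.
Qed.

Lemma cderiveM F G t D E : is_cderive F t D -> is_cderive G t E ->
  is_cderive (fun x => F x * G x) t (D * G t + F t * E).
Proof.
move=> [dF1 dF2] [dG1 dG2]; split.
- rewrite (_ : (fun _ => _) = (fun x => complex.Re (F x)) * (fun x => complex.Re (G x))
    - (fun x => complex.Im (F x)) * (fun x => complex.Im (G x))).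
    apply: (is_derive_eq (is_deriveB (is_deriveM dF1 dG1) (is_deriveM dF2 dG2))).
    by rewrite ReD !ReM /GRing.scale /=; ring.
  by apply/funext => x; rewrite ReM.
- rewrite (_ : (fun _ => _) = (fun x => complex.Re (F x)) * (fun x => complex.Im (G x))
    + (fun x => complex.Im (F x)) * (fun x => complex.Re (G x))).
    apply: (is_derive_eq (is_deriveD (is_deriveM dF1 dG2) (is_deriveM dF2 dG1))).
    rewrite ImD !ImM /GRing.scale /=.
    set a := complex.Re (F t); set b := complex.Im (F t).
    set c := complex.Re (G t); set d := complex.Im (G t).
    by move: a b c d (complex.Re D) (complex.Im D) (complex.Re E) (complex.Im E)
      => a b c d e f g h; ring.
  by apply/funext => x; rewrite ImM.
Qed.

Lemma cderiveZ z F t D : is_cderive F t D -> is_cderive (fun x => z * F x) t (z * D).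
Proof.
move=> dF; apply: cderive_eq (cderiveM (cderive_cst z t) dF) _.
by rewrite mul0r add0r.
Qed.

Lemma ReV z : complex.Re z^-1 = complex.Re z / (complex.Re z ^+ 2 + complex.Im z ^+ 2).
Proof. by case: z. Qed.

Lemma ImV z : complex.Im z^-1 = - (complex.Im z / (complex.Re z ^+ 2 + complex.Im z ^+ 2)).
Proof. by case: z. Qed.

Lemma sqr_normc_neq0 z : z != 0 -> complex.Re z ^+ 2 + complex.Im z ^+ 2 != 0.
Proof.
apply: contra; rewrite paddr_eq0 ?sqr_ge0 // !sqrf_eq0 => /andP[/eqP a /eqP b].
by case: z a b => u v /= -> ->.
Qed.

Lemma cderiveV F t D : F t != 0 -> is_cderive F t D ->
  is_cderive (fun x => (F x)^-1) t (- (D / F t ^+ 2)).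
Proof.
move=> F0 [dR dI].
pose u x := complex.Re (F x); pose v x := complex.Im (F x).
have n0 : u t ^+ 2 + v t ^+ 2 != 0 by exact: sqr_normc_neq0.
have dn : is_derive t 1 (u ^+ 2 + v ^+ 2)
    (2 * u t * complex.Re D + 2 * v t * complex.Im D).
  apply: (is_derive_eq (is_deriveD (is_deriveX 2 dR) (is_deriveX 2 dI))).
  rewrite /GRing.scale /= -/(u t) -/(v t).
  by move: (u t) (v t) (complex.Re D) (complex.Im D) => a b c d; ring.
have dV := @is_deriveV _ (u ^+ 2 + v ^+ 2) t _ 1 n0 dn.
have FX : F t ^- 2 = (F t)^-1 * (F t)^-1 by rewrite expr2 invfM.
split.
- rewrite (_ : (fun _ => _) = u * (fun x => ((u ^+ 2 + v ^+ 2) x)^-1)).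
    have := @is_deriveM _ _ u _ t 1 _ _ dR dV.
    move=> /is_derive_eq; apply.
    rewrite ReN FX !ReM !ImM !ReV !ImV -/(u t) -/(v t) /GRing.scale /=.
    rewrite !fctE; field.
    by rewrite -/(u t ^+ 2) -/(v t ^+2).
  by apply/funext => x; rewrite ReV.
- rewrite (_ : (fun _ => _) = - (v * (fun x => ((u ^+ 2 + v ^+ 2) x)^-1))).
    have := @is_deriveN _ _ _ _ t 1 _ (@is_deriveM _ _ v _ t 1 _ _ dI dV).
    move=> /is_derive_eq; apply.
    rewrite ImN FX !ImM !ReM !ReV !ImV -/(u t) -/(v t) /GRing.scale /=.
    rewrite !fctE; field.
    by rewrite -/(u t ^+ 2) -/(v t ^+2).
  by apply/funext => x; rewrite ImV.
Qed.

Lemma cderiveX F t D n : is_cderive F t D ->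
  is_cderive (fun x => F x ^+ n) t (n%:R * F t ^+ n.-1 * D).
Proof.
move=> dF; elim: n => [|n ih].
  rewrite !mul0r; exact: cderive_cst.
apply: cderive_eq.
  rewrite (_ : (fun _ => _) = fun x => F x * F x ^+ n).
    exact: cderiveM dF ih.
  by apply/funext=> x; rewrite exprS.
rewrite /= -natr1; case: n {ih} => [|n] /=; first by rewrite expr0; ring.
by rewrite !exprS; ring.
Qed.

(** The derivative is given as the product times the sum of the logarithmic derivatives; this form
    plays the part of a logarithm of the phase. *)
Lemma cderive_prod (I : Type) (r : seq I) (F : I -> R -> R[i]) t (D : I -> R[i]) :
  (forall i, F i t != 0) -> (forall i, is_cderive (F i) t (D i)) ->
  is_cderive (fun x => \prod_(i <- r) F i x) t
    ((\prod_(i <- r) F i t) * \sum_(i <- r) D i / F i t).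
Proof.
move=> F0 dF; elim: r => [|i r ih].
  rewrite (_ : (fun _ => _) = fun=> 1); last by apply/funext=> x; rewrite big_nil.
  by rewrite !big_nil mulr0; exact: cderive_cst.
rewrite (_ : (fun _ => _) = fun x => F i x * \prod_(j <- r) F j x); last first.
  by apply/funext=> x; rewrite big_cons.
apply: cderive_eq (cderiveM (dF i) ih) _.
by rewrite !big_cons mulrDr; congr (_ + _); [rewrite mulrAC mulrCA divff // mulr1 mulrC|rewrite mulrA].
Qed.

Definition cis (x : R) : R[i] := Complex (cos x) (sin x).

Lemma normc_cis x : normc (cis x) = 1.
Proof. by rewrite /normc /cis cos2Dsin2 sqrtr1. Qed.

Lemma cisN x : cis (- x) = (cis x)^-1.
Proof.
rewrite /cis cosN sinN; apply/eqP; rewrite eq_complex /=.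
by rewrite cos2Dsin2 !divr1 !eqxx.
Qed.

Lemma cis0 : cis 0 = 1.
Proof. by rewrite /cis cos0 sin0. Qed.

Lemma cderive_cis (c : R) t :
  is_cderive (fun x => cis (c * x)) t ('ic * c%:C%C * cis (c * t)).
Proof.
have dc : is_derive t 1 (fun x => c * x) c.
  by have := @is_deriveZ _ _ _ _ c t 1 _ (is_derive_id t 1); rewrite /GRing.scale /= mulr1.
split; rewrite /=.
  have := @is_derive1_comp _ _ _ t _ _ (is_derive_cos (c * t)) dc.
  by move=> /is_derive_eq; apply; ring.
have := @is_derive1_comp _ _ _ t _ _ (is_derive_sin (c * t)) dc.
by move=> /is_derive_eq; apply; ring.
Qed.

Lemma cderive_line (c : R) t : is_cderive (fun x => 1 + 'ic * (c * x)%:C%C) t ('ic * c%:C%C).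
Proof.
have dc : is_derive t 1 (fun x => c * x) c.
  by have := @is_deriveZ _ _ _ _ c t 1 _ (is_derive_id t 1); rewrite /GRing.scale /= mulr1.
have := cderiveD (cderive_cst 1 t) (cderiveZ 'ic (cderive_real dc)).
by rewrite add0r.
Qed.

Lemma cderive_poly (P : {poly R}) t :
  is_cderive (fun x => (map_poly (real_complex R) P).['ic * x%:C%C]) t
    ('ic * (map_poly (real_complex R) P^`()).['ic * t%:C%C]).
Proof.
elim/poly_ind: P => [|P c ih].
  rewrite deriv0 rmorph0 horner0 mulr0 (_ : (fun _ => _) = fun=> 0).
    exact: cderive_cst.
  by apply/funext=> x; rewrite horner0.
rewrite (_ : (fun _ => _) = fun x =>
  (map_poly (real_complex R) P).['ic * x%:C%C] * ('ic * x%:C%C) + c%:C%C); last first.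
  by apply/funext=> x; rewrite rmorphD rmorphM /= map_polyX map_polyC !hornerE.
have dx := cderiveZ 'ic (cderive_real (is_derive_id t 1)).
apply: cderive_eq (cderiveD (cderiveM ih dx) (cderive_cst _ t)) _.
rewrite derivD derivM derivX derivC mulr1 !addr0 rmorphD rmorphM /= map_polyX !hornerE /=.
by rewrite (_ : (1%:C)%C = 1) //; ring.
Qed.

Lemma cderive_continuous_Re F (D : R -> R[i]) : (forall t, is_cderive F t (D t)) ->
  continuous (fun t => complex.Re (F t)).
Proof. by move=> dF; apply: (is_derive_continuous (f := fun t => complex.Re (D t))) => t; have [] := dF t. Qed.

Lemma derive_bound (f df : R -> R) (x b : R) :
  (forall t, is_derive t 1 f (df t)) -> (forall t, `|t| <= `|x| -> `|df t| <= b) ->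
  `|f x - f 0| <= b * `|x|.
Proof.
move=> dF db.
have cf := is_derive_continuous dF.
have [x0|x0|->] := ltgtP x 0; last by rewrite subrr !normr0 mulr0.
- have [|c] := @MVT _ f df x 0 x0 (fun t _ => dF t).
    exact: continuous_subspaceT.
  rewrite in_itv /= => /andP[xc c0] E.
  rewrite distrC E normrM sub0r normrN ler_wpM2r // db //.
  by rewrite !ltr0_norm // lerN2 ltW.
- have [|c] := @MVT _ f df 0 x x0 (fun t _ => dF t).
    exact: continuous_subspaceT.
  rewrite in_itv /= => /andP[c0 cx] E.
  rewrite E normrM subr0 ler_wpM2r // db //.
  by rewrite !gtr0_norm // ltW.
Qed.

(** The mean value theorem is applied to the real and to the imaginary part separately, which costs
    the factor [2]. *)
Lemma cderive_bound F (D : R -> R[i]) (x b : R) : (forall t, is_cderive F t (D t)) ->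
  (forall t, `|t| <= `|x| -> normc (D t) <= b) ->
  normc (F x - F 0) <= 2 * b * `|x|.
Proof.
move=> dF db; apply: le_trans (normc_le_Re_Im _) _.
rewrite ReD ImD ReN ImN [2]mulr2n mulrDl mul1r mulrDl; apply: lerD.
- apply: (@derive_bound (fun t => complex.Re (F t)) (fun t => complex.Re (D t))).
    by move=> t; have [] := dF t.
  by move=> t /db; apply: le_trans; exact: Re_le_normc.
- apply: (@derive_bound (fun t => complex.Im (F t)) (fun t => complex.Im (D t))).
    by move=> t; have [] := dF t.
  by move=> t /db; apply: le_trans; exact: Im_le_normc.
Qed.

Lemma conjC_ReIm z : Num.conj z = Complex (complex.Re z) (- complex.Im z).
Proof. by case: z. Qed.

End ComplexDerivative.

(** * Laplace expansion *)

Section LaplacePointwise.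
Context {R : realType}.

Definition power_mean (d : nat) (a : 'I_d -> R) (k : nat) : R :=
  d%:R^-1 * \sum_(i < d) a i ^+ k.

Definition phase_prod (d : nat) (a : 'I_d -> R) (t : R) : R[i] :=
  \prod_(i < d) (1 + 'ic * (a i * t)%:C%C).

Definition phi (d : nat) (a : 'I_d -> R) (t : R) : R[i] :=
  cis (d%:R * t) * (phase_prod a t)^-1.

(* The Taylor polynomial at [0] of the phase [s - d^-1 \sum_i ln (1 + a_i s)],
   [s = it], from degree [3] on. *)
Definition gpoly (A : nat -> R) (K : nat) : {poly R} :=
  \sum_(3 <= k < K.+1) ((-1) ^+ k * A k / k%:R) *: 'X^k.

Definition exp_poly (g : {poly R}) (x : R) (r : nat) : {poly R} :=
  \sum_(j < r) (j`!%:R^-1 * x ^+ j) *: g ^+ j.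

Lemma line_neq0 (c : R) : 1 + 'ic * (c%:C)%C != 0 :> R[i].
Proof.
rewrite eq_complex /= !mul0r !mul1r subr0 ?add0r ?addr0; apply/nandP; left.
exact: oner_neq0.
Qed.

Lemma normc_line (c : R) : normc (1 + 'ic * (c%:C)%C) = Num.sqrt (1 + c ^+ 2).
Proof. rewrite /Normc.normc /=.
by rewrite !(mul0r, mul1r, subr0, addr0, add0r, expr1n). Qed.

Lemma normc_line_ge1 (c : R) : 1 <= normc (1 + 'ic * (c%:C)%C).
Proof. by rewrite normc_line -[leLHS]sqrtr1 ler_wsqrtr // lerDl sqr_ge0. Qed.

Lemma phase_prod_neq0 d (a : 'I_d -> R) t : phase_prod a t != 0.
Proof. by rewrite prodf_seq_neq0; apply/allP => i _; rewrite implyTb line_neq0. Qed.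

Lemma normc_phi d (a : 'I_d -> R) t :
  normc (phi a t) = \prod_(i < d) (Num.sqrt (1 + (a i * t) ^+ 2))^-1.
Proof.
rewrite Normc.normcM normc_cis mul1r Normc.normcV normc_prod -prodfV.
by apply: eq_bigr => i _; rewrite normc_line.
Qed.

Lemma cderive_phase_prod d (a : 'I_d -> R) t :
  is_cderive (phase_prod a) t
   (phase_prod a t * \sum_(i < d) ('ic * (a i)%:C%C) / (1 + 'ic * (a i * t)%:C%C)).
Proof.
apply: (@cderive_prod _ _ _ (fun i t => 1 + 'ic * (a i * t)%:C%C)) => i.
  exact: line_neq0.
exact: cderive_line.
Qed.

Lemma phi_cderivable d (a : 'I_d -> R) : exists D, forall t, is_cderive (phi a) t (D t).
Proof.
eexists => t; apply: cderiveM; first exact: cderive_cis.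
apply: cderiveV; first exact: phase_prod_neq0.
exact: cderive_phase_prod.
Qed.

Lemma phi_continuous d (a : 'I_d -> R) : continuous (fun t => complex.Re (phi a t)).
Proof. have [D dD] := phi_cderivable a; exact: cderive_continuous_Re dD. Qed.

(** A truncated exponential satisfies the equation of the exponential except for its last term,
    which differentiation does not reproduce. That term is one of the two error sources of the
    Laplace approximation. *)
Lemma deriv_exp_poly g (x : R) r :
  (exp_poly g x r.+1)^`() =
  x *: g^`() * (exp_poly g x r.+1 - (r`!%:R^-1 * x ^+ r) *: g ^+ r).
Proof.
rewrite [in RHS]/exp_poly big_ord_recr /= addrK /exp_poly.
rewrite raddf_sum /= big_ord_recl /= expr0 alg_polyC derivC add0r mulr_sumr.
apply: eq_bigr => i _; rewrite derivZ deriv_exp /bump /= add1n.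
rewrite -scalerMnr scalerMnl -mulr_natr -[in RHS]scalerAr -[in RHS]scalerAl scalerA add0n.
congr (_ *: _); rewrite factS exprS natrM.
have i0 : (i`!)%:R != 0 :> R by rewrite pnatr_eq0 -lt0n fact_gt0.
by field; rewrite i0 addrC natr1 pnatr_eq0.
Qed.

Lemma deriv_gpoly A K : (gpoly A K)^`() = \sum_(3 <= k < K.+1) ((-1) ^+ k * A k) *: 'X^(k.-1).
Proof.
rewrite raddf_sum /=; rewrite !big_nat; apply: eq_bigr => k /andP[k3 _].
rewrite derivZ derivXn -scalerMnr scalerMnl -mulr_natr divfK //.
by rewrite pnatr_eq0; case: k k3.
Qed.

(** A finite geometric sum with its exact remainder. An infinite expansion would not do: with
    [a <= 2] and [|t| <= 2] the modulus of [a * s] can reach [4]. *)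
Lemma geometric_tail (a s : R[i]) K : (2 <= K)%N -> 1 + a * s != 0 ->
  a ^+ 3 * s ^+ 2 / (1 + a * s) =
  - (\sum_(3 <= k < K.+1) (-1) ^+ k * a ^+ k * s ^+ k.-1) +
  (-1) ^+ K * s ^+ K * a ^+ K.+1 / (1 + a * s).
Proof.
move=> K2 n0; elim: K K2 => [//|K ih]; rewrite leq_eqVlt => /predU1P[<-|K2].
  by rewrite big_geq // oppr0 add0r; field.
rewrite big_nat_recr //= opprD addrAC -addrA (ih K2); congr (_ + _).
by rewrite [(-1) ^+ K.+1]exprS [a ^+ K.+2]exprS [s ^+ K.+1]exprS; field.
Qed.

(** The left side is the logarithmic derivative of the Gaussian times [1 / phi]. The condition on
    the sum of the weights removes its constant term (the phase is stationary at [0]), the variance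
    [A_2] removes the linear one, and [gpoly] accounts for the orders up to [K], leaving the
    explicit remainder. *)
Lemma saddle_log_derivative d (a : 'I_d -> R) (t : R) K : (0 < d)%N -> (2 <= K)%N ->
  \sum_(i < d) a i = d%:R ->
  - (d%:R * power_mean a 2 * t)%:C%C - 'ic * d%:R%:C%C +
    \sum_(i < d) ('ic * (a i)%:C%C) / (1 + 'ic * (a i * t)%:C%C) =
  'ic * (- (d%:R%:C%C * ((gpoly (power_mean a) K)^`()%:CP).['ic * t%:C%C]) +
     (-1) ^+ K * ('ic * t%:C%C) ^+ K *
       \sum_(i < d) (a i)%:C%C ^+ K.+1 / (1 + 'ic * (a i * t)%:C%C)).
Proof.
move=> d0 K2 Ha; set s := 'ic * t%:C%C.
have dn0 : d%:R != 0 :> R by rewrite pnatr_eq0 -lt0n.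
have EA k : d%:R * power_mean a k = \sum_(i < d) a i ^+ k by rewrite /power_mean mulVKf.
have line i : 1 + 'ic * (a i * t)%:C%C = 1 + (a i)%:C%C * s.
  by rewrite /s rmorphM /= mulrCA.
have n0 i : 1 + (a i)%:C%C * s != 0 by rewrite -line line_neq0.
have i2 : 'ic * 'ic = -1 :> R[i] by rewrite -expr2 sqr_i.
have -> : - (d%:R * power_mean a 2 * t)%:C%C = 'ic * \sum_(i < d) ((a i)%:C%C ^+ 2 * s).
  have -> : \sum_(i < d) ((a i)%:C%C ^+ 2 * s) = (d%:R * power_mean a 2)%:C%C * s.
    by rewrite EA -mulr_suml rmorph_sum /=; under [in RHS]eq_bigr do rewrite rmorphXn.
  have -> : 'ic * ((d%:R * power_mean a 2)%:C%C * s) =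
    ('ic * 'ic) * ((d%:R * power_mean a 2)%:C%C * t%:C%C) by rewrite /s; ring.
  by rewrite i2 mulN1r [in LHS]rmorphM.
have -> : 'ic * d%:R%:C%C = 'ic * \sum_(i < d) (a i)%:C%C :> R[i].
  by rewrite -Ha rmorph_sum.
have -> : \sum_(i < d) ('ic * (a i)%:C%C) / (1 + 'ic * (a i * t)%:C%C) =
   'ic * \sum_(i < d) (a i)%:C%C / (1 + (a i)%:C%C * s).
  by rewrite mulr_sumr; apply: eq_bigr => i _; rewrite line mulrA.
rewrite -mulrBr -mulrDr; congr (_ * _).
rewrite -sumrB -big_split /=.
(* Termwise, [a / (1 + a s) - a + a^2 s = a^3 s^2 / (1 + a s)]: the first two orders cancel
   exactly. *)
transitivity (\sum_(i < d) (a i)%:C%C ^+ 3 * s ^+ 2 / (1 + (a i)%:C%C * s)).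
  by apply: eq_bigr => i _; field; exact: n0.
rewrite (eq_bigr _ (fun i _ => geometric_tail K2 (n0 i))).
rewrite big_split /=; congr (_ + _); last first.
  by rewrite mulr_sumr; apply: eq_bigr => i _; rewrite line -!mulrA.
rewrite sumrN; congr (- _).
rewrite deriv_gpoly rmorph_sum /= horner_sum mulr_sumr exchange_big /=.
apply: eq_bigr => k _; rewrite map_polyZ /= map_polyXn hornerZ hornerXn.
rewrite -mulr_suml mulrA; congr (_ * _).
rewrite -rmorphM /= mulrCA EA rmorphM /= rmorph_sum rmorphXn rmorphN rmorph1 -mulr_sumr.
by congr (_ * _); apply: eq_bigr => i _; rewrite rmorphXn.
Qed.

Definition gauss (c t : R) : R := expR (- (c * t ^+ 2 / 2)).

Lemma is_derive_gauss (c t : R) : is_derive t 1 (gauss c) (- (c * t) * gauss c t).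
Proof.
have d1 : is_derive t 1 (fun x : R => - (c * x ^+ 2 / 2)) (- (c * t)).
  rewrite (_ : (fun _ => _) = (- (c / 2)) *: (fun x : R => x ^+ 2)); last first.
    by apply/funext => x; rewrite !fctE /GRing.scale /=; field.
  apply: (is_derive_eq (is_deriveZ _ (is_deriveX 2 (is_derive_id t 1)))).
  by rewrite /GRing.scale /=; field.
have := @is_derive1_comp _ expR _ t _ _ (is_derive_expR _) d1.
by move=> /is_derive_eq; apply; rewrite mulrC.
Qed.

Lemma gauss_continuous (c : R) : continuous (gauss c).
Proof. exact: is_derive_continuous (is_derive_gauss c). Qed.

(* The ratio of the Laplace approximation of [phi a] to [phi a] itself; its
   derivative is of high order in [t], hence the ratio stays close to [1]. *)
Definition quot d (a : 'I_d -> R) (P : {poly R}) (t : R) : R[i] :=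
  (gauss (d%:R * power_mean a 2) t)%:C%C * P%:CP.['ic * t%:C%C] *
  (cis (- d%:R * t) * phase_prod a t).

Lemma quot_phi d (a : 'I_d -> R) P t :
  phi a t * quot a P t =
  (gauss (d%:R * power_mean a 2) t)%:C%C * P%:CP.['ic * t%:C%C].
Proof.
rewrite /phi /quot mulNr cisN.
have c0 : cis (d%:R * t) != 0.
  by apply/eqP => /(congr1 (@Normc.normc R)); rewrite normc_cis Normc.normc0 => /eqP; rewrite oner_eq0.
have p0 := phase_prod_neq0 a t.
by field; rewrite c0.
Qed.

(** After the cancellation of the logarithmic derivatives two errors survive: the last term of the
    truncated exponential, and the remainder of degree [K] of the truncated phase. *)
Lemma cderive_quot d (a : 'I_d -> R) K r t : (0 < d)%N -> (2 <= K)%N ->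
  \sum_(i < d) a i = d%:R ->
  let g := gpoly (power_mean a) K in let P := exp_poly g d%:R r.+1 in
  let s := 'ic * t%:C%C in
  is_cderive (quot a P) t
    ('ic * ((gauss (d%:R * power_mean a 2) t)%:C%C * (cis (- d%:R * t) * phase_prod a t)) *
     (- (d%:R%:C%C * g^`()%:CP.[s] * ((r`!%:R^-1)%:C%C * (d%:R%:C%C * g%:CP.[s]) ^+ r)) +
      P%:CP.[s] * ((-1) ^+ K * s ^+ K *
       \sum_(i < d) (a i)%:C%C ^+ K.+1 / (1 + 'ic * (a i * t)%:C%C)))).
Proof.
move=> d0 K2 Ha g P s.
apply: cderive_eq (cderiveM (cderiveM (cderive_real (is_derive_gauss _ t)) (cderive_poly P t))
  (cderiveM (cderive_cis _ t) (cderive_phase_prod a t))) _.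
have := saddle_log_derivative t d0 K2 Ha; rewrite -/g -/s.
set S := \sum_(i < d) _; set T := \sum_(i < d) _ ^+ _ / _ => ES.
have -> : S = 'ic * (- (d%:R%:C%C * g^`()%:CP.[s]) + (-1) ^+ K * s ^+ K * T)
   + (d%:R * power_mean a 2 * t)%:C%C + 'ic * d%:R%:C%C.
  by rewrite -ES; ring.
have -> : P^`()%:CP.[s] = d%:R%:C%C * g^`()%:CP.[s] *
   (P%:CP.[s] - (r`!%:R^-1)%:C%C * (d%:R%:C%C * g%:CP.[s]) ^+ r).
  rewrite deriv_exp_poly -/P rmorphM rmorphB /= !map_polyZ /= rmorphXn /= hornerM hornerD hornerN !hornerZ horner_exp.
  by rewrite (rmorphM (real_complex R)) /= rmorphXn /= exprMn mulrA.
rewrite rmorphM !rmorphN /=.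
set G := (gauss _ _)%:C%C; set c := cis _; set p := phase_prod a t.
by set X := _ ^+ r; ring.
Qed.

End LaplacePointwise.

(** * Uniform pointwise error of the Laplace approximation *)

Section LaplaceBounds.
Context {R : realType}.

Lemma expr_div_fact_le_expR (x : R) n : 0 <= x -> x ^+ n / n`!%:R <= expR x.
Proof.
move=> x0; case: n => [|n]; first by rewrite expr0 divr1 -expR0 ler_expR.
by apply: le_trans (expR_ge1Dxn n x0); rewrite lerDr ler01.
Qed.

(** Used to absorb all powers of the rescaled variable into half of the decay [e^(-x^2/16)] of the
    integrand; the other half remains for integration. *)
Lemma poly_gauss_bound (p : {poly R}) :
  exists C, 0 <= C /\ forall x, 0 <= x -> p.[x] <= C * expR (x ^+ 2 / 32).
Proof.
exists (\sum_(i < size p) `|p`_i| * (32 ^+ i * i`!%:R * expR 32^-1)); split.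
  by apply: sumr_ge0 => i _; rewrite !mulr_ge0 ?exprn_ge0 // expR_ge0.
move=> x x0; rewrite horner_coef mulr_suml; apply: ler_sum => i _.
apply: le_trans (ler_norm _) _; rewrite normrM -[leRHS]mulrA ler_wpM2l //.
rewrite ger0_norm ?exprn_ge0 // -[leRHS]mulrA -expRD.
(* Chosen so that [32 y = 1 + x^2 >= x]; then [x^i <= 32^i y^i <= 32^i i! e^y], and the constant
   part of [y] yields the factor [expR 32^-1]. *)
pose y : R := 32^-1 + x ^+ 2 / 32.
have y0 : 0 <= y by rewrite /y; have := sqr_ge0 x; lra.
have f0 : 0 < i`!%:R :> R by rewrite ltr0n fact_gt0.
apply: (@le_trans _ _ ((32 * y) ^+ i)).
  rewrite lerXn2r ?nnegrE //; first by rewrite mulr_ge0.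
  by rewrite /y; have := sqr_ge0 (x - 1); nra.
rewrite exprMn -mulrA ler_wpM2l ?exprn_ge0 //.
by have := expr_div_fact_le_expR i y0; rewrite ler_pdivrMr // mulrC.
Qed.

Lemma normc_s (t : R) : normc ('ic * t%:C%C) = `|t|.
Proof. by rewrite Normc.normcM normc_i normc_real mul1r. Qed.

Lemma normc_monomial (c t : R) k :
  normc ((c *: 'X^k)%:CP.['ic * t%:C%C]) = `|c| * `|t| ^+ k.
Proof.
by rewrite map_polyZ /= map_polyXn hornerZ hornerXn Normc.normcM normc_real normcX normc_s.
Qed.

Section Truncation.
Variables (A : nat -> R) (K : nat).
Hypothesis A_le : forall k, `|A k| <= 2 ^+ k.

Let C0 : R := K%:R * 4 ^+ K.

(** With [|A_k| <= 2^k], each term of the phase polynomial on [|t| <= 2], once [|t|^3] is taken out,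
    is at most [4^K]; [C0] accounts for fewer than [K] such terms. *)
Lemma gpoly_term_le k u : (3 <= k < K.+1)%N -> 0 <= u <= 2 ->
  2 ^+ k * u ^+ (k - 3) <= 4 ^+ K :> R.
Proof.
move=> /andP[k3 kK] /andP[u0 u2].
apply: (@le_trans _ _ (2 ^+ K * 2 ^+ K)); last by rewrite -exprMn -natrM.
apply: ler_pM; rewrite ?exprn_ge0 //; first by apply: ler_weXn2l => //; rewrite ler1n.
apply: (@le_trans _ _ (2 ^+ (k - 3))); first by rewrite lerXn2r ?nnegrE.
by apply: ler_weXn2l; [rewrite ler1n|rewrite leq_subLR (leq_trans _ (leq_addl _ _))].
Qed.

Lemma normc_gpoly_le t : `|t| <= 2 ->
  normc ((gpoly A K)%:CP.['ic * t%:C%C]) <= C0 * `|t| ^+ 3.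
Proof.
move=> t2; rewrite rmorph_sum horner_sum /=; apply: le_trans (normc_sum _ _) _.
apply: (@le_trans _ _ (\sum_(3 <= k < K.+1) 4 ^+ K * `|t| ^+ 3)); last first.
  rewrite sumr_const_nat -[leLHS]mulr_natl [leLHS]mulrA ler_wpM2r ?exprn_ge0 // ler_wpM2r ?exprn_ge0 //.
  by rewrite ler_nat subSS leq_subr.
rewrite big_nat [leRHS]big_nat; apply: ler_sum => k kK; rewrite normc_monomial.
have k3 : (3 <= k)%N by case/andP: kK.
have -> : `|t| ^+ k = `|t| ^+ (k - 3) * `|t| ^+ 3 by rewrite -exprD subnK.
rewrite mulrA ler_wpM2r ?exprn_ge0 //.
have tt : 0 <= `|t| <= 2 by rewrite normr_ge0.
apply: le_trans (gpoly_term_le kK tt); rewrite ler_wpM2r ?exprn_ge0 //.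
rewrite !normrM normrX normrN1 expr1n mul1r normfV normr_nat ler_pdivrMr; last first.
  by rewrite ltr0n; case: k k3 {kK}.
by apply: le_trans (A_le k) _; rewrite ler_peMr ?exprn_ge0 // ler1n; case: k k3 {kK}.
Qed.

Lemma normc_deriv_gpoly_le t : `|t| <= 2 ->
  normc (((gpoly A K)^`())%:CP.['ic * t%:C%C]) <= C0 * `|t| ^+ 2.
Proof.
move=> t2; rewrite deriv_gpoly rmorph_sum horner_sum /=; apply: le_trans (normc_sum _ _) _.
apply: (@le_trans _ _ (\sum_(3 <= k < K.+1) 4 ^+ K * `|t| ^+ 2)); last first.
  rewrite sumr_const_nat -[leLHS]mulr_natl [leLHS]mulrA ler_wpM2r ?exprn_ge0 // ler_wpM2r ?exprn_ge0 //.
  by rewrite ler_nat subSS leq_subr.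
rewrite big_nat [leRHS]big_nat; apply: ler_sum => k kK; rewrite normc_monomial.
have k3 : (3 <= k)%N by case/andP: kK.
have -> : k.-1 = (k - 3 + 2)%N by case: k k3 {kK} => [|[|[|k]]] // _; rewrite subSS subSS subSS subn0 addn2.
rewrite exprD mulrA ler_wpM2r ?exprn_ge0 //.
have tt : 0 <= `|t| <= 2 by rewrite normr_ge0.
apply: le_trans (gpoly_term_le kK tt); rewrite ler_wpM2r ?exprn_ge0 //.
by rewrite normrM normrX normrN1 expr1n mul1r.
Qed.

Lemma normc_exp_gpoly_le (x t : R) r : 0 <= x -> `|t| <= 2 ->
  normc ((exp_poly (gpoly A K) x r)%:CP.['ic * t%:C%C]) <=
  \sum_(j < r) (x * (C0 * `|t| ^+ 3)) ^+ j.
Proof.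
move=> x0 t2; rewrite rmorph_sum horner_sum /=; apply: le_trans (normc_sum _ _) _.
apply: ler_sum => j _; rewrite map_polyZ rmorphXn /= hornerZ horner_exp.
rewrite Normc.normcM normc_real normcX exprMn normrM (ger0_norm (exprn_ge0 _ x0)).
rewrite normfV normr_nat -mulrA.
apply: (@le_trans _ _ (1 * (x ^+ j * (C0 * `|t| ^+ 3) ^+ j))); last by rewrite mul1r.
apply: ler_pM; rewrite ?invr_ge0 ?ler0n //.
- by rewrite mulr_ge0 ?exprn_ge0 // normc_ge0.
- by rewrite invf_le1 ?ltr0n ?fact_gt0 // ler1n fact_gt0.
- rewrite ler_wpM2l ?exprn_ge0 // lerXn2r ?nnegrE ?normc_ge0 //.
    by rewrite !mulr_ge0 ?exprn_ge0.
  exact: normc_gpoly_le.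
Qed.

End Truncation.

Section Weights.
Variables (d : nat) (a : 'I_d -> R).
Hypothesis d0 : (0 < d)%N.
Hypothesis a_ge : forall i, 1 / 2 <= a i.
Hypothesis a_le : forall i, a i <= 2.
Hypothesis a_sum : \sum_(i < d) a i = d%:R.

Let dn0 : d%:R != 0 :> R.
Proof. by rewrite pnatr_eq0 -lt0n. Qed.

Lemma power_mean_le k : `|power_mean a k| <= 2 ^+ k.
Proof.
rewrite /power_mean normrM normfV normr_nat mulrC ler_pdivrMr ?ltr0n //.
apply: le_trans (ler_norm_sum _ _ _) _.
apply: (@le_trans _ _ (\sum_(i < d) 2 ^+ k)).
  apply: ler_sum => i _; rewrite normrX lerXn2r ?nnegrE // ger0_norm //.
  by have := a_ge i; lra.
by rewrite sumr_const card_ord mulr_natr.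
Qed.

(** The weights have mean [1], so [A_2 - 1] is their variance. *)
Lemma power_mean2_ge1 : 1 <= power_mean a 2.
Proof.
have E : d%:R * (power_mean a 2 - 1) = \sum_(i < d) (a i - 1) ^+ 2.
  under eq_bigr do rewrite sqrrB1.
  rewrite !big_split /= sumrN sumrMnl a_sum sumr_const card_ord.
  by rewrite /power_mean mulrBr mulVKf // mulr1 [d%:R *+ 2]mulr2n; ring.
have : 0 <= d%:R * (power_mean a 2 - 1) by rewrite E sumr_ge0 // => i _; exact: sqr_ge0.
by rewrite pmulr_rge0 ?ltr0n // subr_ge0.
Qed.

Lemma normc_phi_le t : `|t| <= 2 -> normc (phi a t) <= expR (- (d%:R * t ^+ 2 / 16)).
Proof.
move=> t2; rewrite normc_phi.
apply: (@le_trans _ _ (\prod_(i < d) expR (- (t ^+ 2 / 16)))); last first.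
  rewrite -expR_sum sumr_const card_ord ler_expR -mulr_natl; lra.
apply: ler_prod => i _; rewrite invr_ge0 sqrtr_ge0 /= expRN lef_pV2 ?posrE ?expR_gt0 //; last first.
  by rewrite sqrtr_gt0 ltr_pwDl // sqr_ge0.
have tt : t ^+ 2 <= 4.
  by rewrite -real_normK ?num_real //; have := normr_ge0 t; nra.
have ai := a_ge i; have t0 := sqr_ge0 t.
rewrite -[leLHS]ger0_norm ?expR_ge0 // -sqrtr_sqr ler_wsqrtr // -expRM_natl.
apply: (@le_trans _ _ (1 + t ^+ 2 / 4)); last first.
  rewrite exprMn lerD2l mulrC ler_wpM2r //; nra.
(* As [a_i >= 1/2], each squared factor is at least [1 + y] with [0 <= y <= 1]. There
   [(1 + y) (1 - y/2) >= 1] gives [1 + y >= e^(y/2)], and the square root halves the exponent to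
   [t^2 / 16]. *)
set y := t ^+ 2 / 4.
have y1 : 0 <= y <= 1 by rewrite /y; apply/andP; split; lra.
have -> : 2%:R * (t ^+ 2 / 16) = y / 2 by rewrite /y; field.
have := expR_ge1Dx (- (y / 2)); rewrite expRN => h.
have e0 := expR_gt0 (y / 2).
have : (1 + - (y / 2)) * expR (y / 2) <= 1 by rewrite -ler_pdivlMr // div1r.
case/andP: y1 => y0 y1.
have : 1 <= (1 + y) * (1 + - (y / 2)) by nra.
nra.
Qed.

(** Factor by factor this is [1 + (a_i t)^2 <= e^((a_i t)^2)], the Gaussian of parameter [d A_2]
    being the product of the matching exponentials. It makes the derivative of [quot] bounded
    without loss. *)
Lemma gauss_phase_prod_le t :
  gauss (d%:R * power_mean a 2) t * normc (phase_prod a t) <= 1.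
Proof.
rewrite normc_prod /gauss expRN mulrC ler_pdivrMr ?expR_gt0 // mul1r.
rewrite /power_mean mulVKf // mulr_suml mulr_suml expR_sum.
apply: ler_prod => i _; rewrite normc_ge0 normc_line andTb.
rewrite -[leRHS]ger0_norm ?expR_ge0 // -sqrtr_sqr ler_wsqrtr // -expRM_natl.
apply: le_trans (expR_ge1Dx _) _; rewrite ler_expR exprMn; lra.
Qed.

Let C0 (K : nat) : R := K%:R * 4 ^+ K.

(** The difference is [phi (1 - quot)]. The decay comes from [phi]; the smallness of [quot - 1]
    comes from [quot a P 0 = 1] and the bound on its derivative. *)
Lemma phi_approx K r t : (2 <= K)%N -> `|t| <= 2 ->
  normc (phi a t - (gauss (d%:R * power_mean a 2) t)%:C%C *
    (exp_poly (gpoly (power_mean a) K) d%:R r.+1)%:CP.['ic * t%:C%C]) <=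
  expR (- (d%:R * t ^+ 2 / 16)) *
   (2 * ((d%:R * (C0 K * `|t| ^+ 3)) ^+ r.+1 +
     (\sum_(j < r.+1) (d%:R * (C0 K * `|t| ^+ 3)) ^+ j) *
      (`|t| ^+ K.+1 * d%:R * 2 ^+ K.+1))).
Proof.
move=> K2 t2; rewrite -quot_phi.
set P := exp_poly _ _ _.
have C00 : 0 <= C0 K by rewrite mulr_ge0 ?exprn_ge0.
have -> : phi a t - phi a t * quot a P t = - (phi a t * (quot a P t - 1)) by ring.
rewrite normcN Normc.normcM; apply: ler_pM; rewrite ?normc_ge0 //; first exact: normc_phi_le.
have q0 : quot a P 0 = 1.
  rewrite /quot [- d%:R * 0]mulr0 cis0 mul1r /gauss expr0n /= mulr0 mul0r oppr0 expR0.
  rewrite /phase_prod big1 => [|i _]; last by rewrite mulr0 mulr0 addr0.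
  rewrite mulr1 (_ : (1%:C)%C = 1) // mul1r.
  rewrite (_ : (0%:C)%C = 0) // mulr0 (@horner_map _ _ _ P 0) /= /P /exp_poly horner_sum.
  have g0 : (gpoly (power_mean a) K).[0] = 0.
    rewrite /gpoly horner_sum big1_seq // => k /=; rewrite mem_index_iota hornerZ hornerXn.
    by move=> /andP[k3 _]; rewrite expr0n; case: k k3 => [//|k] _; rewrite mulr0.
  rewrite big_ord_recl big1 => [|i _].
    by rewrite addr0 hornerZ horner_exp /= ?(expr0, fact0, invr1, mulr1).
  by rewrite hornerZ horner_exp g0 expr0n /= mulr0.
rewrite -q0.
set B := (X in _ <= 2 * X).
have B0 : 0 <= B.
  rewrite addr_ge0 ?exprn_ge0 ?mulr_ge0 ?exprn_ge0 // ?sumr_ge0 // => j _.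
  by rewrite exprn_ge0 // !mulr_ge0 // exprn_ge0.
(* A bound on the derivative of [quot] for all arguments up to [|t|]; [cderive_bound] turns it into
   [2 * b * |t| = 2 * B]. *)
pose b := d%:R * (C0 K * `|t| ^+ 2) * (d%:R * (C0 K * `|t| ^+ 3)) ^+ r +
  (\sum_(j < r.+1) (d%:R * (C0 K * `|t| ^+ 3)) ^+ j) * (`|t| ^+ K * d%:R * 2 ^+ K.+1).
have -> : 2 * B = 2 * b * `|t|.
  by rewrite /B /b !exprS; set S := \sum_(j < _) _; ring.
apply: (cderive_bound (fun x => cderive_quot r x d0 K2 a_sum)) => u ut.
have u2 := le_trans ut t2.
rewrite Normc.normcM Normc.normcM normc_i mul1r Normc.normcM normc_real ger0_norm ?expR_ge0 //.
rewrite Normc.normcM normc_cis mul1r.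
apply: le_trans (ler_piMl _ (gauss_phase_prod_le u)) _; first exact: normc_ge0.
apply: le_trans (le_normcD _ _) _; rewrite normcN !Normc.normcM; apply: lerD.
- rewrite !normc_real !normr_nat normcX Normc.normcM normc_real !normr_nat.
  apply: ler_pM; rewrite ?mulr_ge0 ?normc_ge0 ?exprn_ge0 ?mulr_ge0 ?normc_ge0 //.
  + rewrite ler_wpM2l //; apply: le_trans (normc_deriv_gpoly_le K power_mean_le u2) _.
    by rewrite ler_wpM2l // lerXn2r ?nnegrE.
  + rewrite -[leRHS]mul1r; apply: ler_pM; rewrite ?exprn_ge0 ?mulr_ge0 ?normc_ge0 //.
      by rewrite normfV normr_nat invf_le1 ?ltr0n ?fact_gt0 // ler1n fact_gt0.
    rewrite lerXn2r ?nnegrE ?mulr_ge0 ?normc_ge0 ?exprn_ge0 //.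
    rewrite ler_wpM2l //; apply: le_trans (normc_gpoly_le K power_mean_le u2) _.
    by rewrite ler_wpM2l // lerXn2r ?nnegrE.
- apply: ler_pM; rewrite ?mulr_ge0 ?normc_ge0 //.
    apply: le_trans (normc_exp_gpoly_le K power_mean_le r.+1 (ler0n _ _) u2) _.
    apply: ler_sum => j _; rewrite lerXn2r ?nnegrE ?mulr_ge0 ?exprn_ge0 //.
    by rewrite ler_wpM2l // ler_wpM2l // lerXn2r ?nnegrE.
  rewrite !normcX normcN Normc.normc1 expr1n mul1r normc_s -mulrA.
  apply: ler_pM; rewrite ?normc_ge0 ?exprn_ge0 //; first by rewrite lerXn2r ?nnegrE.
  apply: le_trans (normc_sum _ _) _.
  rewrite mulr_natl -[d in leRHS]card_ord -sumr_const; apply: ler_sum => i _.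
  rewrite Normc.normcM normcX normc_real Normc.normcV.
  have ai := a_ge i; have ai2 := a_le i.
  rewrite ler_pdivrMr ?(lt_le_trans ltr01) ?normc_line_ge1 //.
  rewrite -[leLHS]mulr1; apply: ler_pM; rewrite ?exprn_ge0 ?normc_line_ge1 //.
  by rewrite lerXn2r ?nnegrE // ger0_norm //; lra.
Qed.

End Weights.

Lemma cubic_scaling (D c h x : R) : D * h ^+ 2 = 1 ->
  D * (c * (h * x) ^+ 3) = h * (c * x ^+ 3).
Proof.
by move=> E; transitivity (D * h ^+ 2 * (h * (c * x ^+ 3))); [ring|rewrite E mul1r].
Qed.

(** In the variable [x = sqrt d |t|], with [h = 1 / sqrt d], one has [d |t|^3 = h x^3]. Truncating
    the exponential after [2n + 2] terms gives the error [h^(2n+2)], and truncating the phase at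
    degree [2n + 3] gives [d h^(2n+4) = h^(2n+2)]: both orders are chosen to reach [d^-(n+1)]. *)
Lemma laplace_pointwise (n : nat) : exists C : R, 0 <= C /\
  forall (d : nat) (a : 'I_d -> R) (t : R), (0 < d)%N ->
    (forall i, 1 / 2 <= a i) -> (forall i, a i <= 2) -> \sum_(i < d) a i = d%:R ->
    `|t| <= 2 ->
  normc (phi a t - (gauss (d%:R * power_mean a 2) t)%:C%C *
    (exp_poly (gpoly (power_mean a) n.*2.+3) d%:R n.*2.+2)%:CP.['ic * t%:C%C]) <=
  C / d%:R ^+ n.+1 * expR (- (d%:R * t ^+ 2 / 32)).
Proof.
set K := n.*2.+3; pose C0 : R := K%:R * 4 ^+ K.
(* The error bound in the variable [x], after [h^(2n+2)] is factored out and the remaining powers of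
   [h] are bounded by [1]. *)
pose Q : {poly R} := 2 *: ((C0 *: 'X^3) ^+ n.*2.+2 +
  (\sum_(j < n.*2.+2) (C0 *: 'X^3) ^+ j) * (2 ^+ K.+1 *: 'X^(n.*2.+4))).
have [C [C_ge0 HC]] := poly_gauss_bound Q.
exists C; split => // d a t d0 a1 a2 aS t2.
apply: le_trans (phi_approx d0 a1 a2 aS n.*2.+1 (isT : (2 <= n.*2.+3)%N) t2) _.
have C00 : 0 <= C0 by rewrite mulr_ge0 ?exprn_ge0.
have u0 : 0 <= `|t| by [].
move: u0; set u : R := `|t| => u0; pose h : R := (Num.sqrt d%:R)^-1; pose x : R := Num.sqrt d%:R * u.
have s0 : 0 < Num.sqrt d%:R :> R by rewrite sqrtr_gt0 ltr0n.
have d0R : 0 < d%:R :> R by rewrite ltr0n.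
have h2 : h ^+ 2 = d%:R^-1 by rewrite /h exprVn sqr_sqrtr // ltW.
have h0 : 0 <= h by rewrite /h invr_ge0 ltW.
have h1 : h <= 1.
  by rewrite /h invf_le1 // -[leLHS]sqrtr1 ler_wsqrtr // ler1n.
have ux : u = h * x by rewrite /x /h mulKf // gt_eqF.
have x0 : 0 <= x := mulr_ge0 (ltW s0) u0.
have dh : d%:R * h ^+ 2 = 1 by rewrite h2 divff // gt_eqF.
have y_eq : d%:R * (C0 * u ^+ 3) = h * (C0 * x ^+ 3).
  by rewrite ux cubic_scaling.
have t_eq : d%:R * t ^+ 2 = x ^+ 2.
  by rewrite /x exprMn sqr_sqrtr ?ltW // real_normK ?num_real.
rewrite t_eq -/K -/C0 -/u y_eq.
have hpow : h ^+ n.*2.+2 = (d%:R ^+ n.+1)^-1 by rewrite -doubleS -mul2n exprM h2 exprVn.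
apply: (@le_trans _ _ (expR (- (x ^+ 2 / 16)) * (h ^+ n.*2.+2 * Q.[x]))).
  have -> : Q.[x] = 2 * ((C0 * x ^+ 3) ^+ n.*2.+2 +
      (\sum_(j < n.*2.+2) (C0 * x ^+ 3) ^+ j) * (2 ^+ K.+1 * x ^+ n.*2.+4)).
    rewrite /Q hornerZ hornerD horner_exp hornerZ hornerXn; congr (_ * (_ + _)).
    rewrite hornerM hornerZ hornerXn horner_sum; congr (_ * _).
    by apply: eq_bigr => j _; rewrite horner_exp hornerZ hornerXn.
  rewrite ler_wpM2l ?expR_ge0 //.
  rewrite [leRHS]mulrCA ler_wpM2l // mulrDr lerD //; first by rewrite exprMn.
  have -> : u ^+ K.+1 * d%:R * 2 ^+ K.+1 = h ^+ n.*2.+2 * (2 ^+ K.+1 * x ^+ n.*2.+4).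
    have -> : K.+1 = n.*2.+4 by [].
    rewrite ux exprMn (_ : h ^+ n.*2.+4 = h ^+ n.*2.+2 * h ^+ 2); last by rewrite -exprD addn2.
    transitivity (d%:R * h ^+ 2 * (h ^+ n.*2.+2 * (2 ^+ n.*2.+4 * x ^+ n.*2.+4))).
      by ring.
    by rewrite dh mul1r.
  have z0 : 0 <= C0 * x ^+ 3 := mulr_ge0 C00 (exprn_ge0 3 x0).
  rewrite [leRHS]mulrCA; apply: ler_wpM2r.
    apply: mulr_ge0; first exact: exprn_ge0.
    by apply: mulr_ge0; apply: exprn_ge0.
  apply: ler_sum => j _; apply: lerXn2r; rewrite ?nnegrE //; first exact: mulr_ge0.
  exact: ler_piMl.
rewrite hpow mulrCA [leRHS]mulrAC [leRHS]mulrC; apply: ler_wpM2l.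
  by rewrite invr_ge0 exprn_ge0 // ltW.
apply: (@le_trans _ _ (expR (- (x ^+ 2 / 16)) * (C * expR (x ^+ 2 / 32)))).
  by apply: ler_wpM2l; [exact: expR_ge0|exact: HC].
rewrite mulrCA -expRD ler_wpM2l // ler_expR; lra.
Qed.

End LaplaceBounds.

(** * Gaussian moments on a bounded segment *)

Section GaussianMoments.
Context {R : realType}.

Lemma continuous_mul (f g : R -> R) : continuous f -> continuous g ->
  continuous (fun t => f t * g t).
Proof. by move=> cf cg t; exact: continuousM (cf t) (cg t). Qed.

Lemma continuous_sub (f g : R -> R) : continuous f -> continuous g ->
  continuous (fun t => f t - g t).
Proof. by move=> cf cg t; exact: continuousB (cf t) (cg t). Qed.

Lemma continuous_scale (c : R) (f : R -> R) : continuous f ->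
  continuous (fun t => c * f t).
Proof. by move=> cf; apply: continuous_mul => //; exact: cst_continuous. Qed.

(** The common unit of both Laplace expansions. It cancels in their quotient, so only a crude lower
    bound on it enters the estimates. *)
Definition gauss_mass (d : nat) : R := intg (- 2) 2 (gauss d%:R).

Definition gauss_moment (c : R) (m : nat) : R :=
  intg (- 2) 2 (fun t => t ^+ m * gauss c t).

(** The double factorial [(2j-1)!!], the moment of order [2j] of the standard Gaussian. *)
Definition dfact (j : nat) : R := \prod_(i < j) (i.*2.+1)%:R.

Lemma dfactS j : dfact j.+1 = dfact j * (j.*2.+1)%:R.
Proof. by rewrite /dfact big_ord_recr. Qed.

Lemma dfact_ge0 j : 0 <= dfact j.
Proof. by apply: prodr_ge0 => i _. Qed.

Lemma monomial_gauss_continuous (c : R) m : continuous (fun t : R => t ^+ m * gauss c t).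
Proof.
by apply: continuous_mul; [exact: exprn_continuous|exact: gauss_continuous].
Qed.

(** Integration by parts of [t^(m+1) gauss c t]; the last term is the contribution of the endpoints
    [2] and [- 2]. *)
Lemma gauss_moment_rec (c : R) m :
  c * gauss_moment c m.+2 = m.+1%:R * gauss_moment c m -
    (2 ^+ m.+1 - (- 2) ^+ m.+1) * expR (- (2 * c)).
Proof.
have cf : continuous (fun t : R => m.+1%:R * (t ^+ m * gauss c t) - c * (t ^+ m.+2 * gauss c t)).
  by apply: continuous_sub; apply: continuous_scale; exact: monomial_gauss_continuous.
have E : intg (- 2) 2 (fun t => m.+1%:R * (t ^+ m * gauss c t) - c * (t ^+ m.+2 * gauss c t)) =
   2 ^+ m.+1 * gauss c 2 - (- 2) ^+ m.+1 * gauss c (- 2).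
  apply: (@intg_FTC _ (fun t => t ^+ m.+1 * gauss c t)) => //; first by lra.
  move=> t _.
  have -> : (fun t : R => t ^+ m.+1 * gauss c t) = id ^+ m.+1 * gauss c.
    by apply/funext => x; rewrite !fctE.
  have := is_deriveM (is_deriveX m.+1 (is_derive_id t 1)) (is_derive_gauss c t).
  by move=> /is_derive_eq; apply; rewrite !fctE /GRing.scale /= !exprS mulr1; ring.
have g2 : gauss c 2 = expR (- (2 * c)) by rewrite /gauss; congr expR; field.
have gN2 : gauss c (- 2) = expR (- (2 * c)) by rewrite /gauss; congr expR; field.
rewrite g2 gN2 -mulrBl in E; rewrite -E intgB.
- rewrite !intgZ; try exact: monomial_gauss_continuous.
  by rewrite -!/(gauss_moment c _); ring.
- by apply: continuous_scale; exact: monomial_gauss_continuous.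
- by apply: continuous_scale; exact: monomial_gauss_continuous.
Qed.

(** Iterates the recursion; the boundary terms stay exponentially small because [1 <= c] makes every
    division by [c] harmless. *)
Lemma gauss_moment_even j : exists C : R, 0 <= C /\ forall c, 1 <= c ->
  `|gauss_moment c j.*2 - dfact j / c ^+ j * gauss_moment c 0| <= C * expR (- (2 * c)).
Proof.
elim: j => [|j [C [C0 ih]]].
  exists 0; split=> // c c1.
  by rewrite double0 /dfact big_ord0 expr0 divr1 mul1r subrr normr0 mul0r.
exists (j.*2.+1%:R * C + 2 * 2 ^+ j.*2.+1); split.
  by rewrite addr_ge0 ?mulr_ge0 ?exprn_ge0.
move=> c c1; have c0 : 0 < c by lra.
have cn0 : c != 0 by rewrite gt_eqF.
have E := gauss_moment_rec c j.*2.
have -> : (j.+1).*2 = j.*2.+2 by [].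
have s2 : (- 2) ^+ j.*2.+1 = - 2 ^+ j.*2.+1 :> R.
  by rewrite exprNn -signr_odd /= odd_double expr1 mulN1r.
rewrite s2 opprK in E.
have -> : gauss_moment c j.*2.+2 = (c * gauss_moment c j.*2.+2) / c by field.
rewrite E dfactS [c ^+ j.+1]exprS.
have -> : (j.*2.+1%:R * gauss_moment c j.*2 -
     (2 ^+ j.*2.+1 + 2 ^+ j.*2.+1) * expR (- (2 * c))) / c -
     dfact j * j.*2.+1%:R / (c * c ^+ j) * gauss_moment c 0 =
   (j.*2.+1%:R * (gauss_moment c j.*2 - dfact j / c ^+ j * gauss_moment c 0) -
     (2 * 2 ^+ j.*2.+1) * expR (- (2 * c))) / c.
  by field; rewrite cn0 expf_neq0.
rewrite normrM normfV (gtr0_norm c0) ler_pdivrMr //.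
apply: (@le_trans _ _ ((j.*2.+1%:R * C + 2 * 2 ^+ j.*2.+1) * expR (- (2 * c)))); last first.
  by rewrite ler_peMr // mulr_ge0 ?expR_ge0 // addr_ge0 ?mulr_ge0 ?exprn_ge0.
apply: le_trans (ler_normB _ _) _; rewrite [leRHS]mulrDl; apply: lerD.
  by rewrite normrM normr_nat -[leRHS]mulrA ler_wpM2l // ih.
by rewrite ger0_norm // !mulr_ge0 ?exprn_ge0 ?expR_ge0.
Qed.

Lemma gauss_ge0 (c t : R) : 0 <= gauss c t.
Proof. exact: expR_ge0. Qed.

Lemma intg_gauss_ge0 (c a b : R) : 0 <= intg a b (gauss c).
Proof. by apply: Rintegral_ge0 => t _; exact: gauss_ge0. Qed.

Lemma intg_gauss_tail (d : nat) (b : R) : 2 <= b <= 4 ->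
  0 <= intg (- b) b (gauss d%:R) - gauss_mass d <= 4 * expR (- (2 * d%:R)).
Proof.
move=> /andP[b2 b4]; rewrite /gauss_mass.
have cg := @gauss_continuous R d%:R.
have [->|bn2] := eqVneq b 2; first by rewrite subrr lexx mulr_ge0 ?expR_ge0.
have b2' : 2 < b by rewrite lt_neqAle eq_sym bn2.
rewrite (@intg_split _ _ (- b) (- 2) b) //; try lra.
rewrite (@intg_split _ _ (- 2) 2 b) //; try lra.
rewrite addrA [X in X - _]addrAC addrK.
rewrite addr_ge0 ?intg_gauss_ge0 //=.
have gle (t : R) : 2 <= `|t| -> gauss d%:R t <= expR (- (2 * d%:R)).
  move=> t2; rewrite ler_expR lerN2.
  have : 4 <= t ^+ 2 by rewrite -real_normK ?num_real //; nra.
  have : 0 <= d%:R :> R by [].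
  nra.
have e0 := expR_ge0 (- (2 * d%:R) : R).
have h1 : intg 2 b (gauss d%:R) <= expR (- (2 * d%:R)) * (b - 2).
  rewrite -intg_cst //; apply: intg_le => //; first exact: cst_continuous.
  by move=> t /andP[t2 _]; apply: gle; rewrite ger0_norm //; lra.
have h2 : intg (- b) (- 2) (gauss d%:R) <= expR (- (2 * d%:R)) * (- 2 - - b).
  rewrite -intg_cst; last lra.
  apply: intg_le => //; first exact: cst_continuous.
  by move=> t /andP[_ t2]; apply: gle; rewrite ler0_norm; lra.
nra.
Qed.

Lemma gauss_scale (c s t : R) : gauss c (s * t) = gauss (s ^+ 2 * c) t.
Proof. by rewrite /gauss; congr expR; ring. Qed.

(** The substitution [t -> sqrt s t] produces the factor [1 / sqrt A_2] of the expansion. Since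
    [sqrt s <= 2], the new segment lies in [[-4, 4]], and what it adds to [[-2, 2]] is exponentially
    small. *)
Lemma gauss_moment0_scale (d : nat) (s : R) : 1 <= s <= 4 ->
  `|gauss_moment (d%:R * s) 0 - (Num.sqrt s)^-1 * gauss_mass d| <= 4 * expR (- (2 * d%:R)).
Proof.
move=> /andP[s1 s4]; set r := Num.sqrt s.
have r1 : 1 <= r by rewrite /r -[leLHS]sqrtr1 ler_wsqrtr.
have rr : r ^+ 2 = s by rewrite sqr_sqrtr //; lra.
have r2 : r <= 2 by nra.
have r0 : 0 < r by lra.
have -> : gauss_moment (d%:R * s) 0 = intg (- 2) 2 (fun t => gauss d%:R (r * t)).
  by apply: intg_eq => t _; rewrite expr0 mul1r gauss_scale rr mulrC.
rewrite intg_scale //; [|lra|exact: gauss_continuous].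
rewrite -mulrBr mulrN normrM.
have b24 : 2 <= r * 2 <= 4 by apply/andP; split; lra.
have /andP[t0 t1] := intg_gauss_tail d b24.
rewrite (ger0_norm t0) ger0_norm ?invr_ge0 ?(ltW r0) //.
by apply: le_trans t1; rewrite ler_piMl // invf_le1.
Qed.

(** The integrand is at least [1/2] for [|t| <= 1/d]. The true order is [d^(-1/2)], but a lower
    bound by any power of [d] suffices for comparison with exponentials. *)
Lemma gauss_mass_ge (d : nat) : (0 < d)%N -> d%:R^-1 <= gauss_mass d :> R.
Proof.
move=> d0; have dR : 1 <= d%:R :> R by rewrite ler1n.
have cg := @gauss_continuous R d%:R.
set h := d%:R^-1; have h0 : 0 < h by rewrite invr_gt0; lra.
have h1 : h <= 1 by rewrite invf_le1 //; lra.
rewrite /gauss_mass (@intg_split _ _ (- 2) (- h) 2) //; try lra.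
rewrite (@intg_split _ _ (- h) h 2) //; try lra.
have g1 := intg_gauss_ge0 d%:R (- 2) (- h).
have g2 := intg_gauss_ge0 d%:R h 2.
have : (2^-1) * (h - - h) <= intg (- h) h (gauss d%:R).
  rewrite -intg_cst; last lra.
  apply: intg_le => //; first exact: cst_continuous.
  move=> t /andP[ta tb]; rewrite /gauss; apply: le_trans (expR_ge1Dx _).
  have : d%:R * t ^+ 2 <= 1.
    apply: (@le_trans _ _ (d%:R * h ^+ 2)); first by rewrite ler_wpM2l //; nra.
    by rewrite expr2 mulrA divff ?mul1r // pnatr_eq0 -lt0n.
  lra.
lra.
Qed.

Lemma gauss_mass_gt0 (d : nat) : (0 < d)%N -> 0 < gauss_mass d :> R.
Proof. by move=> d0; apply: lt_le_trans (gauss_mass_ge d0); rewrite invr_gt0 ltr0n. Qed.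

(** Bounds the integral of the pointwise error, whose weight [e^(-d t^2/32)] is this Gaussian, four
    times as wide as the reference one. *)
Lemma intg_wide_gauss (d : nat) : intg (- 2) 2 (gauss (d%:R / 16 : R)) <= 4 * gauss_mass d.
Proof.
have cg := @gauss_continuous R d%:R.
have -> : intg (- 2) 2 (gauss (d%:R / 16 : R)) = intg (- 2) 2 (fun t => gauss d%:R (4^-1 * t)).
  by apply: intg_eq => t _; rewrite gauss_scale exprVn -natrX [_ * d%:R]mulrC.
rewrite intg_scale //; try lra.
rewrite invrK ler_wpM2l // /gauss_mass.
rewrite (@intg_split _ _ (- 2) (4^-1 * - 2) 2) //; try lra.
rewrite (@intg_split _ _ (4^-1 * - 2) (4^-1 * 2) 2) //; try lra.
have g1 := intg_gauss_ge0 d%:R (- 2) (4^-1 * - 2).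
have g2 := intg_gauss_ge0 d%:R (4^-1 * 2) 2.
lra.
Qed.

(** From [e^y >= y^(n+1) / (n+1)!] with [y = x d]; the extra power of [d] pays for
    [gauss_mass d >= 1/d]. *)
Lemma expR_negligible (x : R) (n : nat) : 0 < x -> exists C : R, 0 <= C /\
  forall d, (0 < d)%N -> expR (- (x * d%:R)) <= C * gauss_mass d / d%:R ^+ n.
Proof.
move=> x0; exists ((n.+1)`!%:R / x ^+ n.+1); split.
  by rewrite divr_ge0 ?exprn_ge0 // ltW.
move=> d d0; have dR : 0 < d%:R :> R by rewrite ltr0n.
have := @expr_div_fact_le_expR R (x * d%:R) n.+1 (mulr_ge0 (ltW x0) (ltW dR)).
have f0 : 0 < (n.+1)`!%:R :> R by rewrite ltr0n fact_gt0.
rewrite ler_pdivrMr // => h.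
rewrite expRN -mulrA -mulrA.
apply: (@le_trans _ _ ((n.+1)`!%:R * ((x ^+ n.+1)^-1 * (d%:R^-1 / d%:R ^+ n)))); last first.
  apply: ler_wpM2l; first exact: ltW.
  apply: ler_wpM2l; first by rewrite invr_ge0 exprn_ge0 // ltW.
  apply: ler_wpM2r; last exact: gauss_mass_ge.
  by rewrite invr_ge0 exprn_ge0 // ltW.
rewrite -invfM -exprS -invfM -exprMn ler_pdivlMr ?exprn_gt0 ?mulr_gt0 //.
by rewrite mulrC ler_pdivrMr ?expR_gt0 // [leRHS]mulrC.
Qed.

End GaussianMoments.

(** * Coefficients of powers of the phase polynomial *)

Section PowerCoefficients.
Context {R : realType}.
Implicit Types (p q : {poly R}).

Lemma coef_exp_low p i m : (forall j, (j < 3)%N -> p`_j = 0) -> (m < 3 * i)%N ->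
  (p ^+ i)`_m = 0.
Proof.
move=> p0; elim: i m => [|i ih] m; first by rewrite muln0.
move=> mi; rewrite exprS coefM big1 // => j _.
have [j3|j3] := ltnP j 3; first by rewrite p0 // mul0r.
by rewrite ih ?mulr0 //; have := ltn_ord j; lia.
Qed.

(** In a product of [i + 1] factors of order at least [3], a factor contributing degree [j] leaves
    at least [3 i] to the others, so [j <= m - 3 i < k]. *)
Lemma coef_exp_trunc p q i k m : (forall j, (j < 3)%N -> p`_j = 0) ->
  (forall j, (j < k)%N -> p`_j = q`_j) -> (3 <= k)%N -> (m < k + 3 * i)%N ->
  (p ^+ i.+1)`_m = (q ^+ i.+1)`_m.
Proof.
move=> p0 pq k3; have q0 j : (j < 3)%N -> q`_j = 0.
  by move=> j3; rewrite -pq ?p0 // (leq_trans j3).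
elim: i m => [|i ih] m; first by rewrite muln0 addn0 !expr1; exact: pq.
move=> mi; rewrite exprS [in RHS]exprS !coefM; apply: eq_bigr => j _.
have jm : (j <= m)%N by rewrite -ltnS.
have [j3|j3] := ltnP j 3; first by rewrite p0 // q0 // !mul0r.
rewrite ih; last by lia.
have [jk|jk] := ltnP j k; first by rewrite pq.
by rewrite (@coef_exp_low q) ?mulr0 //; lia.
Qed.

Lemma coef_gpoly (A : nat -> R) K j : (gpoly A K)`_j =
  if (3 <= j < K.+1)%N then (-1) ^+ j * A j / j%:R else 0.
Proof.
rewrite /gpoly coef_sum; under eq_bigr do rewrite coefZ coefXn.
case: ifPn => jK.
  rewrite (bigD1_seq j) ?iota_uniq ?mem_index_iota //= eqxx mulr1 big1 ?addr0 //.
  by move=> k /negbTE kj; rewrite eq_sym kj mulr0.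
rewrite big1_seq // => k /=; rewrite mem_index_iota => kK.
by have [jk|_] := eqVneq; [rewrite jk kK in jK|rewrite mulr0].
Qed.

(** For [i >= 1] a single factor contributes degree at most [2 (i + l) - 3 (i - 1) = 2 l + 3 - i <=
    2 l + 2]. This is why the coefficient of [d^-l] involves [A_2, ..., A_(2l+2)] only. *)
Lemma gpoly_exp_trunc (A : nat -> R) K l i : (l.*2.+2 <= K)%N ->
  (gpoly A K ^+ i)`_((i + l).*2) = (gpoly A l.*2.+2 ^+ i)`_((i + l).*2).
Proof.
move=> lK; case: i => [|i]; first by rewrite !expr0.
apply: (@coef_exp_trunc _ _ i l.*2.+3) => //.
- by move=> j j3; rewrite coef_gpoly leqNgt j3.
- by move=> j jl; rewrite !coef_gpoly jl (leq_trans jl).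
- lia.
Qed.

Lemma coef_gpoly_exp_bound K i : exists B : R, 0 <= B /\
  forall A, (forall k, `|A k| <= 2 ^+ k) -> forall m, `|(gpoly A K ^+ i)`_m| <= B.
Proof.
elim: i => [|i [B [B0 ih]]].
  by exists 1; split=> // A _ m; rewrite expr0 coef1; case: (m == _); rewrite ?normr1 ?normr0.
exists (\sum_(3 <= k < K.+1) 2 ^+ k * B); split.
  by apply: sumr_ge0 => k _; rewrite mulr_ge0 ?exprn_ge0.
move=> A HA m; rewrite exprS {1}/gpoly mulr_suml coef_sum.
apply: le_trans (ler_norm_sum _ _ _) _; rewrite big_nat [leRHS]big_nat; apply: ler_sum => k /andP[k3 _].
rewrite -scalerAl coefZ coefXnM normrM; apply: ler_pM => //.
  rewrite !normrM normrX normrN1 expr1n mul1r normfV normr_nat ler_pdivrMr; last first.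
    by rewrite ltr0n; case: k k3.
  by apply: le_trans (HA k) _; rewrite ler_peMr ?exprn_ge0 // ler1n; case: k k3.
by case: ifP => _; [rewrite normr0|exact: ih].
Qed.

Lemma sum_even_odd (V : zmodType) (F : nat -> V) J :
  \sum_(m < J.*2) F m = \sum_(j < J) (F j.*2 + F j.*2.+1).
Proof.
elim: J => [|J ih]; first by rewrite double0 !big_ord0.
by rewrite doubleS !big_ord_recr /= ih addrA.
Qed.

(** Odd powers of [it] are purely imaginary, hence only even coefficients survive. *)
Lemma Re_horner_imag p (t : R) J : (size p <= J.*2)%N ->
  complex.Re (p%:CP.['ic * t%:C%C]) = \sum_(j < J) (-1) ^+ j * p`_j.*2 * t ^+ j.*2.
Proof.
move=> sp; rewrite (@horner_coef_wide _ J.*2) ?size_map_poly //.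
rewrite Re_sum (sum_even_odd (fun m => complex.Re ((p%:CP)`_m * ('ic * t%:C%C) ^+ m))).
apply: eq_bigr => j _; rewrite !coef_map /=.
have E : ('ic * t%:C%C) ^+ j.*2 = ((-1) ^+ j * t ^+ j.*2)%:C%C.
  have i2 : 'ic ^+ 2 = -1 :> R[i] := sqr_i R.
  by rewrite -mul2n !exprM [('ic * _) ^+ 2]exprMn i2 exprMn rmorphM /= !rmorphXn rmorphN rmorph1.
rewrite exprS E !ReM !ImM /=; ring.
Qed.

End PowerCoefficients.

(** * Asymptotic expansion of the integral of [phi] *)

Section LaplaceExpansion.
Context {R : realType}.

(* Coefficient of [d^-l] in [\int gauss (d A_2) t * exp (d (gpoly A K).[it]) dt],
   relative to [\int gauss d]: expand the exponential and replace every monomial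
   by its Gaussian moment; [t^(2j)] contributes [(2j-1)!! / (d A_2)^j]. *)
Definition laplace_coef (A : nat -> R) (l : nat) : R :=
  (Num.sqrt (A 2%N))^-1 * \sum_(i < l.*2.+1)
    (-1) ^+ (i + l) / i`!%:R * (gpoly A l.*2.+2 ^+ i)`_((i + l).*2) *
    (dfact (i + l) / A 2%N ^+ (i + l)).

Lemma size_gpoly_exp (A : nat -> R) K i : (size (gpoly A K ^+ i) <= (K * i).+1)%N.
Proof.
apply: leq_trans (size_poly_exp_leq _ _) _; rewrite ltnS leq_mul2r; apply/orP; right.
rewrite -subn1 leq_subLR add1n; apply/leq_sizeP => j jK.
by rewrite coef_gpoly [(j < K.+1)%N]ltnNge jK andbF.
Qed.

(** Degrees [2 j] with [j < i] vanish because [g^i] starts at degree [3 i]. The index is therefore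
    shifted to [j = i + l]: the prefactor [d^i] against the moment of order [d^-(i+l)] leaves
    exactly [d^-l]. *)
Lemma intg_gauss_gpoly_exp (A : nat -> R) K i L (c : R) : (K * i < L)%N ->
  intg (- 2) 2 (fun t => gauss c t * complex.Re ((gpoly A K ^+ i)%:CP.['ic * t%:C%C])) =
  \sum_(l < L) (-1) ^+ (i + l) * (gpoly A K ^+ i)`_((i + l).*2) * gauss_moment c (i + l).*2.
Proof.
move=> KL; set g := gpoly A K ^+ i.
have sg : (size g <= (i + L).*2)%N.
  apply: leq_trans (size_gpoly_exp _ _ _) _; apply: leq_trans KL _.
  by rewrite -addnn (leq_trans (leq_addl i L)) // leq_addr.
transitivity (intg (- 2) 2 (fun t => \sum_(j < i + L) ((-1) ^+ j * g`_j.*2) * (t ^+ j.*2 * gauss c t))).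
  apply: intg_eq => t _; rewrite (Re_horner_imag t sg) mulr_sumr; apply: eq_bigr => j _; ring.
rewrite intg_sum; last first.
  by move=> j; apply: continuous_scale; exact: monomial_gauss_continuous.
rewrite big_split_ord /= big1 ?add0r => [|j _]; last first.
  rewrite intgZ; last exact: monomial_gauss_continuous.
  rewrite coef_exp_low ?mulr0 ?mul0r //.
    by move=> k k3; rewrite coef_gpoly leqNgt k3.
  by rewrite -mul2n -[(2 * j)%N]add0n -[3%N]/(1 + 2)%N mulnDl mul1n; have := ltn_ord j; lia.
by apply: eq_bigr => l _; rewrite intgZ //; exact: monomial_gauss_continuous.
Qed.

End LaplaceExpansion.

Section LaplaceExpansionProof.
Context {R : realType}.

Let term (A : nat -> R) (K i l : nat) : R :=
  (-1) ^+ (i + l) / i`!%:R * (gpoly A K ^+ i)`_((i + l).*2) *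
    (dfact (i + l) / A 2%N ^+ (i + l)).

Let term_bound K : exists B : nat -> nat -> R, (forall i l, 0 <= B i l) /\
  forall A, (forall k, `|A k| <= 2 ^+ k) -> 1 <= A 2%N ->
  forall i l, `|term A K i l| <= B i l.
Proof.
have [B HB] := choice (fun i => @coef_gpoly_exp_bound R K i).
exists (fun i l => B i * dfact (i + l)); split.
  by move=> i l; have [? _] := HB i; rewrite mulr_ge0 // dfact_ge0.
move=> A HA A2 i l; have [B0 /(_ A HA) HBi] := HB i.
rewrite /term normrM; apply: ler_pM => //.
  rewrite normrM -[leRHS]mul1r; apply: ler_pM => //.
  rewrite normrM normrX normrN1 expr1n mul1r normfV normr_nat.
  by rewrite invf_le1 ?ltr0n ?fact_gt0 // ler1n fact_gt0.
rewrite normrM ger0_norm ?dfact_ge0 // normfV normrX ger0_norm; last lra.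
rewrite ler_piMr ?dfact_ge0 // invf_le1 ?exprn_ege1 // exprn_gt0 //; lra.
Qed.

Lemma laplace_coef_bound l : exists B : R, 0 <= B /\
  forall A, (forall k, `|A k| <= 2 ^+ k) -> 1 <= A 2%N -> `|laplace_coef A l| <= B.
Proof.
have [B [B0 HB]] := term_bound l.*2.+2.
exists (\sum_(i < l.*2.+1) B i l); split; first exact: sumr_ge0.
move=> A HA A2; rewrite /laplace_coef normrM -[leRHS]mul1r; apply: ler_pM => //.
  have s1 : 1 <= Num.sqrt (A 2%N) by rewrite -[leLHS]sqrtr1 ler_wsqrtr.
  by rewrite normfV ger0_norm ?invf_le1 //; lra.
apply: le_trans (ler_norm_sum _ _ _) _; apply: ler_sum => i _; exact: HB.
Qed.

(** Terms with [i > 2 l] vanish since [2 (i + l) < 3 i], and the remaining ones do not see the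
    truncation degree. So the truncation chosen for [n] yields the intrinsic coefficients. *)
Let term_sum A n l : (l <= n)%N ->
  \sum_(i < n.*2.+2) term A n.*2.+3 i l = \sum_(i < l.*2.+1) term A l.*2.+2 i l.
Proof.
move=> ln; have h : (l.*2.+1 <= n.*2.+2)%N by lia.
have : (l.*2.+2 <= n.*2.+3)%N by lia.
move: n.*2.+3 => K lK; rewrite -(subnKC h) big_split_ord /= [X in _ + X]big1 ?addr0 => [|i _].
  by apply: eq_bigr => i _; rewrite /term gpoly_exp_trunc.
rewrite /term coef_exp_low ?mulr0 ?mul0r //; last by lia.
by move=> j j3; rewrite coef_gpoly leqNgt j3.
Qed.

Lemma Re_realM (x : R) (z : R[i]) : complex.Re (x%:C%C * z) = x * complex.Re z.
Proof. by case: z => u v /=; rewrite mul0r subr0. Qed.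

Lemma Re_exp_poly (g : {poly R}) x r z :
  complex.Re ((exp_poly g x r)%:CP.[z]) =
  \sum_(i < r) i`!%:R^-1 * x ^+ i * complex.Re ((g ^+ i)%:CP.[z]).
Proof.
rewrite /exp_poly rmorph_sum horner_sum Re_sum; apply: eq_bigr => i _.
by rewrite /= map_polyZ hornerZ Re_realM.
Qed.

(** Replaces each truncated Gaussian moment by its leading value [(2j-1)!! / c^j] times
    [gauss_mass d / sqrt A_2]. Each replacement costs [e^(-2d)], up to constants uniform in [A]. *)
Let error_bound n : exists C : R, 0 <= C /\
  forall (d : nat) (A : nat -> R), (0 < d)%N -> (forall k, `|A k| <= 2 ^+ k) ->
    1 <= A 2%N <= 4 ->
  `| \sum_(i < n.*2.+2) i`!%:R^-1 * d%:R ^+ i *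
      \sum_(l < n.+1 + (n.*2.+3 * n.*2.+2).+1)
        (-1) ^+ (i + l) * (gpoly A n.*2.+3 ^+ i)`_((i + l).*2) *
         gauss_moment (d%:R * A 2%N) (i + l).*2
   - \sum_(i < n.*2.+2) \sum_(l < n.+1 + (n.*2.+3 * n.*2.+2).+1)
       (Num.sqrt (A 2%N))^-1 * gauss_mass d * (term A n.*2.+3 i l / d%:R ^+ l) | <=
  C * gauss_mass d / d%:R ^+ n.+1.
Proof.
set K := n.*2.+3; set r := n.*2.+2; set L := (n.+1 + _)%N.
have [B HB] := choice (fun i => @coef_gpoly_exp_bound R K i).
have [G HG] := choice (fun j => @gauss_moment_even R j).
(* The prefactors [d^i] are at most [d^r]; the exponent [r + n.+1] absorbs them and still leaves the
   required power. *)
have [E [E0 HE]] := @expR_negligible R 2 (r + n.+1) (ltr0Sn R 1).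
exists ((\sum_(i < r) \sum_(l < L) B i * (G (i + l)%N + dfact (i + l) * 4)) * E).
have BG i l : 0 <= B i * (G (i + l)%N + dfact (i + l) * 4).
  have [? _] := HB i; have [? _] := HG (i + l)%N.
  by rewrite mulr_ge0 // addr_ge0 // mulr_ge0 // dfact_ge0.
split.
  by rewrite mulr_ge0 //; apply: sumr_ge0 => i _; apply: sumr_ge0 => l _.
move=> d A d0 HA /andP[A2 A4].
have dR : 1 <= d%:R :> R by rewrite ler1n.
have dn0 : d%:R != 0 :> R by rewrite pnatr_eq0 -lt0n.
have A0 : A 2%N != 0 by rewrite gt_eqF //; lra.
set c := d%:R * A 2%N; set s := (Num.sqrt (A 2%N))^-1.
have cd : d%:R <= c by rewrite /c ler_peMr //; lra.
rewrite -sumrB.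
apply: (@le_trans _ _ (\sum_(i < r) \sum_(l < L)
    (B i * (G (i + l)%N + dfact (i + l) * 4)) * (d%:R ^+ r * expR (- (2 * d%:R))))); last first.
  set W := \sum_(i < r) _; set V := (X in _ <= X * E * _ / _).
  have -> : W = V * (d%:R ^+ r * expR (- (2 * d%:R))).
    by rewrite /W /V mulr_suml; apply: eq_bigr => i _; rewrite mulr_suml.
  rewrite -[leRHS]mulrA -[leRHS]mulrA; apply: ler_wpM2l.
    by apply: sumr_ge0 => i _; apply: sumr_ge0 => l _.
  apply: (@le_trans _ _ (d%:R ^+ r * (E * gauss_mass d / d%:R ^+ (r + n.+1)))).
    by apply: ler_wpM2l; [exact: exprn_ge0|exact: HE].
  have cancel (x e g y : R) : x != 0 -> y != 0 -> x * (e * g / (x * y)) = e * (g / y).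
    by move=> x0 y0; field; rewrite x0 y0.
  by rewrite exprD cancel ?expf_neq0.
apply: le_trans (ler_norm_sum _ _ _) _; apply: ler_sum => i _.
rewrite mulr_sumr -sumrB; apply: le_trans (ler_norm_sum _ _ _) _; apply: ler_sum => l _.
have [Bi /(_ A HA (i + l).*2) HBi] := HB i.
have c1 : 1 <= c by lra.
have [G0 /(_ c c1) HGl] := HG (i + l)%N.
set M := gauss_moment c (i + l).*2 in HGl *; set g := (gpoly A K ^+ i)`_ _ in HBi *.
have -> : i`!%:R^-1 * d%:R ^+ i * ((-1) ^+ (i + l) * g * M) -
   s * gauss_mass d * (term A K i l / d%:R ^+ l) =
   (i`!%:R^-1 * (-1) ^+ (i + l)) * (d%:R ^+ i * (g * (M - dfact (i + l) / c ^+ (i + l) * (s * gauss_mass d)))).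
  rewrite /term -/g /c exprMn !exprD.
  by field; rewrite !expf_neq0 // pnatr_eq0 -lt0n fact_gt0.
rewrite normrM -[leRHS]mul1r; apply: ler_pM => //.
  rewrite normrM normrX normrN1 expr1n mulr1 normfV normr_nat.
  by rewrite invf_le1 ?ltr0n ?fact_gt0 // ler1n fact_gt0.
set Z := M - _.
have -> : B i * (G (i + l)%N + dfact (i + l) * 4) * (d%:R ^+ r * expR (- (2 * d%:R))) =
  d%:R ^+ r * (B i * ((G (i + l)%N + dfact (i + l) * 4) * expR (- (2 * d%:R)))) by ring.
rewrite [leLHS]normrM [`|g * Z|]normrM; apply: ler_pM => //.
  by rewrite ger0_norm ?exprn_ge0 //; apply: ler_weXn2l => //; exact: ltnW.
apply: ler_pM => //; rewrite /Z.
have -> : M - dfact (i + l) / c ^+ (i + l) * (s * gauss_mass d) =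
   (M - dfact (i + l) / c ^+ (i + l) * gauss_moment c 0) +
   dfact (i + l) / c ^+ (i + l) * (gauss_moment c 0 - s * gauss_mass d) by ring.
apply: le_trans (ler_normD _ _) _; rewrite [leRHS]mulrDl; apply: lerD.
  by apply: le_trans HGl _; rewrite ler_wpM2l // ler_expR; lra.
rewrite normrM -[leRHS]mulrA; apply: ler_pM => //.
  rewrite normrM ger0_norm ?dfact_ge0 // normfV normrX ger0_norm; last lra.
  by rewrite ler_piMr ?dfact_ge0 // invf_le1 ?exprn_ege1 // exprn_gt0 //; lra.
by apply: gauss_moment0_scale; rewrite A2.
Qed.

Lemma laplace_expansion n : exists C : R, 0 <= C /\
  forall (d : nat) (a : 'I_d -> R), (0 < d)%N ->
    (forall i, 1 / 2 <= a i) -> (forall i, a i <= 2) -> \sum_(i < d) a i = d%:R ->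
  `|intg (- 2) 2 (fun t => complex.Re (phi a t)) -
     gauss_mass d * \sum_(l < n.+1) laplace_coef (power_mean a) l / d%:R ^+ l| <=
  C * gauss_mass d / d%:R ^+ n.+1.
Proof.
have [C1 [C10 HC1]] := @laplace_pointwise R n.
have [C2 [C20 HC2]] := error_bound n.
have [B [B0 HB]] := term_bound n.*2.+3.
set K := n.*2.+3; set r := n.*2.+2.
(* The powers [g^i] with [i < r] have degree at most [K * i], so the sum over [l < n.+1 + L'] keeps
   all their coefficients. *)
set L' := (K * r).+1.
pose C3 := \sum_(l < L') \sum_(i < r) B i (n.+1 + l)%N.
have C30 : 0 <= C3 by apply: sumr_ge0 => l _; apply: sumr_ge0 => i _.
(* [4 * C1] is the integrated pointwise error, [C2] the replacement of the moments, and [C3] the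
   terms of order [d^-l] with [l > n]. *)
exists (4 * C1 + C2 + C3); split; first by rewrite !addr_ge0 // mulr_ge0.
move=> d a d0 a1 a2 aS.
have dR : 1 <= d%:R :> R by rewrite ler1n.
have dn0 : d%:R != 0 :> R by rewrite pnatr_eq0 -lt0n.
have G0 := gauss_mass_gt0 d0 : 0 < gauss_mass d :> R.
set A := power_mean a.
have HA k : `|A k| <= 2 ^+ k by exact: power_mean_le.
have A2 : 1 <= A 2%N by exact: power_mean2_ge1.
have A24 : 1 <= A 2%N <= 4.
  by rewrite A2 (le_trans (ler_norm _)) // (le_trans (HA _)) // -natrX.
set c := d%:R * A 2%N; set s := (Num.sqrt (A 2%N))^-1.
have s1 : 0 <= s <= 1.
  have h : 1 <= Num.sqrt (A 2%N) by rewrite -[leLHS]sqrtr1 ler_wsqrtr.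
  by rewrite /s invr_ge0 sqrtr_ge0 invf_le1 //; lra.
set P := exp_poly (gpoly A K) d%:R r.
pose S := intg (- 2) 2 (fun t => gauss c t * complex.Re (P%:CP.['ic * t%:C%C])).
have cRe (p : {poly R}) : continuous (fun t : R => complex.Re (p%:CP.['ic * t%:C%C])).
  exact: cderive_continuous_Re (cderive_poly p).
have e1 : `|intg (- 2) 2 (fun t => complex.Re (phi a t)) - S| <=
    4 * C1 * gauss_mass d / d%:R ^+ n.+1.
  rewrite -intgB; [|exact: phi_continuous|by apply: continuous_mul => //; exact: gauss_continuous].
  apply: (@le_trans _ _ (intg (- 2) 2 (fun t => C1 / d%:R ^+ n.+1 * gauss (d%:R / 16) t))).
    apply: intg_norm_le.
    - apply: continuous_sub; first exact: phi_continuous.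
      by apply: continuous_mul => //; exact: gauss_continuous.
    - by apply: continuous_scale; exact: gauss_continuous.
    move=> t t2; have {}t2 : `|t| <= 2 by rewrite ler_norml.
    have := HC1 d a t d0 a1 a2 aS t2; rewrite -/A -/K -/r -/P -/c => h.
    have -> : gauss (d%:R / 16) t = expR (- (d%:R * t ^+ 2 / 32)).
      by rewrite /gauss; congr expR; field.
    apply: le_trans h; apply: le_trans (Re_le_normc _).
    by rewrite ReD ReN Re_realM.
  rewrite intgZ; last exact: gauss_continuous.
  have -> : 4 * C1 * gauss_mass d / d%:R ^+ n.+1 =
    C1 / d%:R ^+ n.+1 * (4 * gauss_mass d) by ring.
  apply: ler_wpM2l; last exact: intg_wide_gauss.
  by rewrite divr_ge0 // exprn_ge0.
have ES : S = \sum_(i < r) i`!%:R^-1 * d%:R ^+ i *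
      \sum_(l < n.+1 + L') (-1) ^+ (i + l) * (gpoly A K ^+ i)`_((i + l).*2) *
         gauss_moment c (i + l).*2.
  transitivity (intg (- 2) 2 (fun t => \sum_(i < r) (i`!%:R^-1 * d%:R ^+ i) *
     (gauss c t * complex.Re ((gpoly A K ^+ i)%:CP.['ic * t%:C%C])))).
    apply: intg_eq => t _; rewrite Re_exp_poly mulr_sumr; apply: eq_bigr => i _; exact: mulrCA.
  rewrite intg_sum; last first.
    by move=> i; apply: continuous_scale; apply: continuous_mul => //; exact: gauss_continuous.
  apply: eq_bigr => i _; rewrite intgZ; last first.
    by apply: continuous_mul => //; exact: gauss_continuous.
  rewrite (@intg_gauss_gpoly_exp _ _ _ _ (n.+1 + L')) //.
  by rewrite /L' addnS ltnS (leq_trans _ (leq_addl _ _)) // leq_mul2l ltnW ?orbT.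
have e2 := HC2 d A d0 HA A24; rewrite -/c -/K -/r -/L' -ES -/s in e2.
set T := \sum_(i < r) \sum_(l < _) _ in e2.
have ET : T = gauss_mass d * \sum_(l < n.+1) laplace_coef A l / d%:R ^+ l +
   s * gauss_mass d * \sum_(l < L') (\sum_(i < r) term A K i (n.+1 + l)) / d%:R ^+ (n.+1 + l).
  rewrite /T exchange_big big_split_ord /=; congr (_ + _).
    rewrite mulr_sumr; apply: eq_bigr => l _; rewrite -mulr_sumr -mulr_suml term_sum; last first.
      by rewrite -ltnS.
    by rewrite /laplace_coef -/s; ring.
  by rewrite mulr_sumr; apply: eq_bigr => l _; rewrite -mulr_sumr -mulr_suml.
have e3 : `|T - gauss_mass d * \sum_(l < n.+1) laplace_coef A l / d%:R ^+ l| <=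
    C3 * gauss_mass d / d%:R ^+ n.+1.
  rewrite ET addrAC subrr add0r !normrM (ger0_norm (ltW G0)).
  have /andP[s0 s11] := s1; rewrite (ger0_norm s0).
  rewrite mulrAC [leRHS]mulrAC; apply: ler_wpM2r; first exact: ltW.
  apply: (@le_trans _ _ (1 * (C3 / d%:R ^+ n.+1))); last by rewrite mul1r.
  apply: ler_pM => //.
  apply: le_trans (ler_norm_sum _ _ _) _; rewrite mulr_suml; apply: ler_sum => l _.
  rewrite normrM; apply: ler_pM => //.
    by apply: le_trans (ler_norm_sum _ _ _) _; apply: ler_sum => i _; exact: HB.
  rewrite normfV normrX normr_nat lef_pV2 ?posrE ?exprn_gt0 ?(lt_le_trans ltr01) //.
  by apply: ler_weXn2l => //; exact: leq_addr.
have -> : intg (- 2) 2 (fun t => complex.Re (phi a t)) -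
   gauss_mass d * \sum_(l < n.+1) laplace_coef A l / d%:R ^+ l =
   (intg (- 2) 2 (fun t => complex.Re (phi a t)) - S) + (S - T) +
   (T - gauss_mass d * \sum_(l < n.+1) laplace_coef A l / d%:R ^+ l) by ring.
have -> : (4 * C1 + C2 + C3) * gauss_mass d / d%:R ^+ n.+1 =
  4 * C1 * gauss_mass d / d%:R ^+ n.+1 + C2 * gauss_mass d / d%:R ^+ n.+1 +
  C3 * gauss_mass d / d%:R ^+ n.+1 by ring.
apply: le_trans (ler_normD _ _) _; apply: lerD => //.
by apply: le_trans (ler_normD _ _) _; apply: lerD.
Qed.

End LaplaceExpansionProof.

(** * Homogeneous symmetric polynomials and the contour integral *)

Section HomogeneousSymmetric.
Context {R : realType}.
Implicit Types (s : seq R) (b : R).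

(* Coefficients of [\prod_(b <- s) (1 - b w)^-1]. *)
Fixpoint hsym s : nat -> R :=
  if s is b :: s' then
    fix h k := if k is k'.+1 then hsym s' k'.+1 + b * h k' else hsym s' 0%N
  else fun k => (k == 0%N)%:R.

Arguments hsym : simpl never.

Definition psum s j : R := \sum_(b <- s) b ^+ j.

Lemma hsym_consS b s k : hsym (b :: s) k.+1 = hsym s k.+1 + b * hsym (b :: s) k.
Proof. by []. Qed.

Lemma hsym_nil k : hsym [::] k = (k == 0%N)%:R.
Proof. by []. Qed.

Lemma hsym0 s : hsym s 0 = 1.
Proof. by elim: s. Qed.

(** Adjoining a variable [b]: the right side [q] obeys [q(k+1) = (k+1) h_(k+1)(s) + b h_k(b :: s) +
    b q(k)], which is the recursion of [(k+1) h_(k+1)(b :: s)]. *)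
Lemma hsym_newton s k :
  k.+1%:R * hsym s k.+1 = \sum_(j < k.+1) psum s j.+1 * hsym s (k - j).
Proof.
elim: s k => [|b s ih] k.
  rewrite hsym_nil mulr0 big1 // => j _; by rewrite /psum big_nil mul0r.
have psc j : psum (b :: s) j = b ^+ j + psum s j by rewrite /psum big_cons.
pose q k := \sum_(j < k) psum (b :: s) j.+1 * hsym (b :: s) (k.-1 - j).
have E k' : q k'.+1 = \sum_(j < k'.+1) psum s j.+1 * hsym s (k' - j) + b * hsym (b :: s) k' + b * q k'.
  rewrite /q /=; under eq_bigr do rewrite psc mulrDl.
  rewrite big_split /= big_ord_recl /= subn0 expr1 addrC -!addrA addrCA [RHS]addrCA; congr (_ + _).
  have -> : \sum_(i < k'.+1) psum s i.+1 * hsym (b :: s) (k' - i) =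
     \sum_(j < k'.+1) psum s j.+1 * hsym s (k' - j) +
     \sum_(j < k') b * (psum s j.+1 * hsym (b :: s) (k'.-1 - j)).
    rewrite big_ord_recr /= subnn.
    rewrite [in RHS]big_ord_recr /= subnn addrAC; congr (_ + _).
      rewrite -big_split /=; apply: eq_bigr => j _.
      have -> : (k' - j = (k'.-1 - j).+1)%N by have := ltn_ord j; lia.
      by rewrite hsym_consS mulrDr mulrCA.
  rewrite -addrA; congr (_ + _).
  rewrite mulr_sumr -big_split /=; apply: eq_bigr => j _.
  rewrite psc mulrDl mulrDr addrC; congr (_ + _).
  have -> : (k' - bump 0 j = k'.-1 - j)%N by rewrite /bump /=; lia.
  by rewrite /bump /= add1n [b ^+ j.+2]exprS mulrA.
have {}E k' : q k'.+1 = k'.+1%:R * hsym s k'.+1 + b * hsym (b :: s) k' + b * q k'.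
  by rewrite E ih.
rewrite -/(q k.+1); elim: k => [|k ihk].
  by rewrite E /q big_ord0 mulr0 addr0 hsym_consS !hsym0; ring.
by rewrite E -ihk hsym_consS -[k.+2%:R]natr1; ring.
Qed.

(** Newton's identity can be solved for its top term after division by [k + 1]. The moments over the
    sphere are identified in this way. *)
Lemma hsym_unique s (g : nat -> R) : g 0%N = 1 ->
  (forall k, k.+1%:R * g k.+1 = \sum_(j < k.+1) psum s j.+1 * g (k - j)%N) ->
  forall k, g k = hsym s k.
Proof.
move=> g0 gS k; elim/ltn_ind: k => -[|k] ih; first by rewrite g0 hsym0.
apply: (@mulfI _ k.+1%:R); first by rewrite pnatr_eq0.
rewrite gS hsym_newton; apply: eq_bigr => j _; congr (_ * _).
by apply: ih; rewrite ltnS leq_subr.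
Qed.

(** The value at [w = 2] of the generating function with every [b] replaced by its absolute value:
    the constant of Cauchy's estimate on the circle of radius [2]. *)
Definition hsym_const s : R := \prod_(b <- s) (1 - 2 * `|b|)^-1.

Lemma hsym_const_ge0 s : all (fun b => 2 * `|b| < 1) s -> 0 <= hsym_const s.
Proof.
move=> /allP h; rewrite /hsym_const big_seq; apply: prodr_ge0 => b /h.
by move=> hb; rewrite invr_ge0 subr_ge0 ltW.
Qed.

Lemma hsym_bound s k : all (fun b => 2 * `|b| < 1) s ->
  `|hsym s k| <= hsym_const s / 2 ^+ k.
Proof.
elim: s k => [|b s ih] k.
  rewrite /hsym_const big_nil mul1r => _; rewrite hsym_nil; case: k => [|k]; first by rewrite normr1 expr0 invr1.
  by rewrite normr0 invr_ge0 exprn_ge0.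
move=> /andP[hb hs].
have X0 := hsym_const_ge0 hs.
have d0 : 0 < 1 - 2 * `|b| by rewrite subr_gt0.
have E : hsym_const s = hsym_const (b :: s) * (1 - 2 * `|b|).
  by rewrite /hsym_const big_cons mulrAC mulVf ?mul1r // gt_eqF.
have X0' : 0 <= hsym_const (b :: s).
  by rewrite /hsym_const big_cons mulr_ge0 // invr_ge0 ltW.
elim: k => [|k ihk].
  rewrite hsym0 normr1 expr0 divr1.
  have := ih 0%N hs; rewrite hsym0 normr1 expr0 divr1 E => h.
  by apply: le_trans h _; rewrite ler_piMr // lerBlDr lerDl mulr_ge0.
rewrite hsym_consS; apply: le_trans (ler_normD _ _) _.
apply: le_trans (lerD (ih k.+1 hs) (lexx _)) _.
rewrite normrM E.
apply: le_trans (lerD (lexx _) (ler_wpM2l (normr_ge0 _) ihk)) _.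
rewrite exprS le_eqVlt; apply/orP; left; apply/eqP; field.
by rewrite expf_neq0.
Qed.

Lemma sum_half_le L : \sum_(k < L) (2 ^+ k)^-1 <= 2 :> R.
Proof.
suff -> : \sum_(k < L) (2 ^+ k)^-1 = 2 - 2 / 2 ^+ L :> R.
  by rewrite lerBlDr lerDl divr_ge0 // exprn_ge0.
elim: L => [|L ih]; first by rewrite big_ord0 expr0 divr1 subrr.
by rewrite big_ord_recr /= ih exprS; field; rewrite expf_neq0.
Qed.

Lemma hsym_sum_bound s L : all (fun b => 2 * `|b| < 1) s ->
  \sum_(k < L) `|hsym s k| <= 2 * hsym_const s.
Proof.
move=> hs; apply: (@le_trans _ _ (\sum_(k < L) hsym_const s / 2 ^+ k)).
  by apply: ler_sum => k _; exact: hsym_bound.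
by rewrite -mulr_sumr mulrC ler_wpM2r ?hsym_const_ge0 // sum_half_le.
Qed.

Definition hsym_series s L (w : R[i]) : R[i] := \sum_(k < L) (hsym s k)%:C%C * w ^+ k.

(** Multiplying the truncated series of [b :: s] by [1 - b w] returns that of [s] up to one
    top-degree term, small by the Cauchy bound. The disc [|w| <= 1] is where [1 / (1 + it)]
    lives. *)
Lemma hsym_series_approx s : all (fun b => 2 * `|b| < 1) s ->
  exists E : R, 0 <= E /\ forall L w, normc w <= 1 ->
    normc (hsym_series s L.+1 w * \prod_(b <- s) (1 - b%:C%C * w) - 1) <= E / 2 ^+ L.
Proof.
elim: s => [|b s ih].
  move=> _; exists 0; split=> // L w _; rewrite mul0r big_nil mulr1 /hsym_series.
  rewrite big_ord_recl big1 => [|k _]; last by rewrite hsym_nil mul0r.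
  by rewrite hsym_nil mulr1 addr0 subrr Normc.normc0.
move=> hbs; have /andP[hb hs] := hbs; have [E [E0 HE]] := ih hs.
have X0 := hsym_const_ge0 hbs.
exists (E + `|b| * hsym_const (b :: s) * 2 ^+ size s); split.
  by rewrite addr_ge0 // !mulr_ge0 // exprn_ge0.
move=> L w w1.
have key : hsym_series (b :: s) L.+1 w * (1 - b%:C%C * w) =
   hsym_series s L.+1 w - b%:C%C * (hsym (b :: s) L)%:C%C * w ^+ L.+1.
  have : hsym_series (b :: s) L.+1 w = hsym_series s L.+1 w + b%:C%C * w * hsym_series (b :: s) L w.
    rewrite /hsym_series big_ord_recl [in RHS]big_ord_recl !hsym0 -addrA; congr (_ + _).
    rewrite mulr_sumr -big_split /=; apply: eq_bigr => k _.
    rewrite /bump /= add1n hsym_consS rmorphD rmorphM /= exprS; ring.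
  have : hsym_series (b :: s) L w = hsym_series (b :: s) L.+1 w - (hsym (b :: s) L)%:C%C * w ^+ L.
    by rewrite /hsym_series big_ord_recr /= addrK.
  move: (hsym_series (b :: s) L w) (hsym_series (b :: s) L.+1 w) (hsym_series s L.+1 w) => S S' T -> e.
  by rewrite mulrBr mulr1 {1}e exprS; ring.
rewrite big_cons mulrA key mulrBl addrAC.
set P := \prod_(j <- s) _.
have P2 : normc P <= 2 ^+ size s.
  rewrite /P normc_prod.
  have -> : 2 ^+ size s = \prod_(j <- s) 2 :> R by rewrite big_const_seq count_predT -Monoid.iteropE.
  rewrite !big_seq; apply: ler_prod => j js; rewrite normc_ge0 andTb.
  apply: le_trans (le_normcD _ _) _; rewrite normcN Normc.normcM normc_real Normc.normc1.
  have : 2 * `|j| < 1 by exact: (allP hs).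
  by move=> h; have := normr_ge0 j; have := normc_ge0 w; nra.
apply: le_trans (le_normcD _ _) _; rewrite normcN mulrDl; apply: lerD; first exact: HE.
rewrite !Normc.normcM !normc_real normcX.
have -> : `|b| * hsym_const (b :: s) * 2 ^+ size s / 2 ^+ L =
  `|b| * (hsym_const (b :: s) / 2 ^+ L) * 1 * 2 ^+ size s by ring.
apply: ler_pM => //; rewrite ?mulr_ge0 ?normc_ge0 ?exprn_ge0 ?normc_ge0 //.
apply: ler_pM => //; rewrite ?mulr_ge0 ?exprn_ge0 ?normc_ge0 //; last first.
  by rewrite exprn_ile1 ?normc_ge0.
by apply: ler_wpM2l => //; exact: hsym_bound.
Qed.

End HomogeneousSymmetric.

(** * The homogeneous series as a ratio of oscillatory integrals *)

Section ContourLink.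
Context {R : realType}.

Definition invline (t : R) : R[i] := (1 + 'ic * t%:C%C)^-1.

Definition kernel_pow (d m : nat) (t : R) : R[i] := cis (d%:R * t) * invline t ^+ m.

(** Over the whole line this is [2 pi e^-d d^(m-1) / (m-1)!] for [m >= 2], by Fourier inversion of
    the Gamma density; on the segment its recursion in [m] survives up to boundary terms. *)
Definition kernel_int (d m : nat) : R := intg (- 2) 2 (fun t => complex.Re (kernel_pow d m t)).

Lemma normc_invline_le1 t : normc (invline t) <= 1.
Proof.
rewrite Normc.normcV invf_le1 ?normc_line_ge1 //.
exact: lt_le_trans ltr01 (normc_line_ge1 t).
Qed.

Lemma normc_invline_edge t : `|t| = 2 -> normc (invline t) <= 2^-1.
Proof.
move=> t2; rewrite Normc.normcV normc_line lef_pV2 ?posrE ?sqrtr_gt0 //.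
  rewrite -[leLHS]ger0_norm // -sqrtr_sqr ler_wsqrtr //.
  by rewrite -[t ^+ 2]real_normK ?num_real // t2; lra.
by rewrite -[t ^+ 2]real_normK ?num_real // t2; lra.
Qed.

Lemma cderive_kernel_pow d m t :
  is_cderive (kernel_pow d m) t
   ('ic * (d%:R%:C%C * kernel_pow d m t - m%:R * kernel_pow d m.+1 t)).
Proof.
have dl : is_cderive (fun t : R => 1 + 'ic * t%:C%C) t 'ic.
  have := cderiveD (cderive_cst 1 t) (cderiveZ 'ic (cderive_real (is_derive_id t 1))).
  by move=> h; apply: cderive_eq h _; rewrite add0r (_ : (1%:C)%C = 1) // mulr1.
have n0 := line_neq0 t.
apply: cderive_eq (cderiveM (cderive_cis _ t) (cderiveX m (cderiveV n0 dl))) _.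
rewrite /kernel_pow /invline; set c := cis _; set z := 1 + _.
case: m => [|m]; first by rewrite !mul0r mulr0 expr0; ring.
by rewrite [z ^+ 2]expr2 invfM /= !exprS; ring.
Qed.

Lemma kernel_pow_continuous d m : continuous (fun t => complex.Re (kernel_pow d m t)).
Proof. exact: cderive_continuous_Re (cderive_kernel_pow d m). Qed.

(* Integration by parts; the boundary terms are small since [|1 + 2i| > 2]. *)
Lemma kernel_int_rec d m : `|d%:R * kernel_int d m - m%:R * kernel_int d m.+1| <= 2 / 2 ^+ m.
Proof.
have cf := @kernel_pow_continuous d.
have -> : d%:R * kernel_int d m - m%:R * kernel_int d m.+1 =
    intg (- 2) 2 (fun t => d%:R * complex.Re (kernel_pow d m t) -
       m%:R * complex.Re (kernel_pow d m.+1 t)).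
  by rewrite intgB ?intgZ //; apply: continuous_scale.
rewrite (_ : intg _ _ _ = complex.Im (kernel_pow d m 2) - complex.Im (kernel_pow d m (- 2))); last first.
  apply: (@intg_FTC _ (fun t => complex.Im (kernel_pow d m t))); first lra.
    move=> t _; have [_ h] := cderive_kernel_pow d m t.
    apply: (is_derive_eq h); rewrite ImM /= mul0r add0r mul1r ReD ReN Re_realM.
    by rewrite (_ : m%:R = (m%:R%:C)%C) ?Re_realM // rmorph_nat.
  by apply: continuous_sub; apply: continuous_scale.
have edge t : `|t| = 2 -> `|complex.Im (kernel_pow d m t)| <= (2 ^+ m)^-1.
  move=> t2; apply: le_trans (Im_le_normc _) _.
  rewrite Normc.normcM normc_cis mul1r normcX -exprVn lerXn2r ?nnegrE ?normc_ge0 //.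
  exact: normc_invline_edge.
apply: le_trans (ler_normB _ _) _; rewrite mulr2n mulrDl mul1r; apply: lerD; apply: edge.
  by rewrite ger0_norm.
by rewrite normrN ger0_norm.
Qed.

(** Equal to [d^k (d-1)! / (d+k-1)!] for [d > 0], the weight of [h_k] in the series for the
    spherical integral. *)
Definition kernel_weight (d k : nat) : R := \prod_(j < k) (d%:R / (d + j)%:R).

(** The recursion is iterated from power [d] to [d + k]. Its factors [d / (d + j)] are at most [1],
    so the errors [2 / 2^(d+j)] merely add up, to a geometric sum. *)
Lemma kernel_int_shift d k : (0 < d)%N ->
  `|kernel_int d (d + k) - kernel_weight d k * kernel_int d d| <=
  4 / 2 ^+ d * (1 - (2 ^+ k)^-1).
Proof.
move=> d0; elim: k => [|k ih].
  by rewrite /kernel_weight big_ord0 mul1r addn0 subrr normr0 expr0 invr1 subrr mulr0.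
have m0 : 0 < (d + k)%:R :> R by rewrite ltr0n addn_gt0 d0.
have m1 : 1 <= (d + k)%:R :> R by rewrite ler1n addn_gt0 d0.
have E : kernel_int d (d + k.+1) - kernel_weight d k.+1 * kernel_int d d =
   d%:R / (d + k)%:R * (kernel_int d (d + k) - kernel_weight d k * kernel_int d d) -
   (d%:R * kernel_int d (d + k) - (d + k)%:R * kernel_int d (d + k).+1) / (d + k)%:R.
  rewrite /kernel_weight big_ord_recr /= addnS; field.
  by rewrite gt_eqF // -natrD.
rewrite E; apply: le_trans (ler_normB _ _) _.
have -> : 4 / 2 ^+ d * (1 - (2 ^+ k.+1)^-1) = 4 / 2 ^+ d * (1 - (2 ^+ k)^-1) + 2 / 2 ^+ (d + k) :> R.
  by rewrite exprS exprD; field; rewrite !expf_neq0.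
apply: lerD.
  rewrite normrM -[leRHS]mul1r; apply: ler_pM => //.
  by rewrite ger0_norm ?divr_ge0 // ler_pdivrMr // mul1r ler_nat leq_addr.
rewrite normrM normfV (gtr0_norm m0) ler_pdivrMr //.
apply: le_trans (kernel_int_rec d (d + k)) _.
by rewrite ler_peMr // divr_ge0 // exprn_ge0.
Qed.

Definition tilt d (a : 'I_d -> R) : seq R := [seq 1 - (a i)^-1 | i <- index_enum 'I_d].

Lemma big_tilt (T : Type) (idx : T) (op : T -> T -> T) d (a : 'I_d -> R) (F : R -> T) :
  \big[op/idx]_(b <- tilt a) F b = \big[op/idx]_(i < d) F (1 - (a i)^-1).
Proof. by rewrite /tilt big_map. Qed.

(** Factor by factor, [1 + i a t = a (1 + it) (1 - b / (1 + it))] with [b = 1 - 1 / a]. *)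
Lemma phase_prod_factor d (a : 'I_d -> R) t : (forall i, a i != 0) ->
  phase_prod a t = (\prod_(i < d) a i)%:C%C * (1 + 'ic * t%:C%C) ^+ d *
    \prod_(b <- tilt a) (1 - b%:C%C * invline t).
Proof.
move=> a0; rewrite big_tilt rmorph_prod -[in X in _ ^+ X](card_ord d) -prodr_const -!big_split /=.
apply: eq_bigr => i _; rewrite /invline rmorphB rmorph1 fmorphV rmorphM /=.
have n0 := line_neq0 t; have ai : (a i)%:C%C != 0 by rewrite fmorph_eq0.
by field; rewrite ai n0.
Qed.

Lemma tilt_small d (a : 'I_d -> R) : (forall i, `|1 - (a i)^-1| <= 7^-1) ->
  all (fun b => 2 * `|b| < 1) (tilt a).
Proof. by move=> h; apply/allP => b /mapP[i _ ->]; have := h i; lra. Qed.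

Lemma hsym_const_tilt d (a : 'I_d -> R) : (forall i, `|1 - (a i)^-1| <= 7^-1) ->
  hsym_const (tilt a) <= (7 / 5) ^+ d.
Proof.
move=> h; rewrite /hsym_const big_tilt -[in X in _ ^+ X](card_ord d) -prodr_const.
apply: ler_prod => i _; have := h i; move: `|_| => x hx.
rewrite invr_ge0 subr_ge0; apply/andP; split; first lra.
by rewrite -[leRHS]invrK lef_pV2 ?posrE; lra.
Qed.

(* [phi a \prod_i a_i = e^(idt) (1 + it)^-d \prod_i (1 - b_i / (1 + it))^-1] with
   [b_i = 1 - 1 / a_i]: expand the product in [b] and integrate termwise. *)
Lemma contour_link_partial d (a : 'I_d -> R) : (0 < d)%N ->
  (forall i, 0 < a i) -> (forall i, `|1 - (a i)^-1| <= 7^-1) ->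
  exists E : R, 0 <= E /\ forall L,
  `|intg (- 2) 2 (fun t => complex.Re (phi a t)) * \prod_(i < d) a i -
    (\sum_(k < L.+1) hsym (tilt a) k * kernel_weight d k) * kernel_int d d| <=
  8 * (7 / 10) ^+ d + E / 2 ^+ L.
Proof.
move=> d0 a0 ha; set s := tilt a.
have hs : all (fun b => 2 * `|b| < 1) s by exact: tilt_small.
have [E [E0 HE]] := hsym_series_approx hs.
(* [2^d] bounds the inverse of the product of the [1 - b w], whose factors have modulus at least
   [1/2], and [4] is the length of the segment. Dependence on [d] is allowed because [L] tends to
   infinity with [d] fixed. *)
exists (E * 2 ^+ d * 4); split; first by rewrite !mulr_ge0 // exprn_ge0.
move=> L; set PA := \prod_(i < d) a i.
have PA0 : PA != 0 by rewrite gt_eqF // prodr_gt0.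
have cphi := @phi_continuous _ _ a.
have ck := @kernel_pow_continuous d.
have e1 : `|intg (- 2) 2 (fun t => complex.Re (phi a t)) * PA -
    \sum_(k < L.+1) hsym s k * kernel_int d (d + k)| <= E * 2 ^+ d * 4 / 2 ^+ L.
  have -> : intg (- 2) 2 (fun t => complex.Re (phi a t)) * PA -
    \sum_(k < L.+1) hsym s k * kernel_int d (d + k) =
    intg (- 2) 2 (fun t => PA * complex.Re (phi a t) -
       \sum_(k < L.+1) hsym s k * complex.Re (kernel_pow d (d + k) t)).
    rewrite intgB.
    - rewrite intgZ // mulrC; congr (_ - _).
      rewrite intg_sum => [|k]; last exact: continuous_scale.
      by apply: eq_bigr => k _; rewrite intgZ.
    - exact: continuous_scale.
    - by apply: continuous_sum_fun => k; exact: continuous_scale.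
  have -> : E * 2 ^+ d * 4 / 2 ^+ L = (E * 2 ^+ d / 2 ^+ L) * (2 - - 2) by ring.
  rewrite -intg_cst; last lra.
  apply: intg_norm_le; last first.
  - move=> t _.
    have P0 : \prod_(b <- s) (1 - b%:C%C * invline t) != 0.
      have := phase_prod_neq0 a t; rewrite phase_prod_factor => [|i]; last by rewrite gt_eqF.
      by rewrite mulf_eq0 negb_or => /andP[].
    have Ephi : PA%:C%C * phi a t - kernel_pow d d t * hsym_series s L.+1 (invline t) =
      - (kernel_pow d d t * (\prod_(b <- s) (1 - b%:C%C * invline t))^-1 *
       (hsym_series s L.+1 (invline t) * \prod_(b <- s) (1 - b%:C%C * invline t) - 1)).
      rewrite /phi phase_prod_factor => [|i]; last by rewrite gt_eqF.
      rewrite -/s -/PA /kernel_pow {1 2}/invline exprVn.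
      have n0 := line_neq0 t; have PAC : PA%:C%C != 0 by rewrite fmorph_eq0.
      move: (\prod_(b <- s) _) P0 (hsym_series _ _ _) => P P0 S.
      by field; rewrite PAC P0 expf_neq0.
    have -> : PA * complex.Re (phi a t) - \sum_(k < L.+1) hsym s k * complex.Re (kernel_pow d (d + k) t) =
       complex.Re (PA%:C%C * phi a t - kernel_pow d d t * hsym_series s L.+1 (invline t)).
      rewrite ReD ReN Re_realM; congr (_ - _).
      rewrite /hsym_series mulr_sumr Re_sum; apply: eq_bigr => k _.
      by rewrite mulrCA Re_realM /kernel_pow exprD mulrA.
    apply: le_trans (Re_le_normc _) _; rewrite Ephi normcN Normc.normcM.
    rewrite -[leRHS]mulrA [leRHS]mulrCA; apply: ler_pM; rewrite ?normc_ge0 //; last first.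
      by apply: HE; exact: normc_invline_le1.
    rewrite Normc.normcM -[leRHS]mul1r; apply: ler_pM; rewrite ?normc_ge0 //.
      by rewrite Normc.normcM normc_cis mul1r normcX exprn_ile1 ?normc_ge0 // normc_invline_le1.
    rewrite Normc.normcV normc_prod big_tilt -prodfV -[in X in _ ^+ X](card_ord d) -prodr_const.
    apply: ler_prod => i _; rewrite invr_ge0 normc_ge0 andTb.
    have := ha i; set b := 1 - _ => hb.
    have hn : 1 / 2 <= normc (1 - b%:C%C * invline t).
      have h1 : normc (b%:C%C * invline t) <= 7^-1.
        rewrite Normc.normcM normc_real -[leRHS]mulr1; apply: ler_pM => //; first exact: normc_ge0.
        exact: normc_invline_le1.
      have := le_normcD (1 - b%:C%C * invline t) (b%:C%C * invline t).
      by rewrite subrK Normc.normc1; lra.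
    by rewrite -[leRHS]invrK lef_pV2 ?posrE; lra.
  - exact: cst_continuous.
  - apply: continuous_sub; first exact: continuous_scale.
    by apply: continuous_sum_fun => k; exact: continuous_scale.
have e2 : `|\sum_(k < L.+1) hsym s k * kernel_int d (d + k) -
    (\sum_(k < L.+1) hsym s k * kernel_weight d k) * kernel_int d d| <= 8 * (7 / 10) ^+ d.
  rewrite mulr_suml -sumrB; apply: le_trans (ler_norm_sum _ _ _) _.
  apply: (@le_trans _ _ (\sum_(k < L.+1) `|hsym s k| * (4 / 2 ^+ d))).
    apply: ler_sum => k _; rewrite -mulrA -mulrBr normrM; apply: ler_wpM2l => //.
    apply: le_trans (kernel_int_shift k d0) _; apply: ler_piMr.
      by rewrite divr_ge0 // exprn_ge0.
    by rewrite lerBlDr lerDl invr_ge0 exprn_ge0.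
  rewrite -mulr_suml.
  (* Here the growth [(7/5)^d] of the coefficients meets the gain [2^-d] of the boundary terms. *)
  apply: (@le_trans _ _ ((2 * (7 / 5) ^+ d) * (4 / 2 ^+ d))).
    rewrite ler_wpM2r ?divr_ge0 ?exprn_ge0 //.
    apply: le_trans (hsym_sum_bound _ hs) _; rewrite ler_wpM2l //.
    exact: hsym_const_tilt.
  have -> : 7 / 10 = (7 / 5) / 2 :> R by field.
  by rewrite [(7 / 5 / 2) ^+ d]exprMn exprVn le_eqVlt; apply/orP; left; apply/eqP; ring.
set F := intg _ _ _ * _ in e1 *; set S1 := \sum_(k < L.+1) _ in e1 e2; set S2 := _ * kernel_int d d in e2 *.
have -> : F - S2 = (S1 - S2) + (F - S1) by ring.
by apply: le_trans (ler_normD _ _) _; apply: lerD.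
Qed.

Lemma half_pow_small (E e : R) : 0 <= E -> 0 < e ->
  exists L0 : nat, forall L, (L0 <= L)%N -> E / 2 ^+ L <= e.
Proof.
move=> E0 e0; have := archi_boundP (divr_ge0 E0 (ltW e0)); set L0 := Num.bound _ => h.
exists L0 => L hL; rewrite ler_pdivrMr ?exprn_gt0 // mulrC -ler_pdivrMr //.
apply: le_trans (ltW h) _; apply: (@le_trans _ _ L%:R); first by rewrite ler_nat.
by rewrite -natrX ler_nat ltnW // ltn_expl.
Qed.

(** Lets [L] tend to infinity and divides by the product of the weights; as [1 / a_i <= 8/7], the
    rate [7/10] becomes [7/10 * 8/7 = 4/5]. *)
Lemma contour_link d (a : 'I_d -> R) (G : R) : (0 < d)%N ->
  (forall i, 0 < a i) -> (forall i, `|1 - (a i)^-1| <= 7^-1) ->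
  (forall e, 0 < e -> exists L0, forall L, (L0 <= L)%N ->
     `|\sum_(k < L.+1) hsym (tilt a) k * kernel_weight d k - G| <= e) ->
  `|intg (- 2) 2 (fun t => complex.Re (phi a t)) - G / (\prod_(i < d) a i) * kernel_int d d| <=
  8 * (4 / 5) ^+ d.
Proof.
move=> d0 a0 ha HG; set F := intg _ _ _; set PA := \prod_(i < d) a i.
have PA0 : 0 < PA by rewrite prodr_gt0.
have [E [E0 HE]] := contour_link_partial d0 a0 ha; rewrite -/F -/PA in HE.
have key : `|F * PA - G * kernel_int d d| <= 8 * (7 / 10) ^+ d.
  apply/ler_addgt0Pr => e e0; have e20 : 0 < e / 2 by lra.
  set J := kernel_int d d in HE *.
  have eJ : 0 < e / 2 / (`|J| + 1) by rewrite divr_gt0 // ltr_wpDl.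
  have [L1 h1] := half_pow_small E0 e20; have [L2 h2] := HG _ eJ.
  have := HE (maxn L1 L2); have := h1 _ (leq_maxl L1 L2); have := h2 _ (leq_maxr L1 L2).
  move: (\sum_(k < _) _) => S; move: (E / _) => x hS hx hF.
  have -> : F * PA - G * J = (F * PA - S * J) + (S - G) * J by ring.
  apply: le_trans (ler_normD _ _) _; rewrite normrM.
  have : `|S - G| * `|J| <= e / 2.
    apply: (@le_trans _ _ (`|S - G| * (`|J| + 1))).
      by rewrite ler_wpM2l // lerDl.
    by rewrite -ler_pdivlMr // ltr_wpDl.
  lra.
have -> : F - G / PA * kernel_int d d = (F * PA - G * kernel_int d d) * PA^-1.
  by field; rewrite gt_eqF.
rewrite normrM normfV (gtr0_norm PA0).
have PAV : PA^-1 <= (8 / 7) ^+ d.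
  rewrite -prodfV -[in X in _ ^+ X](card_ord d) -prodr_const; apply: ler_prod => i _.
  rewrite invr_ge0 ltW //=; have := ha i; rewrite ler_norml => /andP[]; lra.
have -> : 8 * (4 / 5) ^+ d = 8 * (7 / 10) ^+ d * (8 / 7) ^+ d :> R.
  by rewrite -mulrA -exprMn; congr (_ * _ ^+ _); field.
by apply: ler_pM => //; rewrite invr_ge0 ltW.
Qed.

(** The denominator is the same integral with unit weights, so the same Laplace expansion covers
    it. *)
Lemma kernel_int_phi d : kernel_int d d = intg (- 2) 2 (fun t => complex.Re (phi (fun _ : 'I_d => 1) t)).
Proof.
apply: intg_eq => t _; rewrite /phi /kernel_pow /phase_prod prodr_const card_ord /invline.
by rewrite mul1r exprVn.
Qed.

End ContourLink.

(** * Moments over the sphere *)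

Section ExpTail.
Context {R : realType}.

Definition exp_tail (X : R) (L : nat) : R := expR X - \sum_(k < L) X ^+ k / k`!%:R.

Lemma exp_partial_cvg (x : R) : (\sum_(k < L) x ^+ k / k`!%:R) @[L --> \oo] --> expR x.
Proof.
have h : series (exp_coeff x) @ \oo --> expR x := is_cvg_series_exp_coeff x.
apply: cvg_trans h; apply: near_eq_cvg; apply: nearW => L.
by rewrite /series /= big_mkord; apply: eq_bigr => k _.
Qed.

(** The tail at [x] is dominated termwise by the tail at [X]. The bound is uniform in [x], which
    allows integrating the exponential series term by term. *)
Lemma expR_partial_sum (x X : R) L : `|x| <= X ->
  `|expR x - \sum_(k < L) x ^+ k / k`!%:R| <= exp_tail X L.
Proof.
move=> xX; set s := \sum_(k < L) _.
have c1 : (`|\sum_(k < n) x ^+ k / k`!%:R - s|) @[n --> \oo] --> `|expR x - s|.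
  by apply: cvg_norm; apply: cvgB; [exact: exp_partial_cvg|exact: cvg_cst].
have c2 : (\sum_(k < n) X ^+ k / k`!%:R - \sum_(k < L) X ^+ k / k`!%:R) @[n --> \oo] --> exp_tail X L.
  by apply: cvgB; [exact: exp_partial_cvg|exact: cvg_cst].
apply: (ler_cvg_to c1 c2); near=> n.
have Ln : (L <= n)%N by near: n; exact: nbhs_infty_ge.
rewrite /s -(subnKC Ln) !big_split_ord /= !(addrC (\sum_(k < L) _)) !addrK.
apply: le_trans (ler_norm_sum _ _ _) _; apply: ler_sum => k _.
rewrite normrM normfV normr_nat normrX ler_wpM2r ?invr_ge0 // lerXn2r ?nnegrE //.
exact: le_trans xX.
Unshelve. all: by end_near.
Qed.

Lemma exp_tail_small (X e : R) : 0 < e -> exists L0 : nat, forall L, (L0 <= L)%N ->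
  exp_tail X L <= e.
Proof.
move=> e0; have /cvgrPdist_le /(_ _ e0) [L0 _ h] := @exp_partial_cvg X.
by exists L0 => L LL; apply: le_trans (ler_norm _) (h L LL).
Qed.

End ExpTail.

(** * Expectations and first-order variations *)

Section Expectation.
Context d (T : measurableType d) {R : realType} (P : probability T R) (G : set T).
Hypothesis mG : measurable G.
Hypothesis PG : P G = 1%E.

(** Bounded on [G] only, since entries of arbitrary matrices are unbounded; measurable on the whole
    space, so that composition with translations stays simple. *)
Definition bmeas (f : T -> R) : Prop :=
  measurable_fun setT f /\ exists M, forall U, G U -> `|f U| <= M.

Definition expect (f : T -> R) : R := \int[P]_(U in G) f U.

Lemma bmeas_integrable f : bmeas f -> P.-integrable G (EFin \o f).
Proof.
move=> [mf [M hM]]; apply: measurable_bounded_integrable => //.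
- by rewrite [X in (X < _)%E](_ : _ = 1%E) ?ltry.
- exact: measurable_funTS.
exists M; split; first exact: num_real.
by move=> x Mx U GU /=; apply: le_trans (hM U GU) (ltW Mx).
Qed.

Lemma bmeas_cst c : bmeas (fun=> c).
Proof. by split; [exact: measurable_cst|exists `|c|]. Qed.

Lemma bmeasD f g : bmeas f -> bmeas g -> bmeas (fun U => f U + g U).
Proof.
move=> [mf [M hM]] [mg [N hN]]; split; first exact: measurable_realfun.measurable_funD.
exists (M + N) => U GU; apply: le_trans (ler_normD _ _) _.
by apply: lerD; [exact: hM|exact: hN].
Qed.

Lemma bmeasM f g : bmeas f -> bmeas g -> bmeas (fun U => f U * g U).
Proof.
move=> [mf [M hM]] [mg [N hN]]; split; first exact: measurable_realfun.measurable_funM.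
exists (M * N) => U GU; rewrite normrM.
by apply: ler_pM => //; [exact: hM|exact: hN].
Qed.

Lemma bmeasZ c f : bmeas f -> bmeas (fun U => c * f U).
Proof. by move=> bf; apply: bmeasM => //; exact: bmeas_cst. Qed.

Lemma bmeasB f g : bmeas f -> bmeas g -> bmeas (fun U => f U - g U).
Proof.
move=> bf bg; have := bmeasD bf (bmeasZ (-1) bg).
by under eq_fun do rewrite mulN1r.
Qed.

Lemma bmeasX f n : bmeas f -> bmeas (fun U => f U ^+ n).
Proof.
move=> bf; elim: n => [|n ih].
  by under eq_fun do rewrite expr0; exact: bmeas_cst.
by under eq_fun do rewrite exprS; exact: bmeasM.
Qed.

Lemma bmeas_sum (I : Type) (r : seq I) (f : I -> T -> R) : (forall i, bmeas (f i)) ->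
  bmeas (fun U => \sum_(i <- r) f i U).
Proof.
move=> bf; elim: r => [|i r ih].
  by under eq_fun do rewrite big_nil; exact: bmeas_cst.
by under eq_fun do rewrite big_cons; exact: bmeasD.
Qed.

Lemma expect_eq f g : (forall U, G U -> f U = g U) -> expect f = expect g.
Proof. by move=> fg; apply: eq_Rintegral => U; rewrite inE; exact: fg. Qed.

Lemma expectD f g : bmeas f -> bmeas g ->
  expect (fun U => f U + g U) = expect f + expect g.
Proof. by move=> bf bg; rewrite /expect RintegralD //; exact: bmeas_integrable. Qed.

Lemma expectB f g : bmeas f -> bmeas g ->
  expect (fun U => f U - g U) = expect f - expect g.
Proof. by move=> bf bg; rewrite /expect RintegralB //; exact: bmeas_integrable. Qed.

Lemma expectZ c f : bmeas f -> expect (fun U => c * f U) = c * expect f.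
Proof. by move=> bf; rewrite /expect RintegralZl //; exact: bmeas_integrable. Qed.

Lemma expect_cst c : expect (fun=> c) = c.
Proof.
by rewrite /expect Rintegral_cst // (_ : fine _ = 1) ?mulr1 //= PG.
Qed.

Lemma expect_sum (I : Type) (r : seq I) (f : I -> T -> R) : (forall i, bmeas (f i)) ->
  expect (fun U => \sum_(i <- r) f i U) = \sum_(i <- r) expect (f i).
Proof.
move=> bf; elim: r => [|i r ih].
  by rewrite big_nil -[RHS](expect_cst 0); apply: expect_eq => U _; rewrite big_nil.
rewrite big_cons -ih -expectD //; last exact: bmeas_sum.
by apply: expect_eq => U _; rewrite big_cons.
Qed.

Lemma expect_bound f M : bmeas f -> (forall U, G U -> `|f U| <= M) -> `|expect f| <= M.
Proof.
move=> bf fM; apply: le_trans (le_normr_Rintegral _ (bmeas_integrable bf)) _ => //.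
rewrite -[leRHS]expect_cst; apply: le_Rintegral => //.
- apply: integrable_norm => //; exact: bmeas_integrable.
- exact: (bmeas_integrable (bmeas_cst M)).
Qed.

(** A Taylor expansion at [s = 0] with error uniform on [G]. It takes the place of differentiation
    under the integral sign. *)
Definition first_order (F : R -> T -> R) (F0 F1 : T -> R) : Prop :=
  exists C : R, 0 <= C /\ forall s U, `|s| <= 1 -> G U ->
    [/\ `|F s U - F0 U - s * F1 U| <= C * s ^+ 2, `|F0 U| <= C & `|F1 U| <= C].

Lemma first_orderM F F0 F1 H H0 H1 : first_order F F0 F1 -> first_order H H0 H1 ->
  first_order (fun s U => F s U * H s U) (fun U => F0 U * H0 U)
    (fun U => F0 U * H1 U + F1 U * H0 U).
Proof.
move=> [C [C0 hC]] [D [D0 hD]]; exists (6 * C * D); split; first by rewrite !mulr_ge0.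
move=> s U s1 GU; have [e f0 f1] := hC s U s1 GU; have [e' h0 h1] := hD s U s1 GU.
have CD := mulr_ge0 C0 D0.
have s2 : s ^+ 2 <= 1 by rewrite -real_normK ?num_real // expr_le1.
have s20 := sqr_ge0 s.
have m (a b A B : R) : `|a| <= A -> `|b| <= B -> `|a * b| <= A * B.
  by move=> aA bB; rewrite normrM; apply: ler_pM.
split.
- set X := F s U - F0 U - s * F1 U in e; set Y := H s U - H0 U - s * H1 U in e'.
  have -> : F s U * H s U - F0 U * H0 U - s * (F0 U * H1 U + F1 U * H0 U) =
     X * (H0 U + s * H1 U + Y) + (F0 U + s * F1 U) * Y + s ^+ 2 * (F1 U * H1 U).
    by rewrite /X /Y; ring.
  have b1 : `|s * H1 U| <= 1 * D by apply: m.
  have b2 : `|s * F1 U| <= 1 * C by apply: m.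
  have b3 : `|Y| <= D by apply: le_trans e' _; rewrite ler_piMr.
  have b4 : `|H0 U + s * H1 U + Y| <= 3 * D.
    by apply: le_trans (ler_normD _ _) _; have := ler_normD (H0 U) (s * H1 U); lra.
  have b5 : `|F0 U + s * F1 U| <= 2 * C by apply: le_trans (ler_normD _ _) _; lra.
  have b6 := m _ _ _ _ e b4; have b7 := m _ _ _ _ b5 e'.
  have b8 : `|s ^+ 2 * (F1 U * H1 U)| <= s ^+ 2 * (C * D).
    by rewrite normrM ger0_norm // ler_wpM2l // m.
  apply: le_trans (ler_normD _ _) _.
  have := ler_normD (X * (H0 U + s * H1 U + Y)) ((F0 U + s * F1 U) * Y).
  have -> : 6 * C * D * s ^+ 2 = C * s ^+ 2 * (3 * D) + 2 * C * (D * s ^+ 2) + s ^+ 2 * (C * D) by ring.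
  lra.
- by apply: le_trans (m _ _ _ _ f0 h0) _; lra.
- apply: le_trans (ler_normD _ _) _.
  by have := m _ _ _ _ f0 h1; have := m _ _ _ _ f1 h0; lra.
Qed.

Lemma first_orderX F F0 F1 n : first_order F F0 F1 ->
  first_order (fun s U => F s U ^+ n) (fun U => F0 U ^+ n)
    (fun U => n%:R * F0 U ^+ n.-1 * F1 U).
Proof.
move=> fF; elim: n => [|n ih].
  exists 1; split=> // s U s1 GU; rewrite !expr0 subrr !mul0r mulr0 subrr normr0 normr1.
  by split=> //; rewrite mul1r sqr_ge0.
have := first_orderM fF ih.
have -> : (fun (s : R) U => F s U ^+ n.+1) = (fun s U => F s U * F s U ^+ n).
  by apply/funext => s; apply/funext => U; rewrite exprS.
have -> : (fun U => F0 U ^+ n.+1) = (fun U => F0 U * F0 U ^+ n).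
  by apply/funext => U; rewrite exprS.
have -> // : (fun U => n.+1%:R * F0 U ^+ n.+1.-1 * F1 U) =
   (fun U => F0 U * (n%:R * F0 U ^+ n.-1 * F1 U) + F1 U * F0 U ^+ n).
apply/funext => U; rewrite -natr1 /=; case: n {ih} => [|n]; first by rewrite !expr0; ring.
by rewrite /= exprS; ring.
Qed.

(** The expectation does not depend on [s], so [s] times that of [F1] is of order [s^2]; divide by
    [s] and let it tend to [0]. *)
Lemma first_order_invariant F F0 F1 : first_order F F0 F1 ->
  (forall s, `|s| <= 1 -> bmeas (F s)) -> bmeas F0 -> bmeas F1 ->
  (forall s, `|s| <= 1 -> expect (F s) = expect F0) -> expect F1 = 0.
Proof.
move=> [C [C0 hC]] bF b0 b1 inv.
have key s : 0 < s <= 1 -> `|expect F1| <= C * s.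
  move=> /andP[s0 s1]; have ns : `|s| <= 1 by rewrite gtr0_norm.
  have : `|expect (fun U => F s U - F0 U - s * F1 U)| <= C * s ^+ 2.
    apply: expect_bound => [|U GU]; last by have [] := hC s U ns GU.
    by apply: bmeasB; [apply: bmeasB => //; exact: bF|exact: bmeasZ].
  rewrite expectB; [|by apply: bmeasB => //; exact: bF|exact: bmeasZ].
  rewrite expectB //; last exact: bF.
  rewrite inv // subrr sub0r normrN expectZ // normrM gtr0_norm //.
  by rewrite expr2 mulrCA ler_pM2l.
apply/eqP; rewrite -normr_le0; apply/ler_addgt0Pr => e e0; rewrite add0r.
pose s := Num.min 1 (e / (C + 1)).
have s0 : 0 < s by rewrite lt_min ltr01 divr_gt0 // ltr_wpDl.
have s1 : s <= 1 by rewrite ge_min lexx.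
apply: le_trans (key s _) _; first by rewrite s0.
have : s <= e / (C + 1) by rewrite ge_min lexx orbT.
rewrite ler_pdivlMr ?ltr_wpDl // => h; nra.
Qed.

End Expectation.

Lemma norm_mul_le {R : realType} (a b A B : R) : `|a| <= A -> `|b| <= B -> `|a * b| <= A * B.
Proof. by move=> aA bB; rewrite normrM; apply: ler_pM. Qed.

(** Second-order bounds for a rotation of sine [s]: here [e] is its cosine minus [1], while [v] and
    [w] stand for [b i j] and [q i - q j]. *)
Lemma drift_bounds {R : realType} (e v w s : R) :
  `|e| <= s ^+ 2 -> `|v| <= 1 -> `|w| <= 1 -> `|s| <= 1 ->
  `|2 * s ^+ 2 * v + e * (s * w)| <= 3 * s ^+ 2 /\
  `|e * (2 * s * v) - s ^+ 2 * w| <= 3 * s ^+ 2.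
Proof.
move=> he hv hw hs; have s2 := sqr_ge0 s.
have n2 : `|s ^+ 2| <= s ^+ 2 by rewrite ger0_norm.
have h2 : `|2 : R| <= 2 by rewrite ger0_norm.
split.
  apply: le_trans (ler_normD _ _) _.
  have := norm_mul_le (norm_mul_le h2 n2) hv; have := norm_mul_le he (norm_mul_le hs hw).
  lra.
apply: le_trans (ler_normB _ _) _.
have := norm_mul_le he (norm_mul_le (norm_mul_le h2 hs) hv); have := norm_mul_le n2 hw.
lra.
Qed.

(** * Moments of a quadratic form on the complex sphere *)

Section SphereMoments.
Context d (T : measurableType d) {R : realType} (P : probability T R) (G : set T).
Hypothesis mG : measurable G.
Hypothesis PG : P G = 1%E.
Variable N : nat.

Definition preserving (g : T -> T) : Prop := forall f, bmeas G f ->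
  bmeas G (fun U => f (g U)) /\ expect P G (fun U => f (g U)) = expect P G f.

(* [x i + i y i] are the coordinates of a random unit vector of [C^N]; its law
   is only assumed invariant under the real rotations of two coordinates and
   under the multiplication of one coordinate by [i]. *)
Definition spherical (x y : 'I_N -> T -> R) : Prop :=
  [/\ forall i, measurable_fun setT (x i) /\ measurable_fun setT (y i),
      forall U, G U -> \sum_(i < N) (x i U ^+ 2 + y i U ^+ 2) = 1,
      forall i j (c s : R), i != j -> c ^+ 2 + s ^+ 2 = 1 ->
        exists g, preserving g /\ forall U k, G U ->
          x k (g U) = (if k == i then c * x i U + s * x j U
                       else if k == j then - s * x i U + c * x j U else x k U) /\
          y k (g U) = (if k == i then c * y i U + s * y j U
                       else if k == j then - s * y i U + c * y j U else y k U) &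
      forall i, exists g, preserving g /\ forall U k, G U ->
          x k (g U) = (if k == i then - y i U else x k U) /\
          y k (g U) = (if k == i then x i U else y k U)].

Variables x y : 'I_N -> T -> R.
Hypothesis sph : spherical x y.

Let q i U := x i U ^+ 2 + y i U ^+ 2.

Let q_sum U : G U -> \sum_(i < N) q i U = 1.
Proof. by move=> GU; case: sph => _ /(_ U GU). Qed.

Let q_ge0 i U : 0 <= q i U.
Proof. by rewrite addr_ge0 ?sqr_ge0. Qed.

Let q_le1 i U : G U -> q i U <= 1.
Proof.
move=> GU; rewrite -(q_sum GU) (bigD1 i) //= lerDl.
by apply: sumr_ge0 => j _.
Qed.

Let bx i : bmeas G (x i).
Proof.
case: sph => mxy _ _ _; split; first by case: (mxy i).
exists 1 => U GU; rewrite -[leRHS]sqrtr1 -sqrtr_sqr ler_wsqrtr //.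
by apply: le_trans (q_le1 i GU); rewrite lerDl sqr_ge0.
Qed.

Let by_ i : bmeas G (y i).
Proof.
case: sph => mxy _ _ _; split; first by case: (mxy i).
exists 1 => U GU; rewrite -[leRHS]sqrtr1 -sqrtr_sqr ler_wsqrtr //.
by apply: le_trans (q_le1 i GU); rewrite lerDr sqr_ge0.
Qed.

Let bq i : bmeas G (q i).
Proof. by apply: bmeasD; apply: bmeasX; [exact: bx|exact: by_]. Qed.

Definition quad_power (l : 'I_N -> R) (a : nat) (U : T) : R :=
  \sum_(i < N) l i ^+ a * (x i U ^+ 2 + y i U ^+ 2).

Lemma bmeas_quad_power l a : bmeas G (quad_power l a).
Proof. by apply: bmeas_sum => i; apply: bmeasZ; exact: bq. Qed.

Let Y l := quad_power l 1.

Let b i j U := x i U * x j U + y i U * y j U.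

Let bb i j : bmeas G (b i j).
Proof. by apply: bmeasD; apply: bmeasM; (exact: bx || exact: by_). Qed.

Let b_le1 i j U : i != j -> G U -> `|b i j U| <= 1 /\ `|q i U - q j U| <= 1.
Proof.
move=> ij GU; have : q i U + q j U <= 1.
  rewrite -(q_sum GU) (bigD1 i) //= (bigD1 j) //=; last by rewrite eq_sym.
  by rewrite [leRHS]addrA lerDl; apply: sumr_ge0 => k _.
have := q_ge0 i U; have := q_ge0 j U; rewrite /b /q => h1 h2 h3.
have := sqr_ge0 (x i U - x j U); have := sqr_ge0 (y i U - y j U).
have := sqr_ge0 (x i U + x j U); have := sqr_ge0 (y i U + y j U).
by split; rewrite ler_norml; apply/andP; split; nra.
Qed.

Let Y_split l i j U : i != j ->
  Y l U = l i * q i U + l j * q j U + \sum_(k < N | (k != i) && (k != j)) l k * q k U.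
Proof.
move=> ij; rewrite /Y /quad_power (bigD1 i) //= (bigD1 j) //=; last by rewrite eq_sym.
rewrite !expr1 addrA; congr (_ + _); apply: eq_bigr => k _; by rewrite expr1.
Qed.

(* The derivative at angle [0] of [E (b Y^k)] along the rotations of the
   coordinates [i] and [j] vanishes. *)
Let rotation_identity l i j k : i != j ->
  expect P G (fun U => b i j U * (k%:R * Y l U ^+ k.-1 * (2 * (l i - l j) * b i j U))
     + (q j U - q i U) * Y l U ^+ k) = 0.
Proof.
(* The rotation is parametrized by its sine [s], with cosine [c s = sqrt (1 - s^2)]; [bs] and [Ys]
   are [b i j] and [Y] after the rotation, simplified by [c^2 + s^2 = 1]. *)
move=> ij; pose D := l i - l j; pose c (s : R) := Num.sqrt (1 - s ^+ 2).
pose bs s U := (1 - 2 * s ^+ 2) * b i j U - c s * s * (q i U - q j U).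
pose Ys s U := Y l U + D * (2 * (c s * s) * b i j U - s ^+ 2 * (q i U - q j U)).
have c2 s : `|s| <= 1 -> c s ^+ 2 = 1 - s ^+ 2.
  by move=> s1; rewrite sqr_sqrtr // subr_ge0 -real_normK ?num_real // expr_le1.
have c1 s : `|s| <= 1 -> `|c s - 1| <= s ^+ 2.
  move=> s1; have := c2 s s1; have c0 : 0 <= c s by exact: sqrtr_ge0.
  have := sqr_ge0 s; move: (c s) c0 => z z0 s20 e.
  have z1 : z <= 1 by nra.
  rewrite ler0_norm; nra.
have fb : first_order G bs (b i j) (fun U => q j U - q i U).
  exists 3; split=> // s U s1 GU; have [h1 h2] := b_le1 ij GU.
  split; [|lra|by rewrite distrC; lra].
  have -> : bs s U - b i j U - s * (q j U - q i U) =
     - (2 * s ^+ 2 * b i j U + (c s - 1) * (s * (q i U - q j U))) by rewrite /bs; ring.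
  by rewrite normrN; have [] := drift_bounds (c1 s s1) h1 h2 s1.
have fY : first_order G Ys (Y l) (fun U => 2 * D * b i j U).
  exists (3 * `|D| + \sum_(k < N) `|l k|).
  have L0 : 0 <= \sum_(k < N) `|l k| by apply: sumr_ge0.
  have D0 := normr_ge0 D.
  split; first by rewrite addr_ge0 // mulr_ge0.
  move=> s U s1 GU; have [h1 h2] := b_le1 ij GU.
  split.
  - have -> : Ys s U - Y l U - s * (2 * D * b i j U) =
      D * ((c s - 1) * (2 * s * b i j U) - s ^+ 2 * (q i U - q j U)) by rewrite /Ys; ring.
    rewrite normrM.
    have : `|(c s - 1) * (2 * s * b i j U) - s ^+ 2 * (q i U - q j U)| <= 3 * s ^+ 2.
      by have [] := drift_bounds (c1 s s1) h1 h2 s1.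
    have := sqr_ge0 s; nra.
  - apply: le_trans (ler_norm_sum _ _ _) _; apply: le_trans (_ : \sum_(k < N) `|l k| <= _); last first.
      by rewrite lerDr mulr_ge0.
    apply: ler_sum => k' _; rewrite expr1 normrM ler_piMr // ger0_norm; [exact: q_le1|exact: q_ge0].
  - rewrite !normrM (ger0_norm (ler0n _ 2)); nra.
have fF := first_orderM fb (first_orderX k fY).
have bbs s : bmeas G (bs s).
  by apply: bmeasB; apply: bmeasZ => //; apply: bmeasB.
have bYs s : bmeas G (Ys s).
  apply: bmeasD; first exact: bmeas_quad_power.
  by apply: bmeasZ; apply: bmeasB; apply: bmeasZ => //; apply: bmeasB.
have bY : bmeas G (Y l) by exact: bmeas_quad_power.
apply: (first_order_invariant mG PG fF).
- by move=> s _; apply: bmeasM => //; apply: bmeasX.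
- by apply: bmeasM => //; apply: bmeasX.
- apply: bmeasD; apply: bmeasM => //; last by apply: bmeasX.
    by apply: bmeasM; apply: bmeasZ => //; apply: bmeasX.
  by apply: bmeasB.
move=> s s1; case: sph => _ _ rot _.
have cs : c s ^+ 2 + s ^+ 2 = 1 by rewrite c2 // subrK.
have [g [pg hg]] := rot i j (c s) s ij cs.
have bF : bmeas G (fun U => b i j U * Y l U ^+ k) by apply: bmeasM => //; apply: bmeasX.
have [_ <-] := pg _ bF; apply: expect_eq => U GU.
have hk k' : (k' != i) && (k' != j) -> x k' (g U) = x k' U /\ y k' (g U) = y k' U.
  by move=> /andP[/negbTE ki /negbTE kj]; have := hg U k' GU; rewrite ki kj.
have := hg U i GU; rewrite eqxx => -[xi yi].
have := hg U j GU; rewrite eqxx eq_sym (negbTE ij) => -[xj yj].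
have eb : b i j (g U) = bs s U.
  rewrite /b xi yi xj yj /bs /q /b.
  have -> : 1 - 2 * s ^+ 2 = c s ^+ 2 - s ^+ 2 by rewrite c2 //; ring.
  by ring.
have eY : Y l (g U) = Ys s U.
  rewrite (Y_split _ _ ij) /Ys (Y_split _ U ij) /q xi yi xj yj.
  under eq_bigr => k' hk' do have [-> ->] := hk k' hk'.
  set S := \sum_(k' < N | _) _.
  transitivity (l i * (c s ^+ 2 * q i U + s ^+ 2 * q j U + 2 * (c s * s) * b i j U) +
    l j * (s ^+ 2 * q i U + c s ^+ 2 * q j U - 2 * (c s * s) * b i j U) + S).
    by rewrite /q /b; ring.
  by rewrite (c2 s s1) /D /q /b; ring.
by rewrite eb eY.
Qed.

(** Multiplying the coordinate [i] by the imaginary unit preserves [Y] and exchanges [b^2] with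
    [w^2], the squared real and imaginary parts of [u_i] times the conjugate of [u_j]. As
    [b^2 + w^2 = q_i q_j], the expectation of [b^2] in the rotation identity is half that of
    [q_i q_j]. *)
Lemma pair_identity l i j k :
  expect P G (fun U => (q j U - q i U) * Y l U ^+ k) +
  k%:R * (l i - l j) * expect P G (fun U => q i U * q j U * Y l U ^+ k.-1) = 0.
Proof.
have bY : bmeas G (Y l) by exact: bmeas_quad_power.
have [->|ij] := eqVneq i j.
  rewrite subrr mulr0 mul0r addr0 -[RHS](expect_cst mG PG 0).
  by apply: expect_eq => U _; rewrite subrr mul0r.
pose w U := x i U * y j U - y i U * x j U.
have bw : bmeas G w by apply: bmeasB; apply: bmeasM.
have bYk m : bmeas G (fun U => Y l U ^+ m) by exact: bmeasX.
have b2 : bmeas G (fun U => b i j U ^+ 2 * Y l U ^+ k.-1) by apply: bmeasM => //; exact: bmeasX.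
have w2 : bmeas G (fun U => w U ^+ 2 * Y l U ^+ k.-1) by apply: bmeasM => //; exact: bmeasX.
have phase : expect P G (fun U => b i j U ^+ 2 * Y l U ^+ k.-1) =
    expect P G (fun U => w U ^+ 2 * Y l U ^+ k.-1).
  case: sph => _ _ _ /(_ i) [g [pg hg]].
  have [_ <-] := pg _ b2; apply: expect_eq => U GU.
  have eY : Y l (g U) = Y l U.
    apply: eq_bigr => m _; have [-> ->] := hg U m GU; congr (_ * _).
    by case: eqVneq => [->|_]; ring.
  have := hg U i GU; rewrite eqxx => -[xi yi].
  have := hg U j GU; rewrite eq_sym (negbTE ij) => -[xj yj].
  by rewrite eY /b xi yi xj yj /w; congr (_ * _); ring.
have half : expect P G (fun U => q i U * q j U * Y l U ^+ k.-1) =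
    2 * expect P G (fun U => b i j U ^+ 2 * Y l U ^+ k.-1).
  rewrite mulr2n mulrDl mul1r {2}phase -expectD //.
  by apply: expect_eq => U _; rewrite /q /b /w; ring.
rewrite half; have := rotation_identity l k ij.
rewrite (@expect_eq _ _ _ _ _ _ (fun U => k%:R * (l i - l j) * 2 * (b i j U ^+ 2 * Y l U ^+ k.-1) +
    (q j U - q i U) * Y l U ^+ k)); last by move=> U _; ring.
rewrite expectD //; last by apply: bmeasM => //; exact: bmeasB.
  by rewrite expectZ // addrC mulrA => ->.
exact: bmeasZ.
Qed.

Let p l a : R := \sum_(i < N) l i ^+ a.

(** Sum the pair identities over all [i] and [j] with weight [l_i^a], and use that the [q_j] sum to
    [1]. The recursion lowers the power of [Y] while raising [a]. *)
Lemma moment_rec l a k :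
  (N + k)%:R * expect P G (fun U => quad_power l a U * Y l U ^+ k) =
  p l a * expect P G (fun U => Y l U ^+ k) +
  k%:R * expect P G (fun U => quad_power l a.+1 U * Y l U ^+ k.-1).
Proof.
have bY m : bmeas G (fun U => Y l U ^+ m) by apply: bmeasX; exact: bmeas_quad_power.
have bQ m n : bmeas G (fun U => quad_power l m U * Y l U ^+ n).
  by apply: bmeasM => //; exact: bmeas_quad_power.
have bqq i j m : bmeas G (fun U => q i U * q j U * Y l U ^+ m).
  by apply: bmeasM => //; exact: bmeasM.
have bqd i j : bmeas G (fun U => (q j U - q i U) * Y l U ^+ k).
  by apply: bmeasM => //; exact: bmeasB.
have Z : \sum_(i < N) \sum_(j < N) l i ^+ a *
   (expect P G (fun U => (q j U - q i U) * Y l U ^+ k) +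
    k%:R * (l i - l j) * expect P G (fun U => q i U * q j U * Y l U ^+ k.-1)) = 0.
  by rewrite big1 // => i _; rewrite big1 // => j _; rewrite pair_identity mulr0.
have first : \sum_(i < N) \sum_(j < N) l i ^+ a * expect P G (fun U => (q j U - q i U) * Y l U ^+ k) =
   p l a * expect P G (fun U => Y l U ^+ k) - N%:R * expect P G (fun U => quad_power l a U * Y l U ^+ k).
  transitivity (expect P G (fun U => \sum_(i < N) \sum_(j < N) l i ^+ a * ((q j U - q i U) * Y l U ^+ k))).
    rewrite expect_sum //; last by move=> i; apply: bmeas_sum => j; exact: bmeasZ.
    apply: eq_bigr => i _; rewrite expect_sum //; last by move=> j; exact: bmeasZ.
    by apply: eq_bigr => j _; rewrite expectZ.
  rewrite -[in RHS]expectZ // -[in RHS]expectZ // -expectB //; try exact: bmeasZ.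
  apply: expect_eq => U GU.
  rewrite /quad_power mulrA mulr_sumr /p !mulr_suml -sumrB; apply: eq_bigr => i _.
  rewrite -mulr_sumr -mulr_suml sumrB q_sum // sumr_const card_ord -mulr_natl /q; ring.
have second : \sum_(i < N) \sum_(j < N) l i ^+ a * (l i - l j) * expect P G (fun U => q i U * q j U * Y l U ^+ k.-1) =
   expect P G (fun U => quad_power l a.+1 U * Y l U ^+ k.-1) -
   expect P G (fun U => quad_power l a U * (Y l U * Y l U ^+ k.-1)).
  transitivity (expect P G (fun U => \sum_(i < N) \sum_(j < N) l i ^+ a * (l i - l j) * (q i U * q j U * Y l U ^+ k.-1))).
    rewrite expect_sum //; last by move=> i; apply: bmeas_sum => j; exact: bmeasZ.
    apply: eq_bigr => i _; rewrite expect_sum //; last by move=> j; exact: bmeasZ.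
    by apply: eq_bigr => j _; rewrite expectZ.
  rewrite -expectB //; last first.
    by apply: bmeasM; [exact: bmeas_quad_power|apply: bmeasM => //; exact: bmeas_quad_power].
  apply: expect_eq => U GU; rewrite {2}/quad_power mulr_suml /quad_power mulr_suml -sumrB.
  apply: eq_bigr => i _; rewrite -/(quad_power l 1 U) -/(Y l U).
  transitivity (\sum_(j < N) (l i ^+ a.+1 * q i U * Y l U ^+ k.-1 * q j U -
     l i ^+ a * q i U * Y l U ^+ k.-1 * (l j ^+ 1 * q j U))).
    by apply: eq_bigr => j _; rewrite exprS; ring.
  have EY : \sum_(j < N) l j ^+ 1 * q j U = Y l U by [].
  by rewrite sumrB -!mulr_sumr q_sum // EY /q; ring.
have E : \sum_(i < N) \sum_(j < N) l i ^+ a *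
   (expect P G (fun U => (q j U - q i U) * Y l U ^+ k) +
    k%:R * (l i - l j) * expect P G (fun U => q i U * q j U * Y l U ^+ k.-1)) =
  (\sum_(i < N) \sum_(j < N) l i ^+ a * expect P G (fun U => (q j U - q i U) * Y l U ^+ k)) +
  k%:R * \sum_(i < N) \sum_(j < N) l i ^+ a * (l i - l j) * expect P G (fun U => q i U * q j U * Y l U ^+ k.-1).
  rewrite mulr_sumr -big_split /=; apply: eq_bigr => i _.
  by rewrite mulr_sumr -big_split /=; apply: eq_bigr => j _; ring.
rewrite E first second in Z.
(* For [k = 0] the two powers differ, since the predecessor of [0] is [0], but the factor [k] kills
   both sides. *)
have E3 : k%:R * expect P G (fun U => quad_power l a U * (Y l U * Y l U ^+ k.-1)) =
   k%:R * expect P G (fun U => quad_power l a U * Y l U ^+ k).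
  case: k {Z E second first bqd} => [|k]; first by rewrite !mul0r.
  by congr (_ * _); apply: expect_eq => U _; rewrite /= exprS.
rewrite mulrBr E3 in Z; rewrite natrD mulrDl.
move: Z; set A := _ * _; set B := _ * _; set C := k%:R * _; set D := k%:R * _.
by move=> Z; lra.
Qed.

(** The binomial [N (N+1) ... (N+k-1) / k!], which is [h_k] at [(1, ..., 1)]: the moment of order
    [k] is [h_k(l)] normalized by this value. *)
Definition moment_weight k : R := \prod_(j < k) ((N + j)%:R / j.+1%:R).

Lemma moment_hsym l k : (0 < N)%N ->
  expect P G (fun U => Y l U ^+ k) * moment_weight k = hsym [seq l i | i <- index_enum 'I_N] k.
Proof.
move=> N0.
have bY m : bmeas G (fun U => Y l U ^+ m) by apply: bmeasX; exact: bmeas_quad_power.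
pose h k := expect P G (fun U => Y l U ^+ k) * moment_weight k.
pose s := [seq l i | i <- index_enum 'I_N].
have ps a : psum s a = p l a by rewrite /psum /s big_map.
have WS m : m.+1%:R * moment_weight m.+1 = (N + m)%:R * moment_weight m.
  by rewrite /moment_weight big_ord_recr /=; field; rewrite nat1r pnatr_eq0.
(* With this normalization the recursion reads [Ea a (m+1) = p_a h(m+1) + Ea (a+1) m]. Unrolled from
   [a = 1] it is Newton's identity, because [Ea 1 m] is [(m+1) h(m+1)]. *)
pose Ea a m := expect P G (fun U => quad_power l a U * Y l U ^+ m) * (moment_weight m * (N + m)%:R).
have EE a m : Ea a m = \sum_(j < m.+1) p l (a + j)%N * h (m - j)%N.
  elim: m a => [|m ih] a.
    rewrite big_ord_recl big_ord0 addr0 addn0 /Ea /h subn0.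
    have := moment_rec l a 0; rewrite mul0r addr0 => e.
    transitivity (moment_weight 0 * ((N + 0)%:R * expect P G (fun U => quad_power l a U * Y l U ^+ 0))).
      by ring.
    by rewrite e; ring.
  rewrite big_ord_recl addn0 subn0.
  have -> : \sum_(i < m.+1) p l (a + lift ord0 i) * h (m.+1 - lift ord0 i)%N =
     \sum_(j < m.+1) p l (a.+1 + j)%N * h (m - j)%N.
    by apply: eq_bigr => j _; rewrite /= /bump /= add1n subSS addnS.
  rewrite -ih /Ea /h; have := moment_rec l a m.+1 => /= e.
  transitivity (moment_weight m.+1 * ((N + m.+1)%:R * expect P G (fun U => quad_power l a U * Y l U ^+ m.+1))).
    by ring.
  rewrite e mulrDr; congr (_ + _); first by ring.
  by rewrite mulrA mulrA [moment_weight m.+1 * _]mulrC -mulrA WS; ring.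
rewrite -/(h k) -/s; apply: hsym_unique => [|m].
  rewrite /h /moment_weight big_ord0 mulr1 -[RHS](expect_cst mG PG 1).
  by apply: expect_eq => U _; rewrite expr0.
transitivity (Ea 1%N m).
  rewrite /h /Ea mulrCA WS [(N + m)%:R * _]mulrC; congr (_ * _).
  by apply: expect_eq => U _; rewrite exprS.
by rewrite EE; apply: eq_bigr => j _; rewrite ps add1n.
Qed.

Lemma bmeas_exp_quad l (t : R) : bmeas G (fun U => expR (t * Y l U)).
Proof.
have [mY [M hM]] := bmeas_quad_power l 1; split.
  apply: (measurableT_comp (@measurable_realfun.measurable_expR R)).
  exact: measurable_realfun.measurable_funM (measurable_cst t) mY.
exists (expR (`|t| * M)) => U GU; rewrite ger0_norm ?expR_ge0 // ler_expR.
by apply: le_trans (ler_norm _) _; rewrite normrM ler_wpM2l // hM.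
Qed.

(** Expands the exponential with a uniform tail; [N^k / k!] divided by the weight of the moment of
    order [k] is exactly [kernel_weight N k]. *)
Lemma expect_exp_quad l e : (0 < N)%N -> 0 < e -> exists L0, forall L, (L0 <= L)%N ->
  `|\sum_(k < L.+1) hsym [seq l i | i <- index_enum 'I_N] k * kernel_weight N k -
    expect P G (fun U => expR (N%:R * Y l U))| <= e.
Proof.
move=> N0 e0; have [_ [M hM]] := bmeas_quad_power l 1.
have [L0 hL0] := exp_tail_small (N%:R * M) e0.
exists L0 => L LL; rewrite distrC.
have bY m : bmeas G (fun U => Y l U ^+ m) by apply: bmeasX; exact: bmeas_quad_power.
have bS : bmeas G (fun U => \sum_(k < L.+1) (N%:R ^+ k / k`!%:R) * Y l U ^+ k).
  by apply: bmeas_sum => k; exact: bmeasZ.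
have -> : \sum_(k < L.+1) hsym [seq l i | i <- index_enum 'I_N] k * kernel_weight N k =
   expect P G (fun U => \sum_(k < L.+1) (N%:R ^+ k / k`!%:R) * Y l U ^+ k).
  rewrite expect_sum // => [|k]; last exact: bmeasZ.
  apply: eq_bigr => k _; rewrite expectZ // -moment_hsym // -mulrA mulrC; congr (_ * _).
  rewrite /moment_weight /kernel_weight -big_split /=.
  elim: (k : nat) => [|m ih]; first by rewrite big_ord0 expr0 divr1.
  rewrite big_ord_recr /= ih factS exprS natrM; field.
  by rewrite nat1r -natrD !pnatr_eq0 -!lt0n fact_gt0 addn_gt0 N0.
rewrite -expectB //; last exact: bmeas_exp_quad.
apply: expect_bound => //; first by apply: bmeasB => //; exact: bmeas_exp_quad.
move=> U GU; apply: le_trans (hL0 L.+1 (leqW LL)).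
have -> : \sum_(k < L.+1) (N%:R ^+ k / k`!%:R) * Y l U ^+ k = \sum_(k < L.+1) (N%:R * Y l U) ^+ k / k`!%:R.
  by apply: eq_bigr => k _; rewrite exprMn; ring.
by apply: expR_partial_sum; rewrite normrM normr_nat ler_wpM2l // hM.
Qed.

End SphereMoments.

Lemma is_derive_quadratic {R : realType} (F : R -> R) (t f C e : R) : 0 < e ->
  (forall h, `|h| < e -> `|F (t + h) - F t - h * f| <= C * h ^+ 2) ->
  is_derive t 1 F f.
Proof.
move=> e0 hF.
have cv : (fun h : R => h^-1 *: (F (h *: (1 : R) + t) - F t)) @ 0^' --> f.
  apply/cvgrPdist_le => eps eps0; near=> h.
  have h0 : h != 0 by near: h; exact: nbhs_dnbhs_neq.
  have he : `|h| < e.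
    by near: h; apply: dnbhs0_lt.
  have hC : `|h| < eps / (`|C| + 1).
    by near: h; apply: dnbhs0_lt; rewrite divr_gt0 // ltr_pwDr.
  have C1 : 0 < `|C| + 1 by rewrite ltr_pwDr.
  have := hF h he; rewrite /GRing.scale /= mulr1 [h + t]addrC => q.
  have -> : f - h^-1 * (F (t + h) - F t) = - (h^-1 * (F (t + h) - F t - h * f)) by field.
  rewrite normrN normrM normfV ler_pdivrMl ?normr_gt0 //.
  apply: le_trans q _; rewrite -normr_gt0 in h0.
  rewrite -real_normK ?num_real // expr2 mulrCA ler_wpM2l ?normr_ge0 //.
  move: hC; rewrite ltr_pdivlMr // => hC.
  apply: le_trans (ltW hC); have := ler_norm C; nra.
apply: DeriveDef; first by apply/cvg_ex; exists f.
exact: cvg_lim.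
Unshelve. all: by end_near. Qed.

(** The upper bound is concavity. The lower bound is the same inequality for
    [1 / (1 + y) = 1 - y / (1 + y)], with [y / (1 + y) >= y - 2 y^2] for [y >= -1/2]. *)
Lemma ln_quadratic {R : realType} (y : R) : - 2^-1 <= y -> `|ln (1 + y) - y| <= 2 * y ^+ 2.
Proof.
move=> y2; have y1 : 0 < 1 + y by lra.
have up : ln (1 + y) <= y by apply: le_ln1Dx; lra.
have lo : y - 2 * y ^+ 2 <= ln (1 + y).
  have : ln (1 + - (y / (1 + y))) <= - (y / (1 + y)).
    by apply: le_ln1Dx; rewrite ltrN2 ltr_pdivrMr // mul1r; lra.
  have -> : 1 + - (y / (1 + y)) = (1 + y)^-1 by field; exact: lt0r_neq0.
  rewrite lnV ?posrE // lerN2 => h; apply: le_trans h.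
  rewrite ler_pdivlMr //; have := sqr_ge0 y; nra.
have := sqr_ge0 y; rewrite ler_norml => y20; apply/andP; split; lra.
Qed.

Lemma sum_le_card_mul {R : realType} m (f : 'I_m -> R) c : (forall i, f i <= c) ->
  \sum_(i < m) f i <= c * m%:R.
Proof.
move=> h; apply: le_trans (_ : \sum_(i < m) c <= _); first exact: ler_sum.
by rewrite sumr_const card_ord mulr_natr.
Qed.

Lemma card_mul_le_sum {R : realType} m (f : 'I_m -> R) c : (forall i, c <= f i) ->
  c * m%:R <= \sum_(i < m) f i.
Proof.
move=> h; apply: le_trans (_ : \sum_(i < m) c <= _); last exact: ler_sum.
by rewrite sumr_const card_ord mulr_natr.
Qed.

(** * The R-transform *)

Section RTransform.
Context {R : realType}.
Variables (n : nat) (lam : 'I_n.+1 -> R) (M : R).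
Hypothesis M0 : 0 < M.
Hypothesis lamM : forall i, `|lam i| <= M.

Let lamB i : - M <= lam i <= M.
Proof. by rewrite -ler_norml. Qed.

(** Spectrum and root both lie in [[-M, M]], so [|s (lam i - w)| <= 2 M |s| <= 1/7], the margin that
    the whole development relies on. *)
Definition small_slope (s : R) : Prop := 14 * M * `|s| <= 1.

Lemma slope_bound s w i : small_slope s -> `|w| <= M -> `|s * (lam i - w)| <= 7^-1.
Proof.
rewrite /small_slope => ss; rewrite ler_norml => /andP[w1 w2]; have /andP[l1 l2] := lamB i.
have : `|lam i - w| <= 2 * M by rewrite ler_norml; apply/andP; split; lra.
rewrite normrM; have := normr_ge0 s; nra.
Qed.

Let den_bound s w i : small_slope s -> `|w| <= M -> 6 / 7 <= 1 - s * (lam i - w) <= 8 / 7.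
Proof.
move=> ss wM; have := slope_bound i ss wM; rewrite ler_norml => /andP[h1 h2].
by apply/andP; split; lra.
Qed.

Let den_gt0 s w i : small_slope s -> `|w| <= M -> 0 < 1 - s * (lam i - w).
Proof. by move=> ss wM; have /andP[] := den_bound i ss wM; lra. Qed.

Let den_neq0 s w i : small_slope s -> `|w| <= M -> 1 - s * (lam i - w) != 0.
Proof. by move=> ss wM; rewrite gt_eqF // den_gt0. Qed.

(** The root equation [\sum_i 1 / (1 - s (lam_i - w)) = d] divided by [s]: it keeps its meaning at
    [s = 0], where the root is the mean of the spectrum. *)
Let G s w := \sum_(i < n.+1) (lam i - w) / (1 - s * (lam i - w)).

Lemma Rtransform_root_exists s : small_slope s -> exists w, `|w| <= M /\ G s w = 0.
Proof.
move=> ss.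
have MM : `|M| <= M by rewrite gtr0_norm.
have MM' : `|- M| <= M by rewrite normrN.
have [] := @IVT R (G s) (- M) M 0.
- by apply: le_trans (ltW M0); rewrite oppr_le0 ltW.
- apply: continuous_in_subspaceT => w; rewrite inE /= in_itv /= => wM.
  have wM' : `|w| <= M by rewrite ler_norml.
  rewrite /G.
  have h i : {for w, continuous (fun w => (lam i - w) / (1 - s * (lam i - w)))}.
    have c1 : {for w, continuous (fun w => lam i - w)}.
      by apply: cvgB; [exact: cvg_cst|exact: cvg_id].
    apply: continuousM => //; apply: continuousV; first exact: den_neq0.
    apply: continuousB; first exact: cst_continuous.
    by apply: continuousM => //; exact: cst_continuous.
  elim: (index_enum 'I_n.+1) => [|i r ih].
    rewrite (_ : (fun _ => _) = cst 0); first exact: cst_continuous.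
    by apply/funext => u; rewrite big_nil.
  rewrite (_ : (fun _ => _) = (fun w => (lam i - w) / (1 - s * (lam i - w)) +
      \sum_(j <- r) (lam j - w) / (1 - s * (lam j - w)))).
    by apply: cvgD; [exact: h|exact: ih].
  by apply/funext => u; rewrite big_cons.
- have g1 : 0 <= G s (- M).
    apply: sumr_ge0 => i _; apply: divr_ge0; last exact/ltW/den_gt0.
    by have /andP[] := lamB i; lra.
  have g2 : G s M <= 0.
    apply: sumr_le0 => i _; apply: mulr_le0_ge0; last by rewrite invr_ge0; exact/ltW/den_gt0.
    by have /andP[] := lamB i; lra.
  by rewrite ge_min g2 orbT le_max g1.
- move=> c; rewrite in_itv /= => cM hc; exists c; split=> //.
  by rewrite ler_norml.
Qed.

Lemma Rtransform_root_equation s w : small_slope s -> `|w| <= M -> G s w = 0 ->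
  \sum_(i < n.+1) (1 - s * (lam i - w))^-1 = n.+1%:R.
Proof.
move=> ss wM hG; transitivity (\sum_(i < n.+1) (1 + s * ((lam i - w) / (1 - s * (lam i - w))))).
  by apply: eq_bigr => i _; field; exact: den_neq0.
by rewrite big_split /= -mulr_sumr -/(G s w) hG mulr0 addr0 sumr_const card_ord.
Qed.

(** The sign of the transform tells on which side of the spectrum the point lies, and on each side
    the transform is strictly decreasing. *)
Lemma hilbert_injective : {in outside_spectrum lam &, injective (hilbert lam)}.
Proof.
have sgn z : outside_spectrum lam z -> (forall i, lam i < z) /\ 0 < hilbert lam z \/
    (forall i, z < lam i) /\ hilbert lam z < 0.
  move=> [h|h]; [right|left]; split=> //; rewrite /hilbert.
    rewrite pmulr_rlt0 ?invr_gt0 ?ltr0n // big_ord_recl ltr_wnDr ?invr_lt0 ?subr_lt0 //.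
    by apply: sumr_le0 => i _; rewrite invr_le0 subr_le0 ltW.
  rewrite pmulr_rgt0 ?invr_gt0 ?ltr0n // big_ord_recl ltr_wpDr ?invr_gt0 ?subr_gt0 //.
  by apply: sumr_ge0 => i _; rewrite invr_ge0 subr_ge0 ltW.
have mono z z' : z < z' -> (forall i, 0 < (z - lam i) * (z' - lam i)) -> hilbert lam z' < hilbert lam z.
  move=> zz h; rewrite /hilbert ltr_pM2l ?invr_gt0 ?ltr0n //.
  have hi i : (z' - lam i)^-1 < (z - lam i)^-1.
    have := h i; set a := z - lam i; set b := z' - lam i => ab.
    have a0 : a != 0 by apply: contraTneq ab => ->; rewrite mul0r ltxx.
    have b0 : b != 0 by apply: contraTneq ab => ->; rewrite mulr0 ltxx.
    rewrite -subr_gt0 (_ : a^-1 - b^-1 = (b - a) / (a * b)); last by field; rewrite a0 b0.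
    by rewrite divr_gt0 // /a /b; lra.
  rewrite !big_ord_recl; apply: ltr_leD; first exact: hi.
  by apply: ler_sum => i _; exact: ltW.
move=> z z'; rewrite !inE => oz oz' e; apply/eqP; apply: contraT => /lt_total /orP[lt|lt].
- have : hilbert lam z' < hilbert lam z; last by rewrite e ltxx.
  case: (sgn z oz) (sgn z' oz') => [[h1 h2]|[h1 h2]] [[h3 h4]|[h3 h4]]; try lra.
    by apply: mono => // i; rewrite mulr_gt0 // subr_gt0.
  by apply: mono => // i; rewrite nmulr_rgt0 subr_lt0.
- have : hilbert lam z < hilbert lam z'; last by rewrite e ltxx.
  case: (sgn z oz) (sgn z' oz') => [[h1 h2]|[h1 h2]] [[h3 h4]|[h3 h4]]; try lra.
    by apply: mono => // i; rewrite mulr_gt0 // subr_gt0.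
  by apply: mono => // i; rewrite nmulr_rgt0 subr_lt0.
Qed.

(** The point [w + 1 / s] lies outside the spectrum and is sent to [s]; by injectivity it is
    therefore the value of the partial inverse. *)
Lemma Rtransform_rootE s w : s != 0 -> small_slope s -> `|w| <= M -> G s w = 0 ->
  Rtransform lam s = w.
Proof.
move=> s0 ss wM hG; rewrite /Rtransform.
have zE i : w + s^-1 - lam i = (1 - s * (lam i - w)) / s by field.
have hz : hilbert lam (w + s^-1) = s.
  rewrite /hilbert; transitivity (n.+1%:R^-1 * \sum_(i < n.+1) s * (1 - s * (lam i - w))^-1).
    by congr (_ * _); apply: eq_bigr => i _; rewrite zE invf_div.
  by rewrite -mulr_sumr Rtransform_root_equation // mulrCA mulVf ?mulr1 // pnatr_eq0.
have oz : outside_spectrum lam (w + s^-1).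
  have h i := den_gt0 i ss wM.
  have [sp|sn|/eqP] := ltgtP s 0; last by rewrite (negbTE s0).
    by left => i; rewrite -subr_lt0 zE pmulr_rlt0 // invr_lt0.
  by right => i; rewrite -subr_gt0 zE divr_gt0.
rewrite /hilbert_inv -[X in 'pinv_ _ _ _ X]hz pinvKV ?inE //; first by rewrite addrK.
exact: hilbert_injective.
Qed.

Lemma Rtransform_props s : s != 0 -> small_slope s ->
  `|Rtransform lam s| <= M /\
  \sum_(i < n.+1) (1 - s * (lam i - Rtransform lam s))^-1 = n.+1%:R.
Proof.
move=> s0 ss; have [w [wM hG]] := Rtransform_root_exists ss.
rewrite (Rtransform_rootE s0 ss wM hG); split=> //.
exact: Rtransform_root_equation.
Qed.

(* The root is not known to depend smoothly on [s]; a Lipschitz bound suffices by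
   the cancellation in [Psi_quadratic]. *)
Lemma root_lipschitz s s' w w' : small_slope s -> small_slope s' -> `|w| <= M -> `|w'| <= M ->
  G s w = 0 -> G s' w' = 0 -> `|w' - w| <= 8 * M ^+ 2 * `|s' - s|.
Proof.
move=> ss ss' wM wM' hG hG'.
(* [c] and [e] are the difference quotients, up to sign, of [(lam - w) / (1 - s (lam - w))] in [w]
   and in [s]. The denominators lie in [[6/7, 8/7]], whence [49/64] below and [4 * 49/36 = 49/9]
   above; the ratio [64/9] is at most [8]. *)
pose c i := ((1 - s' * (lam i - w')) * (1 - s' * (lam i - w)))^-1.
pose e i := (lam i - w) ^+ 2 / ((1 - s' * (lam i - w)) * (1 - s * (lam i - w))).
have E : (w' - w) * \sum_(i < n.+1) c i = (s' - s) * \sum_(i < n.+1) e i.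
  have : G s' w' - G s w = 0 by rewrite hG hG' subrr.
  rewrite /G -sumrB => h; apply/eqP; rewrite -subr_eq0 -oppr_eq0 opprB !mulr_sumr -sumrB; apply/eqP.
  rewrite -[RHS]h; apply: eq_bigr => i _; rewrite /c /e; field.
  by rewrite !den_neq0.
have clo : 49 / 64 * n.+1%:R <= \sum_(i < n.+1) c i.
  apply: card_mul_le_sum => i.
  have /andP[a1 a2] := den_bound i ss' wM; have /andP[b1 b2] := den_bound i ss' wM'.
  have p : 0 < (1 - s' * (lam i - w')) * (1 - s' * (lam i - w)) by rewrite mulr_gt0 // den_gt0.
  have : (1 - s' * (lam i - w')) * (1 - s' * (lam i - w)) <= 8 / 7 * (8 / 7).
    by apply: ler_pM => //; exact/ltW/den_gt0.
  by rewrite /c => cc; rewrite -[leRHS]div1r ler_pdivlMr //; lra.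
have ehi : `|\sum_(i < n.+1) e i| <= 49 / 9 * M ^+ 2 * n.+1%:R.
  apply: le_trans (ler_norm_sum _ _ _) _.
  apply: sum_le_card_mul => i.
  have /andP[a1 a2] := den_bound i ss' wM; have /andP[b1 b2] := den_bound i ss wM.
  have p : 0 < (1 - s' * (lam i - w)) * (1 - s * (lam i - w)) by rewrite mulr_gt0 // den_gt0.
  have ab : 36 / 49 <= (1 - s' * (lam i - w)) * (1 - s * (lam i - w)).
    by apply: le_trans (_ : 6 / 7 * (6 / 7) <= _); [lra|apply: ler_pM => //; lra].
  rewrite /e ger0_norm; last by rewrite divr_ge0 ?sqr_ge0 // ltW.
  rewrite ler_pdivrMr //.
  have /andP[l1 l2] := lamB i; move: wM; rewrite ler_norml => /andP[w1 w2].
  have : (lam i - w) ^+ 2 <= 4 * M ^+ 2 by nra.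
  have := sqr_ge0 M; nra.
have d0 : 0 < n.+1%:R :> R by rewrite ltr0n.
have : `|w' - w| * (49 / 64 * n.+1%:R) <= `|s' - s| * (49 / 9 * M ^+ 2 * n.+1%:R).
  apply: le_trans (ler_wpM2l (normr_ge0 _) clo) _.
  apply: le_trans (_ : `|(w' - w) * \sum_(i < n.+1) c i| <= _).
    by rewrite normrM ler_wpM2l // ler_norm.
  by rewrite E normrM ler_wpM2l.
rewrite (_ : _ * (49 / 64 * n.+1%:R) = `|w' - w| * (49 / 64) * n.+1%:R); last by ring.
rewrite (_ : _ * (49 / 9 * _ * n.+1%:R) = `|s' - s| * (49 / 9 * M ^+ 2) * n.+1%:R); last by ring.
rewrite ler_pM2r // => h.
have : 0 <= `|s' - s| * M ^+ 2 by rewrite mulr_ge0 ?sqr_ge0.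
have := normr_ge0 (w' - w); lra.
Qed.

Let Psi s w := s * w - n.+1%:R^-1 * \sum_(i < n.+1) ln (1 - s * (lam i - w)).

(* The first variation in [w] vanishes by the root equation, so that only the
   explicit dependence on [s] contributes at first order. *)
Lemma Psi_quadratic s s' w w' : small_slope s -> small_slope s' -> `|w| <= M -> `|w'| <= M ->
  G s w = 0 -> G s' w' = 0 ->
  `|Psi s' w' - Psi s w - (s' - s) * w| <= 25 * M ^+ 2 * (s' - s) ^+ 2.
Proof.
move=> ss ss' wM wM' hG hG'; have L := root_lipschitz ss ss' wM wM' hG hG'.
have d0 : 0 < n.+1%:R :> R by rewrite ltr0n.
have d0' : n.+1%:R != 0 :> R by rewrite pnatr_eq0.
(* [1 + y i] is the ratio of the new denominator to the old one, so the variation of the logarithms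
   in [Psi] is a sum of [ln (1 + y i)]. *)
pose y i := (s * (lam i - w) - s' * (lam i - w')) / (1 - s * (lam i - w)).
have sy : \sum_(i < n.+1) y i = s' * (w' - w) * n.+1%:R.
  rewrite -(Rtransform_root_equation ss wM hG) mulr_sumr.
  transitivity (\sum_(i < n.+1) ((s - s') * ((lam i - w) / (1 - s * (lam i - w))) +
     s' * (w' - w) * (1 - s * (lam i - w))^-1)); last first.
    by rewrite big_split /= -mulr_sumr -/(G s w) hG mulr0 add0r.
  by apply: eq_bigr => i _; rewrite /y; ring.
(* The numerator is at most [(4/7 + 2) M |s' - s|], hence at most [3 M |s' - s|], and dividing by
   [6/7] gives [7/2]. Then [2 * (7/2)^2 = 49/2 <= 25] is the constant of the lemma. *)
have yb i : `|y i| <= 7 / 2 * M * `|s' - s|.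
  have /andP[a1 a2] := den_bound i ss wM; have a0 := den_gt0 i ss wM.
  rewrite /y normrM normfV (gtr0_norm a0) ler_pdivrMr //.
  have -> : s * (lam i - w) - s' * (lam i - w') = s' * (w' - w) - (s' - s) * (lam i - w) by ring.
  apply: le_trans (ler_normB _ _) _; rewrite !normrM.
  have /andP[l1 l2] := lamB i; have := wM; rewrite ler_norml => /andP[w1 w2].
  have lw : `|lam i - w| <= 2 * M by rewrite ler_norml; apply/andP; split; lra.
  have h1 : `|s'| * `|w' - w| <= `|s'| * (8 * M ^+ 2 * `|s' - s|) by apply: ler_wpM2l.
  have h2 : `|s'| * (8 * M ^+ 2 * `|s' - s|) = (14 * M * `|s'|) * (8 / 14 * M * `|s' - s|) by field.
  have h0 : 0 <= M * `|s' - s| by rewrite mulr_ge0 // ltW.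
  have h3 : (14 * M * `|s'|) * (8 / 14 * M * `|s' - s|) <= 1 * (8 / 14 * M * `|s' - s|).
    by apply: ler_wpM2r => //; lra.
  have h4 : `|s' - s| * `|lam i - w| <= `|s' - s| * (2 * M) by apply: ler_wpM2l.
  have h5 : 3 * (M * `|s' - s|) <= 7 / 2 * (M * `|s' - s|) * (1 - s * (lam i - w)) by nra.
  lra.
have y1 i : 1 + y i = (1 - s' * (lam i - w')) / (1 - s * (lam i - w)).
  by rewrite /y; field; exact: den_neq0.
have ylo i : - 2^-1 <= y i.
  have /andP[a1 a2] := den_bound i ss wM; have a0 := den_gt0 i ss wM.
  have /andP[b1 b2] := den_bound i ss' wM'.
  have : 2^-1 <= 1 + y i by rewrite y1 ler_pdivlMr //; lra.
  lra.
have lnE i : ln (1 - s' * (lam i - w')) - ln (1 - s * (lam i - w)) = ln (1 + y i).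
  by rewrite y1 ln_div ?posrE //; exact: den_gt0.
have -> : Psi s' w' - Psi s w - (s' - s) * w = - (n.+1%:R^-1 * \sum_(i < n.+1) (ln (1 + y i) - y i)).
  rewrite /Psi sumrB sy; under [in RHS]eq_bigr => i _ do rewrite -lnE.
  by rewrite sumrB; field.
rewrite normrN normrM normfV normr_nat ler_pdivrMl //.
apply: le_trans (ler_norm_sum _ _ _) _.
rewrite mulrC; apply: sum_le_card_mul => i.
apply: le_trans (ln_quadratic (ylo i)) _.
have : y i ^+ 2 <= (7 / 2 * M * `|s' - s|) ^+ 2.
  by rewrite -[y i ^+ 2]real_normK ?num_real // ler_pXn2r ?nnegrE // mulr_ge0 // mulr_ge0 // ltW.
have -> : (7 / 2 * M * `|s' - s|) ^+ 2 = 49 / 4 * (M ^+ 2 * `|s' - s| ^+ 2) by field.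
rewrite real_normK ?num_real //.
have : 0 <= M ^+ 2 * (s' - s) ^+ 2 by rewrite mulr_ge0 ?sqr_ge0.
by lra.
Qed.

(** Any selection of roots is Lipschitz, hence continuous. The slope is clamped to the admissible
    interval to obtain a function continuous on the whole line, as the integration lemmas
    require. *)
Lemma small_slope_root : exists f : R -> R, continuous f /\
  forall s, small_slope s -> `|f s| <= M /\ G s (f s) = 0.
Proof.
pose c : R := (14 * M)^-1; have c0 : 0 < c by rewrite invr_gt0 mulr_gt0.
pose clamp s := if s < - c then - c else if c < s then c else s.
have ssE s : small_slope s <-> - c <= s <= c.
  by rewrite /small_slope mulrC -ler_pdivlMr ?mulr_gt0 // div1r ler_norml.
have clampss s : small_slope (clamp s).
  apply/ssE; rewrite /clamp; case: ltP => [_|h1]; first by apply/andP; split; lra.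
  by case: ltP => [_|h2]; apply/andP; split; lra.
have clamp_lip s s' : `|clamp s' - clamp s| <= `|s' - s|.
  have h1 := ler_norm (s' - s); have h2 := ler_norm (- (s' - s)); rewrite normrN in h2.
  rewrite ler_norml /clamp.
  by case: (ltP s (- c)); case: (ltP s' (- c)); try case: (ltP c s); try case: (ltP c s');
    move=> *; apply/andP; split; lra.
have /choice[f hf] : forall s, exists w, `|w| <= M /\ G (clamp s) w = 0.
  by move=> s; exact: Rtransform_root_exists.
exists f; split=> [s|s ss]; last first.
  have := hf s; suff -> : clamp s = s by [].
  move/ssE : ss => /andP[s1 s2]; rewrite /clamp; case: ltP => [|_]; first by lra.
  by case: ltP => //; lra.
have M2 : 0 < 8 * M ^+ 2 by rewrite mulr_gt0 // exprn_gt0.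
apply/cvgrPdist_le => e e0; have e' : 0 < (8 * M ^+ 2)^-1 * e by rewrite mulr_gt0 // invr_gt0.
near=> t; have [[f1 f2] [f3 f4]] := (hf s, hf t).
rewrite distrC; apply: le_trans (root_lipschitz (clampss s) (clampss t) f1 f3 f2 f4) _.
rewrite -ler_pdivlMl //; apply: le_trans (clamp_lip _ _) _; rewrite distrC.
near: t.
by exists ((8 * M ^+ 2)^-1 * e) => // x /= /ltW.
Unshelve. all: by end_near. Qed.

(** [Rtransform] has a junk value at [0], so it is traded for the continuous root [f] on a half-open
    segment, at no cost for the integral. The strict bound on [th] keeps the endpoint inside the
    admissible slopes, where [Psi s (f s)] is differentiable on both sides. *)
Lemma Rtransform_integral th : th != 0 -> 14 * M * `|th| < 1 ->
  oriented_integral (Rtransform lam) 0 th = Psi th (Rtransform lam th).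
Proof.
move=> th0 ss; have [f [cf hf]] := small_slope_root.
have fE s : s != 0 -> small_slope s -> f s = Rtransform lam s.
  by move=> s0 sl; have [h1 h2] := hf s sl; rewrite (Rtransform_rootE s0 sl h1 h2).
pose c : R := (14 * M)^-1; have M14 : 0 < 14 * M by rewrite mulr_gt0.
have ssE s : small_slope s <-> `|s| <= c.
  by rewrite /small_slope mulrC -ler_pdivlMr // div1r.
have thc : `|th| < c by rewrite -[c]div1r ltr_pdivlMr // mulrC.
have dF (t : R) : `|t| <= `|th| -> is_derive t 1 (fun s => Psi s (f s)) (f t).
  move=> tt; apply: (@is_derive_quadratic _ _ _ _ (25 * M ^+ 2) (c - `|t|)).
    by rewrite subr_gt0; apply: le_lt_trans thc.
  move=> h hc; have s1 : small_slope t by apply/ssE/(le_trans tt)/ltW.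
  have s2 : small_slope (t + h).
    by apply/ssE/(le_trans (ler_normD _ _)); lra.
  have [a1 a2] := hf _ s1; have [b1 b2] := hf _ s2.
  by have := Psi_quadratic s1 s2 a1 b1 a2 b2; rewrite (_ : t + h - t = h) //; ring.
have P0 w : Psi 0 w = 0.
  rewrite /Psi mul0r big1 ?mulr0 ?subrr // => i _.
  by rewrite mul0r subr0 ln1.
rewrite /oriented_integral; case: ifPn => [th_ge0|th_lt0].
  have thp : 0 < th by rewrite lt_neqAle eq_sym th0.
  have eqf : {in `]0, th], f =1 Rtransform lam}.
    move=> t; rewrite in_itv /= => /andP[t0 t1]; apply: fE; first by rewrite gt_eqF.
    by apply/ssE; rewrite gtr0_norm //; apply: le_trans (ltW thc); rewrite gtr0_norm.
  have If : lebesgue_measure.-integrable `]0, th] (EFin \o f).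
    apply: integrableS (continuous_integrable_segment 0 th cf) => //.
    by move=> t /=; rewrite !in_itv /= => /andP[t0 ->]; rewrite ltW.
  have IR : lebesgue_measure.-integrable `]0, th] (EFin \o Rtransform lam).
    apply: eq_integrable If => // t; rewrite inE /= => tt; congr EFin; exact: eqf.
  rewrite -Rintegral_itv_obnd_cbnd //.
  transitivity (\int[lebesgue_measure]_(x in `]0, th]) f x).
    by apply: eq_Rintegral => t; rewrite inE /= => tt; rewrite eqf.
  rewrite Rintegral_itv_obnd_cbnd //.
  have FTC : intg 0 th f = Psi th (f th) - Psi 0 (f 0).
    apply: (@intg_FTC _ (fun s => Psi s (f s)) f) => // t /andP[t0 t1].
    by apply: dF; rewrite !ger0_norm.
  by rewrite -/(intg 0 th f) FTC P0 subr0 fE //; exact: ltW.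
have thn : th < 0 by rewrite ltNge.
have eqf : {in `[th, 0[, f =1 Rtransform lam}.
  move=> t; rewrite in_itv /= => /andP[t0 t1]; apply: fE; first by rewrite lt_eqF.
  by apply/ssE; apply: le_trans (ltW thc); rewrite !ltr0_norm // lerN2.
have If : lebesgue_measure.-integrable `[th, 0[ (EFin \o f).
  apply: integrableS (continuous_integrable_segment th 0 cf) => //.
  by move=> t /=; rewrite !in_itv /= => /andP[-> t0]; rewrite ltW.
have IR : lebesgue_measure.-integrable `[th, 0[ (EFin \o Rtransform lam).
  apply: eq_integrable If => // t; rewrite inE /= => tt; congr EFin; exact: eqf.
rewrite -Rintegral_itv_bndo_bndc //.
have -> : \int[lebesgue_measure]_(x in `[th, 0[) Rtransform lam x = \int[lebesgue_measure]_(x in `[th, 0[) f x.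
  by apply: eq_Rintegral => t; rewrite inE /= => tt; rewrite eqf.
rewrite Rintegral_itv_bndo_bndc //.
have FTC : intg th 0 f = Psi 0 (f 0) - Psi th (f th).
  apply: (@intg_FTC _ (fun s => Psi s (f s)) f) => // t /andP[t0 t1].
  by apply: dF; rewrite !ler0_norm ?lerN2 // ltW.
by rewrite -/(intg th 0 f) FTC P0 sub0r opprK fE //; exact: ltW.
Qed.

Lemma expR_Rtransform_integral th : th != 0 -> 14 * M * `|th| < 1 ->
  expR (n.+1%:R * oriented_integral (Rtransform lam) 0 th) =
  expR (n.+1%:R * th * Rtransform lam th) *
    \prod_(i < n.+1) (1 - th * (lam i - Rtransform lam th))^-1.
Proof.
move=> th0 ss; rewrite Rtransform_integral //.
have [vM _] := Rtransform_props th0 (ltW ss).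
set v := Rtransform lam th in vM *.
rewrite /Psi mulrBr mulrA mulrA mulfV ?pnatr_eq0 // mul1r expRD; congr (_ * _).
rewrite -sumrN expR_sum; apply: eq_bigr => i _.
by rewrite expRN lnK ?posrE //; apply: den_gt0 => //; exact: ltW.
Qed.

Lemma derive1n_hilbert k z : (forall i, z != lam i) ->
  derive1n k (hilbert lam) z =
  (-1) ^+ k * k`!%:R * (n.+1%:R^-1 * \sum_(i < n.+1) (z - lam i) ^- k.+1).
Proof.
elim: k z => [|k ih] z hz.
  by rewrite derive1n0 expr0 fact0 !mul1r.
have zn : \near z, forall i, z != lam i.
  have : (\forall x \near z, forall i, i \in index_enum 'I_n.+1 -> x != lam i).
    elim: (index_enum 'I_n.+1) => [|i r ihr]; first by near=> x => i; rewrite in_nil.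
    near=> x => j; rewrite in_cons => /predU1P[->|].
      by near: x; apply: open_nbhs_nbhs; split; [exact: open_neq|exact: hz].
    move: j; near: x; exact: ihr.
  by apply: filterS => x h i; apply: h; rewrite mem_index_enum.
have near_eq : \near z, (-1) ^+ k * k`!%:R * (n.+1%:R^-1 * \sum_(i < n.+1) (z - lam i) ^- k.+1) =
    derive1n k (hilbert lam) z.
  by near do rewrite ih //.
have di i : is_derive z 1 (fun z => (z - lam i) ^- k.+1) (- k.+1%:R * (z - lam i) ^- k.+2).
  have d1 : is_derive z 1 (fun z => z - lam i) (1 - 0) by apply: is_deriveB.
  have d2 : is_derive z 1 (fun z => (z - lam i) ^+ k.+1) (k.+1%:R * (z - lam i) ^+ k).
    have := @is_deriveX _ _ _ k.+1 _ _ _ d1.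
    by rewrite exprfctE /GRing.scale /= subr0 mulr1.
  have nz : z - lam i != 0 by rewrite subr_eq0 hz.
  have d3 := @is_deriveV _ (fun z => (z - lam i) ^+ k.+1) _ _ _ (expf_neq0 k.+1 nz) d2.
  apply: is_derive_eq d3 _; rewrite /GRing.scale /=.
  rewrite (exprS _ k.+1) (exprS _ k); field; by rewrite expf_neq0.
rewrite derive1nS derive1E -(near_eq_derive _ near_eq).
have ds : is_derive z 1 (fun z => \sum_(i < n.+1) (z - lam i) ^- k.+1)
    (\sum_(i < n.+1) (- k.+1%:R * (z - lam i) ^- k.+2)).
  have := @is_derive_sum _ _ _ _ (fun i z => (z - lam i) ^- k.+1) z 1 _ di.
  by rewrite fct_sumE.
have d1 := @is_deriveZ _ _ _ _ (n.+1%:R^-1) _ _ _ ds.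
have d2 := @is_deriveZ _ _ _ _ ((-1) ^+ k * k`!%:R) _ _ _ d1.
have [_ ->] := d2; rewrite /GRing.scale /= -mulr_sumr factS natrM exprS; ring.
Unshelve. all: by end_near. Qed.

Lemma Acoef_power_mean th k : th != 0 -> small_slope th -> (0 < k)%N ->
  Acoef lam th k = power_mean (fun i => (1 - th * (lam i - Rtransform lam th))^-1) k.
Proof.
move=> th0 ss; case: k => // k _; have [vM _] := Rtransform_props th0 ss.
set v := Rtransform lam th in vM *.
have zE i : v + th^-1 - lam i = (1 - th * (lam i - v)) / th by field.
rewrite /Acoef -/v derive1n_hilbert /=; last first.
  by move=> i; rewrite -subr_eq0 zE mulf_neq0 ?invr_eq0 // den_neq0.
rewrite /power_mean; under eq_bigr => i _ do rewrite zE expr_div_n invf_div.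
under [in RHS]eq_bigr => i _ do rewrite exprVn.
rewrite -mulr_sumr.
have s1 : (-1) ^+ k * (-1) ^+ k = 1 :> R by rewrite -exprMn mulrNN mul1r expr1n.
transitivity ((-1) ^+ k * (-1) ^+ k * (n.+1%:R^-1 * \sum_(i < n.+1) (1 - th * (lam i - v)) ^- k.+1)).
  have F0 : k`!%:R != 0 :> R by rewrite pnatr_eq0 -lt0n fact_gt0.
  have T0 : th ^+ k.+1 != 0 by rewrite expf_neq0.
  move: F0 T0 (n.+1%:R^-1) (\sum_(i < n.+1) _) ((-1) ^+ k); move: (k`!%:R) (th ^+ k.+1) => F T F0 T0 x y z.
  by field; rewrite F0 T0.
by rewrite s1 mul1r.
Qed.

End RTransform.

(** * Haar measures *)

Section InvariantExpectation.
Context d (T : measurableType d) {R : realType} (P : probability T R) (G : set T).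
Hypothesis mG : measurable G.

Lemma preserving_comp (g h : T -> T) : preserving P G g -> preserving P G h ->
  preserving P G (g \o h).
Proof.
move=> pg ph f bf; have [b1 e1] := pg f bf; have [b2 e2] := ph _ b1.
by split=> //; rewrite -e1 -e2.
Qed.

(** Change of variables: the push-forward of [P] by [g] is [P] itself, and the domain [G] is stable
    under preimage. *)
Lemma invariant_preserving (g : T -> T) : P G = 1%E -> measurable_fun setT g ->
  (forall A, measurable A -> P (g @^-1` A) = P A) -> g @^-1` G = G ->
  preserving P G g.
Proof.
move=> PG mg Pg gG f [mf [M hM]].
have bfg : bmeas G (fun U => f (g U)).
  split; first exact: (measurableT_comp mf).
  exists M => U GU; apply: hM.
  by have : (g @^-1` G) U by rewrite gG.
split=> //; rewrite /expect /Rintegral; congr fine.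
rewrite -[X in (\int[P]_(x in X) (f (g x))%:E)%E]gG.
have /measurable_realfun.measurable_EFinP mEf := mf.
rewrite -(@integral_pushforward _ _ _ _ _ g mg P G (EFin \o f) mEf _ mG).
  by apply: eq_measure_integral => A mA _; exact: Pg.
by rewrite gG; exact: (bmeas_integrable mG PG bfg).
Qed.

End InvariantExpectation.

Lemma sum_double {V : nmodType} m (f : nat -> V) :
  \sum_(j < m.*2) f j = \sum_(i < m) (f i.*2 + f i.*2.+1).
Proof.
elim: m => [|m ih]; first by rewrite !big_ord0.
by rewrite doubleS !big_ord_recr /= ih addrA.
Qed.

Section PlaneRotation.
Context {K : comNzRingType} (n : nat).
Implicit Types (i j a b : 'I_n) (c s : K).

(** Over an arbitrary commutative ring, to serve the orthogonal group and, with real [c] and [s]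
    seen as complex numbers, the unitary group. *)
Definition plane_rotation i j c s : 'M[K]_n := \matrix_(a, b)
  (if a == i then c *+ (b == i) + s *+ (b == j)
   else if a == j then - s *+ (b == i) + c *+ (b == j) else (a == b)%:R).

Lemma mul_plane_rotation m i j c s (U : 'M[K]_(n, m)) a k :
  (plane_rotation i j c s *m U) a k =
  if a == i then c * U i k + s * U j k
  else if a == j then - s * U i k + c * U j k else U a k.
Proof.
have delta x (l : 'I_n) : \sum_(b < n) (x *+ (b == l)) * U b k = x * U l k.
  rewrite (bigD1 l) //= eqxx mulr1n big1 ?addr0 // => b /negbTE->.
  by rewrite mulr0n mul0r.
rewrite mxE; case: (altP (a =P i)) => [->|ai].
  rewrite -!delta -big_split; apply: eq_bigr => b _.
  by rewrite mxE eqxx mulrDl.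
case: (altP (a =P j)) => [aj|aj].
  rewrite -!delta -big_split; apply: eq_bigr => b _.
  by rewrite mxE (negbTE ai) aj eqxx mulrDl.
rewrite -[RHS]mul1r -delta; apply: eq_bigr => b _.
by rewrite mxE (negbTE ai) (negbTE aj) eq_sym.
Qed.

Lemma plane_rotation_orthogonal i j c s : i != j -> c ^+ 2 + s ^+ 2 = 1 ->
  plane_rotation i j c s *m (plane_rotation i j c s)^T = 1%:M.
Proof.
move=> ij cs; have ji := ij; rewrite eq_sym in ji.
apply/matrixP => a b; rewrite mul_plane_rotation !mxE eqxx (negbTE ij) (negbTE ji).
rewrite !eqxx /= mulr0n mulr1n addr0 add0r.
have [ai|ai] := eqVneq a i.
  have [bi|bi] := eqVneq b i; first by rewrite ai bi eqxx /= -cs; ring.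
  have [bj|bj] := eqVneq b j; first by rewrite ai bj (negbTE ij) /=; ring.
  by rewrite ai eq_sym (negbTE bi) /=; ring.
have [aj|aj] := eqVneq a j.
  have [bi|bi] := eqVneq b i; first by rewrite aj bi (negbTE ji) /=; ring.
  have [bj|bj] := eqVneq b j; first by rewrite aj bj eqxx /= -cs; ring.
  by rewrite aj eq_sym (negbTE bj) /=; ring.
have [bi|bi] := eqVneq b i; first by rewrite bi (negbTE ai) /=; ring.
have [bj|bj] := eqVneq b j; first by rewrite bj (negbTE aj) /=; ring.
by rewrite eq_sym.
Qed.

End PlaneRotation.

Section OrthogonalHaar.
Context {R : realType} (n : nat).
Let T := real_matrices R n.+1.
Let G : set T := @orthogonal_group R n.+1.
Variable P : probability T R.
Hypothesis haarP : is_haar_probability (@real_cylinders R n.+1) (@orthogonal_group R n.+1) P.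

Lemma measurable_entry i j : measurable_fun setT (fun U : T => (U : 'M[R]_n.+1) i j).
Proof.
move=> _ X mX; rewrite setTI; apply: sub_sigma_algebra.
by exists i, j, X.
Qed.

Let measurable_sum (m : nat) (f : 'I_m -> T -> R) : (forall i, measurable_fun setT (f i)) ->
  measurable_fun setT (fun U => \sum_(i < m) f i U).
Proof.
by move=> mf; apply: measurable_sum.
Qed.

(** The group is the zero set of a single measurable function, the sum of the squared entries of
    [U U^T - 1]. *)
Lemma measurable_orthogonal_group : measurable G.
Proof.
pose D (U : T) : R := \sum_(i < n.+1) \sum_(j < n.+1)
  (\sum_(k < n.+1) (U : 'M[R]_n.+1) i k * (U : 'M[R]_n.+1) j k - (i == j)%:R) ^+ 2.
have mD : measurable_fun setT D.
  apply: measurable_sum => i; apply: measurable_sum => j.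
  apply: measurable_realfun.measurable_funX; apply: measurable_realfun.measurable_funB => //.
  apply: measurable_sum => k; apply: measurable_realfun.measurable_funM; exact: measurable_entry.
rewrite (_ : G = setT `&` D @^-1` [set 0]); first exact: mD.
apply/seteqP; split => U.
  move=> GU; split=> //=; rewrite /D big1 // => i _; rewrite big1 // => j _.
  have /matrixP /(_ i j) : (U : 'M[R]_n.+1) *m (U : 'M[R]_n.+1)^T = 1%:M by [].
  rewrite !mxE; under eq_bigr do rewrite mxE; move=> ->.
  by rewrite subrr expr0n.
move=> [_ /= /eqP]; rewrite psumr_eq0 => [|i _]; last by apply: sumr_ge0 => j _; exact: sqr_ge0.
move=> /allP h; apply/matrixP => i j; have := h i (mem_index_enum _).
rewrite implyTb psumr_eq0 => [|j' _]; last exact: sqr_ge0.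
move=> /allP/(_ j (mem_index_enum _)); rewrite implyTb sqrf_eq0 subr_eq0 => /eqP e.
by rewrite !mxE -e; apply: eq_bigr => k _; rewrite !mxE.
Qed.

Lemma orthogonal_preserving (g : 'M[R]_n.+1) : g *m g^T = 1%:M ->
  preserving P G (fun U : T => g *m (U : 'M[R]_n.+1) : T).
Proof.
move=> gg; case: haarP => PG inv; apply: invariant_preserving => //.
- exact: measurable_orthogonal_group.
- apply: (@measurability _ _ T T setT _ (@real_cylinders R n.+1)) => // _ [_ [i [j [X [mX ->]]]] <-].
  rewrite setTI; have mf : measurable_fun setT (fun U : T => (g *m (U : 'M[R]_n.+1)) i j).
    under eq_fun do rewrite mxE.
    apply: measurable_sum => k; apply: measurable_realfun.measurable_funM => //.
    exact: measurable_entry.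
  by have := mf measurableT X mX; rewrite setTI.
- by move=> A mA; exact: inv.
- have GM (A B : 'M[R]_n.+1) : A *m A^T = 1%:M -> B *m B^T = 1%:M -> A *m B *m (A *m B)^T = 1%:M.
    by move=> hA hB; rewrite trmx_mul -mulmxA [B *m _]mulmxA hB mul1mx.
  apply/seteqP; split => U /=; rewrite /G /orthogonal_group /= => h; last exact: GM.
  have gTg : g^T *m g = 1%:M by exact: mulmx1C.
  have := GM g^T (g *m U); rewrite mulmxA gTg mul1mx; apply=> //.
  by rewrite trmxK.
Qed.

End OrthogonalHaar.

(** * The orthogonal integral in even dimension *)

Section OrthogonalSpherical.
Context {R : realType} (N : nat).
Variable P : probability (real_matrices R N.*2.+2) R.
Hypothesis haarP :
  is_haar_probability (@real_cylinders R N.*2.+2) (@orthogonal_group R N.*2.+2) P.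

(** Rows [2 i] and [2 i + 1] of the first column are read as the real and imaginary parts of a
    complex coordinate [i]; both carry the eigenvalue [lam i] in the doubled matrix. *)
Let ev (i : 'I_N.+1) : 'I_N.*2.+2 := inord i.*2.
Let od (i : 'I_N.+1) : 'I_N.*2.+2 := inord i.*2.+1.

Let val_ev i : ev i = i.*2 :> nat.
Proof. by rewrite inordK // -doubleS ltn_double. Qed.

Let val_od i : od i = i.*2.+1 :> nat.
Proof. by rewrite inordK // !ltnS leq_double -ltnS. Qed.

Let ev_eq i j : (ev i == ev j) = (i == j).
Proof. by rewrite -val_eqE /= !val_ev (inj_eq double_inj). Qed.

Let od_eq i j : (od i == od j) = (i == j).
Proof. by rewrite -val_eqE /= !val_od eqSS (inj_eq double_inj). Qed.

Let ev_od i j : (ev i == od j) = false.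
Proof.
rewrite -val_eqE /= val_ev val_od; apply/eqP => /(congr1 odd).
by rewrite /= !odd_double.
Qed.

Let od_ev i j : (od i == ev j) = false.
Proof. by rewrite eq_sym ev_od. Qed.

Let sum_pairs (V : nmodType) (f : 'I_N.*2.+2 -> V) :
  \sum_j f j = \sum_(i < N.+1) (f (ev i) + f (od i)).
Proof.
transitivity (\sum_(j < N.+1.*2) f (inord j)).
  by apply: eq_bigr => j _; rewrite inord_val.
exact: (@sum_double V N.+1 (fun j => f (inord j))).
Qed.

Let x (i : 'I_N.+1) (U : real_matrices R N.*2.+2) : R := (U : 'M[R]_N.*2.+2) (ev i) ord0.
Let y (i : 'I_N.+1) (U : real_matrices R N.*2.+2) : R := (U : 'M[R]_N.*2.+2) (od i) ord0.

Let sph : spherical P (@orthogonal_group R N.*2.+2) x y.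
Proof.
split.
- by move=> i; split; exact: measurable_entry.
- move=> U GU; have /matrixP /(_ ord0 ord0) : (U : 'M[R]_N.*2.+2)^T *m (U : 'M[R]_N.*2.+2) = 1%:M.
    exact: mulmx1C.
  rewrite !mxE sum_pairs eqxx mulr1n => <-; apply: eq_bigr => i _.
  by rewrite !mxE -!expr2.
- move=> i j c s ij cs.
  (* A real rotation of two complex coordinates rotates their real parts and their imaginary parts
     simultaneously, in two disjoint planes. *)
  exists ((fun U => plane_rotation (ev i) (ev j) c s *m U) \o
          (fun U => plane_rotation (od i) (od j) c s *m U)); split.
    apply: preserving_comp; apply: orthogonal_preserving => //;
      apply: plane_rotation_orthogonal => //; by rewrite ?ev_eq ?od_eq.
  move=> U k GU; rewrite /x /y /= !mul_plane_rotation !ev_eq !od_eq !ev_od !od_ev.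
  by split.
(* Multiplication by the imaginary unit is a quarter turn in the plane of the two parts of one
   coordinate. *)
- move=> i; exists (fun U => plane_rotation (ev i) (od i) 0 (-1) *m U); split.
    apply: orthogonal_preserving => //; apply: plane_rotation_orthogonal.
      by rewrite ev_od.
    by rewrite expr0n /= add0r sqrrN expr1n.
  move=> U k GU; rewrite /x /y /= !mul_plane_rotation !ev_eq !od_eq !ev_od !od_ev.
  by split; case: ifP => // _; ring.
Qed.

Lemma spherical_integral1_quad (th : R) (lam : 'I_N.+1 -> R) :
  exists x y : 'I_N.+1 -> real_matrices R N.*2.+2 -> R,
    spherical P (@orthogonal_group R N.*2.+2) x y /\
    spherical_integral1 P (th / 2) (doubled_diag lam) =
    expect P (@orthogonal_group R N.*2.+2)
      (fun U => expR (N.+1%:R * quad_power x y (fun i => th * lam i) 1 U)).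
Proof.
exists x, y; split; first exact: sph.
apply: expect_eq => U GU; congr expR.
rewrite /quad_power mxE sum_pairs.
(* The halved parameter compensates the doubled size. *)
have E : th / 2 * N.*2.+2%:R = N.+1%:R * th by rewrite -doubleS -muln2 natrM; field.
rewrite [X in X * _]E -[LHS]mulrA; congr (_ * _); rewrite mulr_sumr; apply: eq_bigr => i _.
have diag (j : 'I_N.*2.+2) (k : 'I_N.+1) : j./2 = k :> nat ->
   ((col ord0 (U : 'M[R]_N.*2.+2))^T *m doubled_diag lam) ord0 j = lam k * U j ord0.
  move=> jk; rewrite mul_mx_diag !mxE jk inord_val; ring.
rewrite (diag _ i) ?(diag _ i) ?mxE /x /y; first by ring.
  by rewrite val_od; exact: (half_bit_double i true).
by rewrite val_ev doubleK.
Qed.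

End OrthogonalSpherical.

(** * The unitary integral *)

Section UnitaryMatrix.
Local Open Scope sesquilinear_scope.
Context {C : numClosedFieldType} (n : nat).
Implicit Types A B U V : 'M[C]_n.

Lemma unitarymx_mulKl V U : V \is unitarymx -> V *m U \is unitarymx -> U \is unitarymx.
Proof.
move=> uV uVU; rewrite -[U]mul1mx.
rewrite -(_ : V^t* *m V = 1%:M); last exact/mulmx1C/unitarymxP.
by rewrite -mulmxA mul_unitarymx // trmxC_unitary.
Qed.

Lemma char_poly_similar (A P Q : 'M[C]_n) : Q *m P = 1%:M -> char_poly (Q *m A *m P) = char_poly A.
Proof.
move=> QP; rewrite /char_poly.
have -> : char_poly_mx (Q *m A *m P) =
    map_mx polyC Q *m char_poly_mx A *m map_mx polyC P.
  rewrite /char_poly_mx mulmxBr mulmxBl -!map_mxM mul_mx_scalar -scalemxAl.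
  by rewrite -map_mxM QP map_mx1 scalemx1.
rewrite !det_mulmx mulrAC -det_mulmx -map_mxM QP map_mx1 det1 mul1r //.
Qed.

Lemma hermitian_diagonalization B : B \is hermsymmx -> exists V D,
  [/\ V \is unitarymx, B = V^t* *m diag_mx D *m V &
      char_poly B = \prod_(i < n) ('X - (D ord0 i)%:P)].
Proof.
move=> /hermitian_normalmx /orthomx_spectralP hB.
have uV := spectral_unitarymx B; rewrite (invmx_unitary uV) in hB.
exists (spectralmx B), (spectral_diag B); split=> //.
have V1 : (spectralmx B)^t* *m spectralmx B = 1%:M by exact/mulmx1C/unitarymxP.
rewrite (congr1 char_poly hB) (char_poly_similar _ V1).
rewrite char_poly_trig; first by apply: eq_bigr => i _; rewrite mxE eqxx mulr1n.
apply/is_trig_mxP => i j ij; rewrite mxE; case: eqP => [e|_]; last by rewrite mulr0n.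
by rewrite e ltnn in ij.
Qed.

Lemma diag_quadratic_form (D : 'rV[C]_n) V U j :
  ((col j U)^t* *m (V^t* *m diag_mx D *m V) *m col j U) ord0 ord0 =
  \sum_(k < n) D ord0 k * (Num.conj ((V *m U) k j) * (V *m U) k j).
Proof.
have -> : (col j U)^t* *m (V^t* *m diag_mx D *m V) *m col j U =
    (col j (V *m U))^t* *m diag_mx D *m col j (V *m U).
  by rewrite !colE -!mulmxA !trmx_mul !map_mxM -!mulmxA.
rewrite mxE; apply: eq_bigr => k _.
by rewrite mul_mx_diag !mxE mulrAC mulrC.
Qed.

End UnitaryMatrix.

Section UnitaryHaar.
Local Open Scope sesquilinear_scope.
Local Open Scope complex_scope.
Context {R : realType} (n : nat).
Let T := complex_matrices R n.+1.
Let G : set T := @unitary_group R n.+1.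
Variable P : probability T R.
Hypothesis haarP :
  is_haar_probability (@complex_cylinders R n.+1) (@unitary_group R n.+1) P.

Let mfun (f : T -> R[i]) :=
  measurable_fun setT (fun U => complex.Re (f U)) /\
  measurable_fun setT (fun U => complex.Im (f U)).

Let mfun_entry i j : mfun (fun U : T => (U : 'M[R[i]]_n.+1) i j).
Proof.
by split => _ X mX; rewrite setTI; apply: sub_sigma_algebra; exists i, j, X;
  split=> //; [left|right].
Qed.

Let mfun_cst z : mfun (fun=> z).
Proof. by split; exact: measurable_cst. Qed.

Let mfunM f g : mfun f -> mfun g -> mfun (fun U => f U * g U).
Proof.
move=> [f1 f2] [g1 g2]; split.
  under eq_fun do rewrite ReM; apply: measurable_realfun.measurable_funB;
  exact: measurable_realfun.measurable_funM.
under eq_fun do rewrite ImM; apply: measurable_realfun.measurable_funD;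
  exact: measurable_realfun.measurable_funM.
Qed.

Let mfunD f g : mfun f -> mfun g -> mfun (fun U => f U + g U).
Proof.
move=> [f1 f2] [g1 g2]; split.
  by under eq_fun do rewrite ReD; exact: measurable_realfun.measurable_funD.
by under eq_fun do rewrite ImD; exact: measurable_realfun.measurable_funD.
Qed.

Let mfun_conj f : mfun f -> mfun (fun U => Num.conj (f U)).
Proof.
move=> [f1 f2]; split; under eq_fun do rewrite conjC_ReIm /=; first by [].
by under eq_fun do rewrite -mulN1r; exact: measurable_realfun.measurable_funM.
Qed.

Let mfun_sum (m : nat) (f : 'I_m -> T -> R[i]) : (forall i, mfun (f i)) ->
  mfun (fun U => \sum_(i < m) f i U).
Proof.
move=> mf; elim: (index_enum _) => [|i r ih].
  by under eq_fun do rewrite big_nil; exact: mfun_cst.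
by under eq_fun do rewrite big_cons; exact: mfunD.
Qed.

Lemma measurable_unitary_group : measurable G.
Proof.
pose E (U : T) i j := \sum_(k < n.+1) (U : 'M[R[i]]_n.+1) i k * Num.conj ((U : 'M[R[i]]_n.+1) j k) + - (i == j)%:R.
pose D (U : T) : R := \sum_(i < n.+1) \sum_(j < n.+1)
   (complex.Re (E U i j) ^+ 2 + complex.Im (E U i j) ^+ 2).
have mE i j : mfun (fun U => E U i j).
  apply: mfunD; last exact: mfun_cst.
  by apply: mfun_sum => k; apply: mfunM; [|apply: mfun_conj]; exact: mfun_entry.
have mD : measurable_fun setT D.
  apply: measurable_sum => i; apply: measurable_sum => j.
  by apply: measurable_realfun.measurable_funD; apply: measurable_realfun.measurable_funX;
    case: (mE i j).
rewrite (_ : G = setT `&` D @^-1` [set 0]); first exact: mD.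
have entry (U : T) i j : ((U : 'M[R[i]]_n.+1) *m (U : 'M[R[i]]_n.+1)^t* ) i j =
    \sum_(k < n.+1) (U : 'M[R[i]]_n.+1) i k * Num.conj ((U : 'M[R[i]]_n.+1) j k).
  by rewrite mxE; apply: eq_bigr => k _; rewrite !mxE.
apply/seteqP; split => U.
  move=> /unitarymxP GU; split=> //=; rewrite /D big1 // => i _; rewrite big1 // => j _.
  by rewrite /E -entry GU mxE subrr /= expr0n /= addr0.
have pos i j : 0 <= complex.Re (E U i j) ^+ 2 + complex.Im (E U i j) ^+ 2.
  by rewrite addr_ge0 ?sqr_ge0.
move=> [_ /= /eqP]; rewrite psumr_eq0 => [|i _]; last by apply: sumr_ge0 => j _.
move=> /allP h; apply/unitarymxP/matrixP => i j; have := h i (mem_index_enum _).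
rewrite implyTb psumr_eq0 => // /allP/(_ j (mem_index_enum _)).
rewrite implyTb paddr_eq0 ?sqr_ge0 // !sqrf_eq0 => /andP[/eqP e1 /eqP e2].
rewrite entry mxE; apply/eqP; rewrite -subr_eq0 -/(E U i j) eq_complex e1 e2.
by rewrite !eqxx.
Qed.

Lemma unitary_preserving (g : 'M[R[i]]_n.+1) : g \is unitarymx ->
  preserving P G (fun U : T => g *m (U : 'M[R[i]]_n.+1) : T).
Proof.
move=> gg; case: haarP => PG inv; apply: invariant_preserving.
- exact: measurable_unitary_group.
- exact: PG.
- apply: (@measurability _ _ T T setT _ (@complex_cylinders R n.+1)); first by [].
  move=> A0 [A1 [i [j [X [mX hA]]]] <-].
  rewrite setTI; have [m1 m2] : mfun (fun U : T => (g *m (U : 'M[R[i]]_n.+1)) i j).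
    under eq_fun do rewrite mxE.
    by apply: mfun_sum => k; apply: mfunM; [exact: mfun_cst|exact: mfun_entry].
  case: hA => ->.
    by have := m1 measurableT X mX; rewrite setTI.
  by have := m2 measurableT X mX; rewrite setTI.
- by move=> A mA; exact: inv.
- apply/seteqP; split => U h; first exact: (unitarymx_mulKl gg h).
  exact: (mul_unitarymx gg h).
Qed.

End UnitaryHaar.

(** Newton's identity involves [s] only through its power sums, which are symmetric. The spectral
    theorem lists the eigenvalues in an order of its own, hence the use. *)
Lemma hsym_perm {R : realType} (s t : seq R) k : perm_eq s t -> hsym s k = hsym t k.
Proof.
move=> st; apply: hsym_unique => [|m]; first exact: hsym0.
rewrite hsym_newton; apply: eq_bigr => j _; congr (_ * _).
exact: perm_big.
Qed.

Section UnitarySpherical.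
Local Open Scope sesquilinear_scope.
Local Open Scope complex_scope.
Context {R : realType} (n : nat).
Variable P : probability (complex_matrices R n.+1) R.
Hypothesis haarP :
  is_haar_probability (@complex_cylinders R n.+1) (@unitary_group R n.+1) P.

Let x (i : 'I_n.+1) (U : complex_matrices R n.+1) : R :=
  complex.Re ((U : 'M[R[i]]_n.+1) i ord0).
Let y (i : 'I_n.+1) (U : complex_matrices R n.+1) : R :=
  complex.Im ((U : 'M[R[i]]_n.+1) i ord0).

Let normE (z : R[i]) : Num.conj z * z = (complex.Re z ^+ 2 + complex.Im z ^+ 2)%:C.
Proof. by rewrite conjC_ReIm; case: z => a b; apply/eqP; rewrite eq_complex /=; apply/andP; split; apply/eqP; ring. Qed.

Let conj_real (a : R) : Num.conj (a%:C) = a%:C.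
Proof. by rewrite conjC_ReIm /= oppr0. Qed.

Let rotation_unitary i j (c s : R) : i != j -> c ^+ 2 + s ^+ 2 = 1 ->
  plane_rotation i j c%:C s%:C \is @unitarymx R[i] n.+1 n.+1.
Proof.
move=> ij cs; apply/unitarymxP.
have -> : (plane_rotation i j c%:C s%:C)^t* = (plane_rotation i j c%:C s%:C)^T :> 'M[R[i]]_n.+1.
  apply/matrixP => a b; rewrite !mxE.
  case: ifP => _; first by rewrite rmorphD !rmorphMn /= !conj_real.
  case: ifP => _; last by rewrite rmorph_nat.
  by rewrite rmorphD !rmorphMn rmorphN /= !conj_real.
apply: plane_rotation_orthogonal => //.
by rewrite -!rmorphXn -rmorphD cs.
Qed.

Let phase (i : 'I_n.+1) : 'M[R[i]]_n.+1 :=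
  diag_mx (\row_k (if k == i then Complex 0 1 else 1)).

Let phase_unitary i : phase i \is unitarymx.
Proof.
apply/unitarymxP/matrixP => a b; rewrite mul_diag_mx !mxE.
case: (altP (b =P a)) => [->|ba].
  rewrite eqxx mulr1n; case: ifP => _; last by rewrite conjC1 mulr1.
  by rewrite mulrC normE /= expr0n expr1n /= add0r.
by rewrite mulr0n conjC0 mulr0 eq_sym (negbTE ba).
Qed.

Lemma unitary_spherical : spherical P (@unitary_group R n.+1) x y.
Proof.
split.
- move=> i; split => _ X mX; rewrite setTI; apply: sub_sigma_algebra;
    exists i, ord0, X; split=> //; [by left|by right].
- move=> U /unitarymxP GU.
  have /matrixP /(_ ord0 ord0) : (U : 'M[R[i]]_n.+1)^t* *m (U : 'M[R[i]]_n.+1) = 1%:M.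
    exact: mulmx1C.
  rewrite !mxE; under eq_bigr => i _ do rewrite !mxE normE.
  by rewrite -rmorph_sum => /(congr1 (@complex.Re R)).
- move=> i j c s ij cs; exists (fun U => plane_rotation i j c%:C s%:C *m U); split.
    by apply: unitary_preserving => //; exact: rotation_unitary.
  move=> U k GU; rewrite /x /y !mul_plane_rotation.
  case: ifP => _; first by rewrite ReD ImD !ReM !ImM /=; split; ring.
  by case: ifP => _ //; rewrite ReD ImD !ReM !ImM /=; split; ring.
- move=> i; exists (fun U => phase i *m U); split.
    by apply: unitary_preserving => //; exact: phase_unitary.
  move=> U k GU; rewrite /x /y mul_diag_mx !mxE.
  case: eqP => [->|_]; last by rewrite mul1r.
  by rewrite ReM ImM /=; split; ring.
Qed.

(** Diagonalize [B] by a unitary [V] and replace [V U] by [U] by left invariance. The diagonal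
    entries have the characteristic polynomial of [B], so they permute [lam] and are real. *)
Lemma spherical_integral2_quad (th : R) (B : 'M[R[i]]_n.+1) (lam : 'I_n.+1 -> R) :
  B \is hermsymmx -> eigenvalues_of B lam ->
  exists mu : 'I_n.+1 -> R,
    perm_eq [seq mu i | i <- index_enum 'I_n.+1] [seq lam i | i <- index_enum 'I_n.+1] /\
    spherical_integral2 P th B =
    expect P (@unitary_group R n.+1)
      (fun U => expR (n.+1%:R * quad_power x y (fun i => th * mu i) 1 U)).
Proof.
move=> hB eB; have [V [D [uV eqB cB]]] := hermitian_diagonalization hB.
have pD : perm_eq [seq D ord0 i | i <- index_enum 'I_n.+1] [seq (lam i)%:C | i <- index_enum 'I_n.+1].
  by apply: prod_XsubC_eq; rewrite !big_map -cB eB.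
exists (fun i => complex.Re (D ord0 i)); split.
  have := perm_map (@complex.Re R) pD; rewrite -!map_comp.
  by congr (perm_eq _ _); apply: eq_map.
have Dreal i : D ord0 i = (complex.Re (D ord0 i))%:C.
  have : D ord0 i \in [seq (lam i)%:C | i <- index_enum 'I_n.+1].
    by rewrite -(perm_mem pD); apply: map_f; rewrite mem_index_enum.
  by case/mapP => j _ ->.
pose h (U : complex_matrices R n.+1) : R := expR (n.+1%:R * quad_power x y (fun i => th * complex.Re (D ord0 i)) 1 U).
have PG : P (@unitary_group R n.+1) = 1%E by case: haarP.
have bh : bmeas (@unitary_group R n.+1 : set (complex_matrices R n.+1)) h.
  exact: (bmeas_exp_quad unitary_spherical).
have [_ <-] := unitary_preserving haarP uV bh.
apply: expect_eq => U GU; rewrite /h; congr expR.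
rewrite eqB diag_quadratic_form /quad_power Re_sum !mulr_sumr.
apply: eq_bigr => i _; rewrite normE {1}Dreal -rmorphM /= /x /y; ring.
Qed.

End UnitarySpherical.

(** * Equality of the two spherical integrals *)

Section SphericalIntegrals.
Context {R : realType} (n : nat).

Let kernel_limit (l : 'I_n.+1 -> R) (E : R) := forall e, 0 < e -> exists L0, forall L, (L0 <= L)%N ->
  `|\sum_(k < L.+1) hsym [seq l i | i <- index_enum 'I_n.+1] k * kernel_weight n.+1 k - E| <= e.

(** On the unit sphere, subtracting [v] from all eigenvalues only multiplies the exponential by a
    constant. With [v] the R-transform the shifted weights satisfy the saddle-point condition. *)
Let spherical_shift d (T : measurableType d) (P : probability T R) (G : set T)
    (x y : 'I_n.+1 -> T -> R) (l : 'I_n.+1 -> R) (th v : R) :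
  measurable G -> P G = 1%E -> spherical P G x y ->
  exists E, kernel_limit (fun i => th * (l i - v)) E /\
    expect P G (fun U => expR (n.+1%:R * quad_power x y (fun i => th * l i) 1 U)) =
    expR (n.+1%:R * th * v) * E.
Proof.
move=> mG PG sph.
exists (expect P G (fun U => expR (n.+1%:R * quad_power x y (fun i => th * (l i - v)) 1 U))); split.
  by move=> e e0; exact: (expect_exp_quad mG PG sph).
rewrite -expectZ //; last exact: (bmeas_exp_quad sph).
apply: expect_eq => U GU; rewrite -expRD; congr expR.
case: sph => _ /(_ U GU) q1 _ _.
rewrite /quad_power -mulrA -mulrDr; congr (_ * _).
rewrite -[th * v]mulr1 -q1 mulr_sumr -big_split; apply: eq_bigr => i _ /=.
by rewrite !expr1; ring.
Qed.

Lemma spherical_integrals (B : 'M[R[i]%C]_n.+1) (lam : 'I_n.+1 -> R)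
    (P2 : probability (complex_matrices R n.+1) R)
    (P1 : probability (real_matrices R n.*2.+2) R) (th v : R) :
  B \is hermsymmx -> eigenvalues_of B lam ->
  is_haar_probability (@complex_cylinders R n.+1) (@unitary_group R n.+1) P2 ->
  is_haar_probability (@real_cylinders R n.*2.+2) (@orthogonal_group R n.*2.+2) P1 ->
  exists E, [/\ kernel_limit (fun i => th * (lam i - v)) E,
    spherical_integral2 P2 th B = expR (n.+1%:R * th * v) * E &
    spherical_integral1 P1 (th / 2) (doubled_diag lam) = expR (n.+1%:R * th * v) * E].
Proof.
move=> hB eB haar2 haar1.
have [mu [pmu I2]] := spherical_integral2_quad haar2 th hB eB.
have [x [y [sph I1]]] := spherical_integral1_quad haar1 th lam.
have PG2 : P2 (@unitary_group R n.+1) = 1%E by case: haar2.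
have PG1 : P1 (@orthogonal_group R n.*2.+2) = 1%E by case: haar1.
have [E2 [l2 e2]] := spherical_shift mu th v (@measurable_unitary_group R n) PG2 (unitary_spherical haar2).
have [E1 [l1 e1]] := spherical_shift lam th v (@measurable_orthogonal_group R _) PG1 sph.
(* Both are limits of the same partial sums, the terms being symmetric in the eigenvalues. *)
have E12 : E2 = E1.
  apply/eqP; rewrite -subr_eq0 -normr_le0; apply/ler_addgt0Pr => e e0; rewrite add0r.
  have e2' : 0 < e / 2 by rewrite divr_gt0.
  have [L1 hL1] := l1 _ e2'; have [L2 hL2] := l2 _ e2'.
  have := hL1 (maxn L1 L2) (leq_maxl _ _); have := hL2 (maxn L1 L2) (leq_maxr _ _).
  have pm : perm_eq [seq th * (mu i - v) | i <- index_enum 'I_n.+1] [seq th * (lam i - v) | i <- index_enum 'I_n.+1].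
    have := perm_map (fun z => th * (z - v)) pmu; rewrite -!map_comp.
    by congr (perm_eq _ _); apply: eq_map.
  under eq_bigr => k _ do rewrite (hsym_perm k pm).
  set S := \sum_(k < _) _ => h2 h1.
  have -> : E2 - E1 = (S - E1) - (S - E2) by ring.
  by apply: le_trans (ler_normB _ _) _; lra.
exists E1; split=> //; first by rewrite I2 e2 E12.
by rewrite I1 e1.
Qed.

End SphericalIntegrals.

(** * Quotient of the two expansions *)

Section SeriesQuotient.
Context {R : realType}.
Implicit Types (e c : nat -> R).

(* The first [k] coefficients of the inverse of [1 + \sum_(j > 0) e j X^j],
   highest degree first. *)
Fixpoint series_inv_seq e (k : nat) : seq R :=
  if k is k'.+1 then
    let s := series_inv_seq e k' in
    (if k' == 0%N then 1 else - \sum_(j < k') e j.+1 * s`_j) :: s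
  else [::].

Definition series_inv e (k : nat) : R := head 0 (series_inv_seq e k.+1).

Definition series_quot c e (k : nat) : R :=
  \sum_(j < k.+1) c j * series_inv e (k - j).

Lemma series_inv_seqE e k j : (j < k)%N -> (series_inv_seq e k)`_j = series_inv e (k.-1 - j).
Proof.
elim: k j => [//|k ih] [|j] jk; first by rewrite subn0.
by rewrite [LHS]/= ih // succnK -subn1 -subnDA.
Qed.

Lemma series_inv0 e : series_inv e 0 = 1.
Proof. by []. Qed.

Lemma series_invS e k :
  series_inv e k.+1 = - \sum_(j < k.+1) e j.+1 * series_inv e (k - j).
Proof.
rewrite /series_inv -/(series_inv_seq e k.+2) [in LHS]/=.
congr (- _); apply: eq_bigr => j _; congr (_ * _).
exact: (series_inv_seqE _ (ltn_ord j)).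
Qed.

Lemma series_inv_conv e k : e 0%N = 1 -> (0 < k)%N ->
  \sum_(j < k.+1) e j * series_inv e (k - j) = 0.
Proof.
case: k => // k e0 _; rewrite big_ord_recl subn0 e0 mul1r series_invS addrC; apply/eqP.
rewrite subr_eq0; apply/eqP; apply: eq_bigr => j _.
by rewrite /= /bump /= add1n subSS.
Qed.

Variables (n : nat) (e : nat -> R).
Hypothesis e0 : e 0%N = 1.

Let pol (f : nat -> R) : {poly R} := \poly_(l < n.+1) f l.

Let coefE f k : (k <= n)%N -> (pol f)`_k = f k.
Proof. by move=> kn; rewrite coef_poly ltnS kn. Qed.

Lemma series_quot_conv c k : (k <= n)%N ->
  (pol e * pol (series_quot c e))`_k = c k.
Proof.
move=> kn.
have EI s : (s <= n)%N -> (pol e * pol (series_inv e))`_s = (s == 0%N)%:R.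
  move=> sn; rewrite coefM; case: s sn => [|s] sn.
    by rewrite big_ord_recl big_ord0 !coefE // e0 series_inv0 mulr1 addr0.
  rewrite -[RHS](@series_inv_conv e s.+1) //; apply: eq_bigr => j _.
  by rewrite !coefE // ?(leq_trans (leq_subr _ _)) // (leq_trans _ sn) // -ltnS.
have CI s : (s <= n)%N -> (pol (series_quot c e))`_s = (pol c * pol (series_inv e))`_s.
  move=> sn; rewrite coefE // coefM; apply: eq_bigr => j _.
  by rewrite !coefE // ?(leq_trans (leq_subr _ _)) // (leq_trans _ sn) // -ltnS.
transitivity ((pol e * (pol c * pol (series_inv e)))`_k).
  rewrite !coefM; apply: eq_bigr => j _; rewrite CI ?coefM //.
  exact: leq_trans (leq_subr _ _) kn.
rewrite mulrCA coefM big_ord_recr /= subnn EI // mulr1 big1 ?add0r ?coefE // => j _.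
rewrite EI ?(leq_trans (leq_subr _ _)) //.
by rewrite subn_eq0 leqNgt ltn_ord mulr0.
Qed.

Lemma series_quot_bound B : 0 <= B -> exists B', 0 <= B' /\
  forall c, (forall k, (k <= n)%N -> `|c k| <= B) -> forall k, (k <= n)%N -> `|series_quot c e k| <= B'.
Proof.
move=> B0; pose S := \sum_(i < n.+1) `|series_inv e i|.
have S0 : 0 <= S by exact: sumr_ge0.
exists (n.+1%:R * (B * S)); split; first by rewrite !mulr_ge0.
move=> c hc k kn; apply: le_trans (ler_norm_sum _ _ _) _.
apply: le_trans (_ : \sum_(j < k.+1) B * S <= _).
  apply: ler_sum => j _; rewrite normrM; apply: ler_pM => //.
    by apply: hc; apply: leq_trans kn; rewrite -ltnS.
  have jn : (k - j < n.+1)%N by rewrite ltnS (leq_trans (leq_subr _ _)).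
  by rewrite /S (bigD1 (Ordinal jn)) //= lerDl; exact: sumr_ge0.
by rewrite sumr_const card_ord -[leLHS]mulr_natl ler_wpM2r ?mulr_ge0 // ler_nat ltnS.
Qed.

(** The product of the truncations agrees with [c] up to degree [n]; the at most [n + 1]
    coefficients of higher degree are bounded uniformly in [c]. *)
Lemma series_quot_remainder B : 0 <= B -> exists C, 0 <= C /\
  forall c, (forall k, (k <= n)%N -> `|c k| <= B) -> forall x : R, 0 <= x -> x <= 1 ->
  `|(\sum_(l < n.+1) e l * x ^+ l) * (\sum_(l < n.+1) series_quot c e l * x ^+ l) -
     \sum_(l < n.+1) c l * x ^+ l| <= C * x ^+ n.+1.
Proof.
move=> B0; have [B' [B'0 hB']] := series_quot_bound B0.
pose S := \sum_(i < n.+1) `|e i|; have S0 : 0 <= S by exact: sumr_ge0.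
exists (n.+1%:R * ((n.+1 + n.+1)%:R * (S * B'))); split; first by rewrite !mulr_ge0.
move=> c hc x x0 x1.
have polS f : (pol f).[x] = \sum_(l < n.+1) f l * x ^+ l.
  by rewrite horner_poly.
rewrite -!polS -hornerM (@horner_coef_wide _ (n.+1 + n.+1)); last first.
  apply: leq_trans (size_polyMleq _ _) _.
  apply: leq_trans (leq_pred _) _; apply: leq_add; exact: size_poly.
rewrite big_split_ord /= polS.
have -> : \sum_(i < n.+1) (pol e * pol (series_quot c e))`_i * x ^+ i = \sum_(l < n.+1) c l * x ^+ l.
  by apply: eq_bigr => i _; congr (_ * _); apply: series_quot_conv; rewrite -ltnS.
rewrite addrAC subrr add0r; apply: le_trans (ler_norm_sum _ _ _) _.
have bE k : `|(pol e)`_k| <= S.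
  rewrite coef_poly; case: ifP => [kn|_]; last by rewrite normr0.
  by rewrite /S (bigD1 (Ordinal kn)) //= lerDl; exact: sumr_ge0.
have bQ k : `|(pol (series_quot c e))`_k| <= B'.
  by rewrite coef_poly; case: ifP => [kn|_]; [exact: hB'|rewrite normr0].
apply: le_trans (_ : \sum_(i < n.+1) (n.+1 + n.+1)%:R * (S * B') * x ^+ n.+1 <= _); last first.
  by rewrite sumr_const card_ord -[leLHS]mulr_natl mulrA.
apply: ler_sum => i _; rewrite normrM; apply: ler_pM => //.
  rewrite coefM; apply: le_trans (ler_norm_sum _ _ _) _.
  apply: le_trans (_ : \sum_(j < (n.+1 + i).+1) S * B' <= _).
    by apply: ler_sum => j _; rewrite normrM; exact: ler_pM.
  rewrite sumr_const card_ord -[leLHS]mulr_natl ler_wpM2r ?mulr_ge0 // ler_nat.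
  by rewrite -addnS leq_add2l.
by rewrite ger0_norm ?exprn_ge0 // exprD ler_piMr ?exprn_ge0 // exprn_ile1.
Qed.

End SeriesQuotient.

Section LaplaceCoefficients.
Context {R : realType}.
Implicit Types A : nat -> R.

Lemma laplace_coef_eq A A' l : (forall j, (2 <= j <= l.*2.+2)%N -> A j = A' j) ->
  laplace_coef A l = laplace_coef A' l.
Proof.
move=> h; rewrite /laplace_coef h //.
have -> : gpoly A l.*2.+2 = gpoly A' l.*2.+2; last by [].
rewrite /gpoly big_nat [RHS]big_nat; apply: eq_bigr => k /andP[k3 kl].
by rewrite h // (ltnW k3).
Qed.

Lemma laplace_coef0 A : laplace_coef A 0 = (Num.sqrt (A 2%N))^-1.
Proof.
rewrite /laplace_coef big_ord_recl big_ord0 addr0 expr0 coef1 /dfact big_ord0.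
by rewrite !expr0 fact0 /= !divr1 !mulr1.
Qed.

(** The term [i = 0] vanishes; [i = 1] gives [3!! A_4 / 4 = 3/4 A_4], and [i = 2] gives
    [- 5!! (A_3 / 3)^2 / 2 = - 5/6 A_3^2], up to powers of [A_2]. *)
Lemma laplace_coef1 A : laplace_coef A 1 = (Num.sqrt (A 2%N))^-1 *
  (3 / 4 * (A 4%N / A 2%N ^+ 2) - 5 / 6 * (A 3%N ^+ 2 / A 2%N ^+ 3)).
Proof.
rewrite /laplace_coef; congr (_ * _).
rewrite !big_ord_recr big_ord0 /= expr0 expr1 coef1.
have -> : (gpoly A 1.*2.+2)`_(1 + 1).*2 = A 4%N / 4.
  by rewrite coef_gpoly /= -signr_odd /= expr0 mul1r.
have -> : (gpoly A 1.*2.+2 ^+ 2)`_(2 + 1).*2 = (A 3%N / 3) ^+ 2.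
  rewrite -[(2 + 1).*2]/6%N expr2 coefM !big_ord_recr big_ord0 /= !coef_gpoly /=.
  by rewrite !(mul0r, mulr0, add0r, addr0); field.
rewrite -[(0 + 1)%N]/1%N -[(1 + 1)%N]/2%N -[(1.*2 + 1)%N]/3%N -[1.*2]/2%N.
rewrite /dfact !big_ord_recr !big_ord0 /= !factS fact0 /=.
rewrite -[0.*2.+1]/1%N -[1.*2.+1]/3%N -[2.*2.+1]/5%N -[(2 * (1 * 1))%N]/2%N -[(1 * 1)%N]/1%N.
move: (A 2%N ^- 1) (A 2%N ^- 2) (A 2%N ^- 3) => z1 z2 z3; by field.
Qed.

End LaplaceCoefficients.

Section RatioExpansion.
Context {R : realType}.

Definition expansion_coef (k : nat) (A : nat -> R) : R :=
  series_quot (laplace_coef A) (laplace_coef (fun=> 1)) k.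

Lemma power_mean_cst1 d : (0 < d)%N -> power_mean (fun _ : 'I_d => 1 : R) = fun=> 1.
Proof.
move=> d0; apply/funext => k; rewrite /power_mean.
under eq_bigr do rewrite expr1n; rewrite sumr_const card_ord mulVf //.
by rewrite pnatr_eq0 -lt0n.
Qed.

Lemma laplace_coef_cst1 : laplace_coef (fun=> 1 : R) 0 = 1.
Proof. by rewrite laplace_coef0 sqrtr1 invr1. Qed.

(** The expansion of order [0] with unit weights gives [gauss_mass d] up to a relative error
    [C / d], at most one half once [d >= 2 C]. *)
Lemma kernel_int_ge : exists D0 : nat, forall d, (0 < d)%N -> (D0 <= d)%N ->
  gauss_mass d / 2 <= kernel_int d d :> R.
Proof.
have [C [C0 hC]] := @laplace_expansion R 0.
exists (Num.bound (2 * C)) => d d0 dD.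
have d0R : 0 < d%:R :> R by rewrite ltr0n.
have K0 : 0 < gauss_mass d :> R by exact: gauss_mass_gt0.
have := hC d (fun=> 1) d0.
rewrite power_mean_cst1 // big_ord_recl big_ord0 addr0 laplace_coef_cst1 expr0 divr1 mulr1 expr1.
rewrite -kernel_int_phi => h2.
have {h2} : `|kernel_int d d - gauss_mass d| <= C * gauss_mass d / d%:R.
  apply: h2 => [_|_|]; [lra|lra|].
  by rewrite sumr_const card_ord.
have h : 2 * C <= d%:R.
  by apply: le_trans (ltW (archi_boundP _)) _; rewrite ?mulr_ge0 // ler_nat.
have : C * gauss_mass d / d%:R <= gauss_mass d / 2.
  by rewrite ler_pdivrMr //; nra.
by rewrite ler_norml => h1 /andP[h2 _]; lra.
Qed.

Lemma ratio_expansion n : exists (C : R) (D0 : nat), 0 <= C /\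
  forall (d : nat) (a : 'I_d -> R) (G : R), (0 < d)%N -> (D0 <= d)%N ->
  (forall i, 0 < a i) -> (forall i, `|1 - (a i)^-1| <= 7^-1) ->
  \sum_(i < d) a i = d%:R ->
  (forall e, 0 < e -> exists L0, forall L, (L0 <= L)%N ->
     `|\sum_(k < L.+1) hsym (tilt a) k * kernel_weight d k - G| <= e) ->
  `|G / (\prod_(i < d) a i) -
    \sum_(k < n.+1) expansion_coef k (power_mean a) / d%:R ^+ k| <= C / d%:R ^+ n.+1.
Proof.
have [Ca [Ca0 hCa]] := @laplace_expansion R n.
have [D0 hD0] := kernel_int_ge.
(* Writes the contour error [(4/5)^d] as [e^(- d ln (5/4))], so that it is negligible against every
   power of [1/d]. *)
have ln54 : 0 < ln (5 / 4 : R) by rewrite ln_gt0 //; lra.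
have [C5 [C50 hC5]] := @expR_negligible R _ n.+1 ln54.
have /choice[b hb] := @laplace_coef_bound R.
pose B := \sum_(l < n.+1) b l.
have b0 l : 0 <= b l by case: (hb l).
have B0 : 0 <= B by exact: sumr_ge0.
have [Bq [Bq0 hBq]] := series_quot_bound n (laplace_coef (fun=> 1 : R)) B0.
have [Cq [Cq0 hCq]] := series_quot_remainder n laplace_coef_cst1 B0.
(* The factor [2] pays for dividing by [kernel_int d d >= gauss_mass d / 2]. Inside: [8 * C5] is the
   contour error, [Ca] the Laplace error of the numerator, [Cq] the remainder of the formal
   quotient, and the last term the Laplace error of the denominator times a bound on the truncated
   quotient. *)
exists (2 * (8 * C5 + Ca + Cq + n.+1%:R * Bq * Ca)), D0.
have C0 : 0 <= 8 * C5 + Ca + Cq + n.+1%:R * Bq * Ca by rewrite !addr_ge0 // !mulr_ge0.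
split; first by rewrite mulr_ge0.
move=> d a G d0 dD a0 a7 aS aL.
have a_ge i : 1 / 2 <= a i.
  have := a7 i; rewrite ler_norml => /andP[h1 h2].
  have := mulfV (lt0r_neq0 (a0 i)); have := a0 i; have : (a i)^-1 <= 8 / 7 by lra.
  by nra.
have a_le i : a i <= 2.
  have := a7 i; rewrite ler_norml => /andP[h1 h2].
  have := mulfV (lt0r_neq0 (a0 i)); have := a0 i; have : 6 / 7 <= (a i)^-1 by lra.
  by nra.
have d0R : 0 < d%:R :> R by rewrite ltr0n.
set x := d%:R^-1 : R.
have x0 : 0 <= x by rewrite invr_ge0 ltW.
have x1 : x <= 1 by rewrite invf_le1 // ler1n.
set K := gauss_mass d : R; have K0 : 0 < K by exact: gauss_mass_gt0.
set A := power_mean a.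
have Ab l : (l <= n)%N -> `|laplace_coef A l| <= B.
  move=> ln; have [_ h] := hb l; apply: le_trans (h _ _ _) _.
  - by move=> k; exact: power_mean_le.
  - exact: power_mean2_ge1.
  - have ln' : (l < n.+1)%N by [].
    by rewrite /B (bigD1 (Ordinal ln')) //= lerDl; exact: sumr_ge0.
have xk (c : nat -> R) : \sum_(l < n.+1) c l / d%:R ^+ l = \sum_(l < n.+1) c l * x ^+ l.
  by apply: eq_bigr => l _; rewrite exprVn.
have h1 := hCa d a d0 a_ge a_le aS.
have h2 : `|kernel_int d d - K * \sum_(l < n.+1) laplace_coef (fun=> 1 : R) l * x ^+ l| <= Ca * K * x ^+ n.+1.
  have := hCa d (fun=> 1) d0; rewrite -kernel_int_phi power_mean_cst1 // xk -exprVn; apply.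
  - by move=> _; lra.
  - by move=> _; lra.
  - by rewrite sumr_const card_ord.
rewrite -/K -/A xk -exprVn -/x in h1.
have h3 := contour_link d0 a0 a7 aL.
have h5 : (4 / 5 : R) ^+ d <= C5 * K * x ^+ n.+1.
  have := hC5 d d0; rewrite exprVn; congr (_ <= _).
  rewrite mulrC -mulrN expRM_natl expRN lnK ?posrE; last by lra.
  by rewrite invf_div.
have h4 := hCq _ Ab x x0 x1.
have h6 : `|\sum_(k < n.+1) expansion_coef k A * x ^+ k| <= n.+1%:R * Bq.
  apply: le_trans (ler_norm_sum _ _ _) _; rewrite mulrC; apply: sum_le_card_mul => k.
  rewrite normrM -[leRHS]mulr1; apply: ler_pM => //.
    by apply: hBq => //; rewrite -ltnS.
  by rewrite ger0_norm ?exprn_ge0 // exprn_ile1.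
have h7 := hD0 d d0 dD.
rewrite xk -exprVn -/x -/A.
set G' := G / _ in h3 *; set X := x ^+ n.+1 in h1 h2 h4 h5 *.
have X0 : 0 <= X by exact: exprn_ge0.
set Q := \sum_(k < n.+1) expansion_coef k A * x ^+ k in h6 *.
have {}h4 : `|(\sum_(l < n.+1) laplace_coef (fun=> 1 : R) l * x ^+ l) * Q -
   \sum_(l < n.+1) laplace_coef A l * x ^+ l| <= Cq * X by exact: h4.
set Se := \sum_(l < n.+1) laplace_coef (fun=> 1) l * x ^+ l in h2 h4.
set Sc := \sum_(l < n.+1) laplace_coef A l * x ^+ l in h1 h4.
set fa := intg _ _ _ in h1 h3; set f1 := kernel_int d d in h2 h3 h7.
have f10 : 0 < f1 by apply: lt_le_trans h7; rewrite divr_gt0.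
have key : `|(G' - Q) * f1| <= (8 * C5 + Ca + Cq + n.+1%:R * Bq * Ca) * (K * X).
  have -> : (G' - Q) * f1 = - (fa - G' * f1) + (fa - K * Sc) - K * (Se * Q - Sc) - Q * (f1 - K * Se).
    by ring.
  have g4 : `|K * (Se * Q - Sc)| <= K * (Cq * X) by rewrite normrM gtr0_norm // ler_wpM2l // ltW.
  have g6 : `|Q * (f1 - K * Se)| <= n.+1%:R * Bq * (Ca * K * X) by rewrite normrM; apply: ler_pM.
  apply: le_trans (ler_normB _ _) _; apply: le_trans (lerD (le_trans (ler_normB _ _) (lerD (ler_normD _ _) (lexx _))) (lexx _)) _.
  by rewrite normrN; lra.
rewrite normrM (gtr0_norm f10) in key.
have n0 := normr_ge0 (G' - Q).
have : `|G' - Q| * (K / 2) <= (8 * C5 + Ca + Cq + n.+1%:R * Bq * Ca) * (K * X).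
  by apply: le_trans key; apply: ler_wpM2l.
rewrite (_ : `|G' - Q| * (K / 2) = (`|G' - Q| / 2) * K); last by ring.
rewrite (_ : _ * (K * X) = (8 * C5 + Ca + Cq + n.+1%:R * Bq * Ca) * X * K); last by ring.
by rewrite ler_pM2r //; lra.
Qed.

Lemma expansion_coef_eq k (A A' : nat -> R) n : (k <= n)%N ->
  (forall j, (2 <= j <= n.*2.+2)%N -> A j = A' j) -> expansion_coef k A = expansion_coef k A'.
Proof.
move=> kn h; apply: eq_bigr => j _; congr (_ * _); apply: laplace_coef_eq => i /andP[i2 ij].
apply: h; rewrite i2 (leq_trans ij) // !ltnS leq_double.
by rewrite (leq_trans _ kn) // -ltnS.
Qed.

Lemma expansion_coef0 (A : nat -> R) : expansion_coef 0 A = 1 / Num.sqrt (A 2%N).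
Proof.
by rewrite /expansion_coef /series_quot big_ord_recl big_ord0 addr0 series_inv0 mulr1 laplace_coef0 div1r.
Qed.

(** The quotient contributes [c_1 - c_0 e_1], where [e_1 = 3/4 - 5/6 = -1/12] is the coefficient for
    unit weights (up to sign, that of Stirling's series); it produces the [1/6]. *)
Lemma expansion_coef1 (A : nat -> R) : expansion_coef 1 A = 1 / (2 * Num.sqrt (A 2%N)) *
  (3 / 2 * (A 4%N / A 2%N ^+ 2) - 5 / 3 * (A 3%N ^+ 2 / A 2%N ^+ 3) + 1 / 6).
Proof.
rewrite /expansion_coef /series_quot !big_ord_recl big_ord0 addr0 subn0 subnn.
rewrite series_inv0 series_invS big_ord_recl big_ord0 addr0 subnn series_inv0.
rewrite -[nat_of_ord (lift _ _)]/1%N -[(nat_of_ord ord0).+1]/1%N laplace_coef0 !laplace_coef1 sqrtr1 invr1 !expr1n div1r [(2 * _)^-1]invfM.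
move: (Num.sqrt (A 2%N))^-1 (A 2%N ^- 2) (A 2%N ^- 3) => z z2 z3; by field.
Qed.

End RatioExpansion.

(** The finitely many sizes below [D0] are absorbed into the constant. *)
Lemma eventually_bounded {R : realType} (r : nat -> R) (n : nat) (C : R) (D0 : nat) : 0 <= C ->
  (forall N, (D0 <= N.+1)%N -> `|r N| <= C / N.+1%:R ^+ n) ->
  exists C', 0 < C' /\ forall N, `|r N| <= C' / N.+1%:R ^+ n.
Proof.
move=> C0 h; pose S := \sum_(N < D0) `|r N| * N.+1%:R ^+ n.
have S0 : 0 <= S by apply: sumr_ge0 => N _; rewrite mulr_ge0 ?exprn_ge0.
have p N : 0 < N.+1%:R ^+ n :> R by rewrite exprn_gt0 // ltr0n.
exists (C + S + 1); split; first by rewrite ltr_wpDl // addr_ge0.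
move=> N; rewrite ler_pdivlMr //; have [ND|DN] := ltnP N.+1 D0.
  have : `|r N| * N.+1%:R ^+ n <= S.
    rewrite /S (bigD1 (Ordinal (ltnW ND))) //= lerDl.
    by apply: sumr_ge0 => i _; rewrite mulr_ge0 ?exprn_ge0.
  by lra.
by have := h N DN; rewrite ler_pdivlMr //; lra.
Qed.

Lemma spectral_norm_ge {R : realType} n (lam : 'I_n.+1 -> R) i : `|lam i| <= spectral_norm lam.
Proof. exact: le_bigmax. Qed.

Theorem theorem3 (R : realType) :
  exists m : nat -> R -> R -> (nat -> R) -> R,
  forall n : nat,
    (forall (k : nat) (theta v : R) (a a' : nat -> R), (k <= n)%N ->
       (forall j : nat, (2 <= j <= n.*2.+2)%N -> a j = a' j) ->
       m k theta v a = m k theta v a') /\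
    forall (M theta : R)
      (B : forall N : nat, 'M[R[i]%C]_N.+1)
      (lam : forall N : nat, 'I_N.+1 -> R)
      (haarU : forall N : nat, probability (complex_matrices R N.+1) R)
      (haarO : forall N : nat, probability (real_matrices R N.*2.+2) R),
      0 < M ->
      (forall N, B N \is hermsymmx) ->
      (forall N, eigenvalues_of (B N) (lam N)) ->
      (ereal_sup (range (fun N => (spectral_norm (lam N))%:E)) < M%:E)%E ->
      theta != 0 ->
      `|theta| < (4 * M ^+ 2 + 10 * M + 1)^-1 ->
      (forall N, is_haar_probability (@complex_cylinders R N.+1)
                   (@unitary_group R N.+1) (haarU N)) ->
      (forall N, is_haar_probability (@real_cylinders R N.*2.+2)
                   (@orthogonal_group R N.*2.+2) (haarO N)) ->
      let v N := Rtransform (lam N) theta in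
      let A N := Acoef (lam N) theta in
      let I2 N := spherical_integral2 (haarU N) theta (B N) in
      [/\ forall N, I2 N =
            spherical_integral1 (haarO N) (theta / 2) (doubled_diag (lam N)),
          exists C : R, 0 < C /\ exists r : nat -> R,
            forall N,
              `|r N| <= C / N.+1%:R ^+ n.+1 /\
              I2 N =
                expR (N.+1%:R *
                      oriented_integral (Rtransform (lam N)) 0 theta) *
                (\sum_(k < n.+1) m k theta (v N) (A N) / N.+1%:R ^+ k + r N),
          forall N, m 0%N theta (v N) (A N) = 1 / Num.sqrt (A N 2%N) &
          forall N, m 1%N theta (v N) (A N) =
            1 / (2 * Num.sqrt (A N 2%N)) *
            (3 / 2 * (A N 4%N / A N 2%N ^+ 2)
             - 5 / 3 * (A N 3%N ^+ 2 / A N 2%N ^+ 3) + 1 / 6)].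
Proof.
exists (fun k _ _ A => expansion_coef k A) => n; split.
  by move=> k _ _ a a' kn h; exact: (expansion_coef_eq kn h).
move=> M theta B lam haarU haarO M0 hB eB supM th0 thM hU hO v A I2.
have lamM N i : `|lam N i| <= M.
  apply: le_trans (spectral_norm_ge (lam N) i) _; rewrite -lee_fin.
  by apply: le_trans (ltW supM); apply: ereal_sup_ubound; exists N.
(* [(2 M - 1)^2 >= 0] gives [14 M <= 4 M^2 + 10 M + 1]. *)
have ss : 14 * M * `|theta| < 1.
  have q0 : 0 < 4 * M ^+ 2 + 10 * M + 1 by have := sqr_ge0 M; lra.
  have := thM; rewrite -[X in _ < X]div1r ltr_pdivlMr // => h.
  apply: le_lt_trans h; rewrite mulrC ler_wpM2l //.
  by have := sqr_ge0 (2 * M - 1); lra.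
have sw : small_slope M theta by exact: ltW.
pose a N (i : 'I_N.+1) := (1 - theta * (lam N i - v N))^-1.
have vP N := Rtransform_props M0 (lamM N) th0 sw.
have xb N i : `|theta * (lam N i - v N)| <= 7^-1.
  by have [vM _] := vP N; exact: (slope_bound (lamM N) i sw vM).
have a7 N i : `|1 - (a N i)^-1| <= 7^-1.
  by rewrite /a invrK opprB addrC subrK; exact: xb.
have a0 N i : 0 < a N i.
  by rewrite invr_gt0; have := xb N i; rewrite ler_norml => /andP[_]; lra.
have aS N : \sum_(i < N.+1) a N i = N.+1%:R by have [] := vP N.
have AE N k : (0 < k)%N -> A N k = power_mean (a N) k.
  by move=> k0; exact: (Acoef_power_mean M0 (lamM N) th0 sw k0).
(* [Acoef] at index [0] is [theta], not the mean of the [a_i ^ 0]. Only indices from [2] on enter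
   the coefficients, so the two sequences may be exchanged. *)
have mE N k : expansion_coef k (A N) = expansion_coef k (power_mean (a N)).
  by apply: (@expansion_coef_eq _ _ _ _ k) => // j /andP[j2 _]; rewrite AE // ltnW.
have I21 N := spherical_integrals theta (v N) (hB N) (eB N) (hU N) (hO N).
split.
- by move=> N; have [E [_ e2 e1]] := I21 N; rewrite /I2 e2 e1.
- have [C [D0 [C0 hC]]] := @ratio_expansion R n.
  pose W N := expR (N.+1%:R * oriented_integral (Rtransform (lam N)) 0 theta).
  have W0 N : W N != 0 by rewrite gt_eqF // expR_gt0.
  (* Defined as the exact remainder, so the identity holds for every [N]; only its size is
     asymptotic information. *)
  pose r N := I2 N / W N - \sum_(k < n.+1) expansion_coef k (A N) / N.+1%:R ^+ k.
  have [N DN|C' [C'0 hC']] := @eventually_bounded R r n.+1 C D0 C0.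
    have [E [lE e2 _]] := I21 N.
    have -> : r N = E / (\prod_(i < N.+1) a N i) -
       \sum_(k < n.+1) expansion_coef k (power_mean (a N)) / N.+1%:R ^+ k.
      rewrite /r; under eq_bigr => k _ do rewrite mE; congr (_ - _).
      rewrite /I2 e2 /W (expR_Rtransform_integral M0 (lamM N) th0 ss) -/(v N).
      by rewrite -mulf_div divff ?mul1r // gt_eqF // expR_gt0.
    apply: hC => //; have <- : [seq theta * (lam N i - v N) | i <- index_enum 'I_N.+1] = tilt (a N).
      by apply: eq_map => i; rewrite /a invrK subKr.
    exact: lE.
  exists C'; split=> //; exists r => N; split=> //.
  by rewrite /r addrC subrK mulrC divfK.
- by move=> N; exact: expansion_coef0.
- by move=> N; exact: expansion_coef1.
Qed.
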